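(* Let $q\in(0,1)$, $r\in(0,\infty)$ and let $\mathcal{A}=\mathcal{O}(S_{qr}^2)$ be the unital $*$-algebra generated by $a=a^*,b,b^*$ with defining relations $$ab=q^{-2}ba,\quad ab^*=q^2b^*a,\quad b^*b=a-a^2+r\mathbf 1,\quad bb^*=q^2a-q^4a^2+r\mathbf 1,$$ with the $\mathbb{Z}$-grading determined by $a\in\mathcal{A}_0$, $b\in\mathcal{A}_1$, $b^*\in\mathcal{A}_{-1}$. Let $\mathcal{B}=\mathcal{A}_0$, let $\alpha$ be the canonical partial action of $\mathbb{Z}$ on the positive spectrum $\widehat{\mathcal{B}}^+$, let $\beta$ be the dual partial action on $C(\widehat{\mathcal{B}}^+)$, and let $\Theta=(\theta,I,J)$ be the partial automorphism of $C(\widehat{\mathcal{B}}^+)$ with $\theta=\beta_1$, $I=I_{-1}$, $J=I_1=C(\widehat{\mathcal{B}}^+)$, which defines $\beta$. Then the enveloping $C^*$-algebra $\mathfrak{A}$ of $\mathcal{A}$ is isomorphic to the covariance algebra $C^*(C(\widehat{\mathcal{B}}^+),\Theta)\simeq C(\widehat{\mathcal{B}}^+)\times_\beta\mathbb{Z}$.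
   Context: Every $*$-representation of $\mathcal{A}$ is by bounded operators; the enveloping $C^*$-algebra of $\mathcal{A}$ is the universal $C^*$-algebra for $*$-representations of $\mathcal{A}$ by bounded operators on Hilbert spaces (the separated completion of $\mathcal{A}$ in the norm $\|x\|=\sup_\pi\|\pi(x)\|$). **Partial action.** $\mathcal{B}=\mathcal{A}_0=\mathbb{C}[a]$ is commutative. $\widehat{\mathcal{B}}$ is the set of characters (nonzero $*$-homomorphisms $\mathcal{B}\to\mathbb{C}$), with the weak topology defined by the functions $\chi\mapsto\chi(x)$, $x\in\mathcal{B}$; the character $\chi_t$ with $\chi_t(a)=t\in\mathbb{R}$ is identified with $t$. $\widehat{\mathcal{B}}^+$ is the set of $\chi\in\widehat{\mathcal{B}}$ with $\chi(c^*c)\ge0$ for all homogeneous $c\in\bigcup_n\mathcal{A}_n$. For $n\in\mathbb{Z}$, $\mathcal{D}_{-n}$ is the set of $\chi\in\widehat{\mathcal{B}}^+$ with $\chi(c^*c)\neq0$ for some $c\in\mathcal{A}_n$, and $\alpha_n:\mathcal{D}_{-n}\to\mathcal{D}_n$ is $(\alpha_n(\chi))(x)=\chi(c^*xc)/\chi(c^*c)$, $x\in\mathcal B$, for any such $c$ (independent of the choice). The sets $\mathcal{D}_n$ are open and compact, the $\alpha_n$ are homeomorphisms, and they form a partial action of $\mathbb{Z}$. **Dual partial action, crossed product.** Put $I_n=C(\mathcal{D}_n)$ (a closed ideal of $C(\widehat{\mathcal{B}}^+)$) and $\beta_n:I_{-n}\to I_n$, $(\beta_n(f))(t)=f(\alpha_{-n}(t))=f(q^{2n}t)$.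 A partial automorphism $\Theta=(\theta,I,J)$ of a $C^*$-algebra $\mathfrak{B}$ consists of closed two-sided ideals $I,J$ and a $*$-isomorphism $\theta:I\to J$. It defines a partial action of $\mathbb{Z}$ by $I_0=\mathfrak{B}$, $I_{n+1}=\{x\in J\mid\theta^{-1}(x)\in I_n\}$ for $n\ge0$, $I_{n-1}=\{x\in I\mid\theta(x)\in I_n\}$ for $n\le0$, $\beta_n=\theta^n$. The partial crossed product $\mathfrak{B}\times_\beta\mathbb{Z}$ (called the covariance algebra $C^*(\mathfrak{B},\Theta)$ when $\beta$ is defined by $\Theta$) is the enveloping $C^*$-algebra of the $*$-algebra spanned by $x\otimes n$, $x\in I_n$, $n\in\mathbb{Z}$, with $(x\otimes n)(y\otimes m)=\beta_n(\beta_{-n}(x)y)\otimes(n+m)$ and $(x\otimes n)^*=\beta_{-n}(x^* )\otimes(-n)$. *)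

(* Defs.v *)
From HB Require Import structures.
From mathcomp Require Import all_boot all_order all_algebra.
From mathcomp Require Import complex finmap ring lra.
From mathcomp Require Import all_classical all_reals all_analysis.

Set Implicit Arguments.
Unset Strict Implicit.
Unset Printing Implicit Defensive.

Import Order.TTheory GRing.Theory Num.Theory.
Import numFieldNormedType.Exports.
Local Open Scope classical_set_scope.
Local Open Scope ring_scope.

Section Modulus.
Variable R : realType.
Implicit Types z w : R[i].

Definition cmod z : R := complex.Re `|z|.

Lemma cmodE z : `|z| = real_complex R (cmod z).
Proof. by rewrite /cmod normc_def. Qed.
Lemma cmod_ge0 z : 0 <= cmod z.
Proof. by have := normr_ge0 z; rewrite cmodE ler0c. Qed.
Lemma cmod_leP z (M : R) : (cmod z <= M) = (`|z| <= real_complex R M).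
Proof. by rewrite cmodE lecR. Qed.
Lemma cmod_ltP z (M : R) : (cmod z < M) = (`|z| < real_complex R M).
Proof. by rewrite cmodE ltcR. Qed.
Lemma cmodD z w : cmod (z + w) <= cmod z + cmod w.
Proof. by rewrite -lecR rmorphD -!cmodE ler_normD. Qed.
Lemma cmodM z w : cmod (z * w) = cmod z * cmod w.
Proof. by apply: (@complexI R); rewrite rmorphM -!cmodE normrM. Qed.
Lemma cmodJ z : cmod z^* = cmod z.
Proof. by apply: (@complexI R); rewrite -!cmodE norm_conjC. Qed.
Lemma cmodN z : cmod (- z) = cmod z.
Proof. by apply: (@complexI R); rewrite -!cmodE normrN. Qed.
Lemma cmodBC z w : cmod (z - w) = cmod (w - z).
Proof. by rewrite -cmodN opprB. Qed.
Lemma cmod0 : cmod 0 = 0.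
Proof. by apply: (@complexI R); rewrite -!cmodE normr0. Qed.
Lemma cmod_eq0 z : cmod z = 0 -> z = 0.
Proof. by move=> h; apply/normr0_eq0; rewrite cmodE h. Qed.
Lemma cmod_sqr z : z^* * z = real_complex R (cmod z ^+ 2).
Proof. by rewrite mulrC -normCK cmodE rmorphXn. Qed.

Lemma cmod_le_ReIm z : cmod z <= `|complex.Re z| + `|complex.Im z|.
Proof.
rewrite {1}[z]complexE; apply: le_trans (cmodD _ _) _.
have h (x : R) : cmod (real_complex R x) = `|x|.
  by rewrite /cmod normc_def /= expr0n addr0 sqrtr_sqr.
rewrite cmodM !h lerD2l.
by rewrite /cmod normc_def /= expr0n expr1n add0r sqrtr1 mul1r.
Qed.

Lemma Re_le_cmod z : `|complex.Re z| <= cmod z.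
Proof. by rewrite -lecR -cmodE normc_ge_Re. Qed.

Lemma Im_le_cmod z : `|complex.Im z| <= cmod z.
Proof.
rewrite /cmod normc_def /= -sqrtr_sqr ler_wsqrtr //.
by rewrite lerDr sqr_ge0.
Qed.

Lemma real_cauchy (u : nat -> R) :
  (forall e : R, 0 < e -> exists N : nat, forall m n : nat,
      (N <= m)%N -> (N <= n)%N -> `|u m - u n| < e) ->
  exists l, forall e : R, 0 < e -> exists N : nat, forall n,
      (N <= n)%N -> `|u n - l| < e.
Proof.
move=> hu; have : cvg (u @ \oo).
  apply: R_complete; apply: cauchy_exP => e e0.
  have [N hN] := hu e e0; exists (u N).
  exists N => // n /= hn; rewrite /ball /=; exact: hN.
move=> /cvg_ex[l /cvgrPdist_lt hl]; exists l => e e0.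
have [N _ hN] := hl e e0; exists N => n hn.
by rewrite distrC; exact: hN.
Qed.

Lemma complex_cauchy (u : nat -> R[i]) :
  (forall e : R, 0 < e -> exists N : nat, forall m n : nat,
      (N <= m)%N -> (N <= n)%N -> cmod (u m - u n) < e) ->
  exists l, forall e : R, 0 < e -> exists N : nat, forall n,
      (N <= n)%N -> cmod (u n - l) < e.
Proof.
move=> hu.
have [e e0|a ha] := @real_cauchy (fun n => complex.Re (u n)).
  have [N hN] := hu e e0; exists N => m n hm hn.
  by apply: le_lt_trans (hN _ _ hm hn); rewrite -raddfB Re_le_cmod.
have [e e0|b hb] := @real_cauchy (fun n => complex.Im (u n)).
  have [N hN] := hu e e0; exists N => m n hm hn.
  by apply: le_lt_trans (hN _ _ hm hn); rewrite -raddfB Im_le_cmod.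
exists (Complex a b) => e e0; have e20 : 0 < e / 2 by rewrite divr_gt0.
have [M hM] := ha _ e20; have [N hN] := hb _ e20.
exists (maxn M N) => n; rewrite geq_max => /andP[hm hn].
apply: le_lt_trans (cmod_le_ReIm _) _; rewrite [e]splitr !raddfB /=.
by rewrite ltrD ?hM ?hN.
Qed.

End Modulus.

HB.mixin Record isStarAlgebra (C : numClosedFieldType) A
    & GRing.Algebra C A := {
  star : A -> A;
  starK : involutive star;
  starD : {morph star : x y / x + y};
  starZ : forall (c : C) x, star (c *: x) = c^* *: star x;
  starM : forall x y, star (x * y) = star y * star x
}.

#[short(type="starAlgType")]
HB.structure Definition StarAlgebra (C : numClosedFieldType) :=
  {A of isStarAlgebra C A & GRing.Algebra C A}.

Section StarTheory.
Variables (C : numClosedFieldType) (A : starAlgType C).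
Implicit Types x : A.

Lemma star0 : star 0 = 0 :> A.
Proof. by apply: (addrI (star 0)); rewrite -starD !addr0. Qed.

Lemma starN x : star (- x) = - star x.
Proof. by apply: (addrI (star x)); rewrite -starD !subrr star0. Qed.

Lemma star1 : star 1 = 1 :> A.
Proof. by rewrite -[LHS]mulr1 -{2}[1]starK -starM mulr1 starK. Qed.

Lemma star_sum (I : Type) (s : seq I) (F : I -> A) :
  star (\sum_(i <- s) F i) = \sum_(i <- s) star (F i).
Proof. exact: (big_morph _ starD star0). Qed.

End StarTheory.

(* The norm is kept R-valued: the ring structure of a C*-algebra and the      *)
(* R[i]-valued norm of completeNormedModType have no common join.             *)
HB.mixin Record isCstarAlgebra (R : realType) A & StarAlgebra R[i] A := {
  cnorm : A -> R;
  cnormD : forall x y, cnorm (x + y) <= cnorm x + cnorm y;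
  cnormZ : forall (c : R[i]) x, cnorm (c *: x) = cmod c * cnorm x;
  cnorm0_eq0 : forall x, cnorm x = 0 -> x = 0;
  cnormM : forall x y, cnorm (x * y) <= cnorm x * cnorm y;
  cnorm_star : forall x, cnorm (star x * x) = cnorm x ^+ 2;
  cnorm_complete : forall u : nat -> A,
    (forall e : R, 0 < e -> exists N : nat, forall m n : nat,
      (N <= m)%N -> (N <= n)%N -> cnorm (u m - u n) < e) ->
    exists l, (fun n => cnorm (u n - l)) @ \oo --> (0 : R)
}.

#[short(type="cstarAlgType")]
HB.structure Definition CstarAlgebra (R : realType) :=
  {A of isCstarAlgebra R A & StarAlgebra R[i] A}.

Section CstarTheory.
Variables (R : realType) (A : cstarAlgType R).
Implicit Types x : A.

Lemma cnorm0 : cnorm (0 : A) = 0.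
Proof. by rewrite -(scale0r (0 : A)) cnormZ cmod0 mul0r. Qed.

Lemma star_mul_eq0 x : star x * x = 0 -> x = 0.
Proof.
move=> xx0; apply: cnorm0_eq0; apply/eqP; rewrite -sqrf_eq0.
by rewrite -cnorm_star xx0 cnorm0.
Qed.

End CstarTheory.

Definition star_hom (C : numClosedFieldType) (A B : starAlgType C)
    (f : A -> B) : Prop :=
  [/\ {morph f : x y / x + y},
      forall (c : C) x, f (c *: x) = c *: f x,
      {morph f : x y / x * y},
      f 1 = 1 &
      {morph f : x / star x}].

Definition star_iso (C : numClosedFieldType) (A B : starAlgType C) : Prop :=
  exists f : A -> B, star_hom f /\ bijective f.

(* The dot product is linear in its first argument. *)
Record hilbert (C : numClosedFieldType) := Hilbert {
  hilbert_sort :> completeNormedModType C;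
  dot : {dot hilbert_sort for (@Num.conj C)};
  hilbert_norm : forall x, `|x| ^+ 2 = dot x x
}.

(* Representations of the (unital) algebra A are unital; for the operator     *)
(* norms below this is no restriction, since pi 1 is a projection commuting   *)
(* with pi x.                                                                 *)
Record star_rep (C : numClosedFieldType) (A : starAlgType C) (H : hilbert C)
    (pi : A -> {linear H -> H}) : Prop := StarRep {
  rep_bounded : forall x, continuous (pi x);
  repD : forall x y v, pi (x + y) v = pi x v + pi y v;
  repZ : forall c x v, pi (c *: x) v = c *: pi x v;
  repM : forall x y v, pi (x * y) v = pi x (pi y v);
  rep1 : forall v, pi 1 v = v;
  rep_star : forall x u v, dot H (pi x u) v = dot H u (pi (star x) v)
}.

Section Envelope.
Variable R : realType.

Definition op_norm (H : hilbert R[i]) (T : H -> H) : \bar R :=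
  ereal_sup [set (complex.Re `|T v|)%:E | v in [set v : H | `|v| <= 1]].

Definition rep_norm (A : starAlgType R[i]) (x : A) : \bar R :=
  ereal_sup [set y | exists (H : hilbert R[i]) (pi : A -> {linear H -> H}),
    star_rep pi /\ y = op_norm (pi x)].

(* [iota : A -> E] presents E as the separated completion of A in rep_norm;   *)
(* in particular rep_norm is finite.                                          *)
Definition enveloping (A : starAlgType R[i]) (E : cstarAlgType R)
    (iota : A -> E) : Prop :=
  [/\ star_hom iota,
      forall x, (cnorm (iota x))%:E = rep_norm x &
      forall (y : E) (e : R), 0 < e -> exists x, cnorm (y - iota x) < e].

Definition has_envelope (A : starAlgType R[i]) : Prop :=
  exists (E : cstarAlgType R) (iota : A -> E), enveloping iota.

Definition envelopes_isomorphic (A B : starAlgType R[i]) : Prop :=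
  forall (E F : cstarAlgType R) (iota : A -> E) (kappa : B -> F),
    enveloping iota -> enveloping kappa -> star_iso E F.

End Envelope.

Section PartialActions.
Variables (R : realType) (B : cstarAlgType R).

(* Closed under the involution: automatic for closed two-sided ideals of a    *)
(* C*-algebra, so this does not restrict the notion.                          *)
Record closed_ideal (I : set B) : Prop := ClosedIdeal {
  ideal0 : I 0;
  idealD : forall x y, I x -> I y -> I (x + y);
  idealMl : forall x y, I y -> I (x * y);
  idealMr : forall x y, I x -> I (x * y);
  ideal_star : forall x, I x -> I (star x);
  ideal_closed : forall (u : nat -> B) (l : B), (forall n, I (u n)) ->
    (fun n => cnorm (u n - l)) @ \oo --> (0 : R) -> I l
}.

Record star_iso_on (I J : set B) (f : B -> B) : Prop := StarIsoOn {
  iso_bij : set_bij I J f;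
  isoD : forall x y, I x -> I y -> f (x + y) = f x + f y;
  isoZ : forall (c : R[i]) x, I x -> f (c *: x) = c *: f x;
  isoM : forall x y, I x -> I y -> f (x * y) = f x * f y;
  iso_star : forall x, I x -> f (star x) = star (f x)
}.

(* [pa_act P n] is only meaningful on [pa_dom P (- n)]. *)
Record pa_data := PaData { pa_dom : int -> set B; pa_act : int -> B -> B }.

Record is_paction (P : pa_data) : Prop := IsPaction {
  pa_dom0 : pa_dom P 0 = setT;
  pa_act0 : forall x, pa_act P 0 x = x;
  pa_ideal : forall n, closed_ideal (pa_dom P n);
  pa_iso : forall n, star_iso_on (pa_dom P (- n)) (pa_dom P n) (pa_act P n);
  pa_comp : forall m n x, pa_dom P (- n) x -> pa_dom P (- m) (pa_act P n x) ->
    pa_dom P (- (m + n)) x /\ pa_act P (m + n) x = pa_act P m (pa_act P n x)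
}.

Record paction := Paction { paction_data :> pa_data;
                            pactionP : is_paction paction_data }.

Definition same_paction (P Q : pa_data) : Prop :=
  (forall n, pa_dom P n = pa_dom Q n) /\
  (forall n x, pa_dom P (- n) x -> pa_act P n x = pa_act Q n x).

Record pauto_data := PautoData {
  pauto_I : set B; pauto_J : set B; pauto_theta : B -> B }.

Record is_pauto (T : pauto_data) : Prop := IsPauto {
  pautoI : closed_ideal (pauto_I T);
  pautoJ : closed_ideal (pauto_J T);
  pauto_iso : star_iso_on (pauto_I T) (pauto_J T) (pauto_theta T)
}.

Section OfPauto.
Variable T : pauto_data.
Let I := pauto_I T.
Let J := pauto_J T.
Let theta := pauto_theta T.
Let theta_inv : B -> B := 'pinv_(fun=> 0) I theta.

Fixpoint pauto_posdom (n : nat) : set B :=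
  if n is m.+1 then [set x | J x /\ pauto_posdom m (theta_inv x)] else setT.

Fixpoint pauto_negdom (n : nat) : set B :=
  if n is m.+1 then [set x | I x /\ pauto_negdom m (theta x)] else setT.

Definition pa_of_pauto : pa_data := {|
  pa_dom := fun n => match n with
    | Posz m => pauto_posdom m | Negz m => pauto_negdom m.+1 end;
  pa_act := fun n => match n with
    | Posz m => iter m theta | Negz m => iter m.+1 theta_inv end |}.

End OfPauto.

Section Crossed.
Variable P : paction.
Local Notation dom := (pa_dom P).
Local Notation act := (pa_act P).
Let hP := pactionP P.

Definition crossed_pred : {pred int -> B} := fun f =>
  `[< finite_set [set n | f n != 0] /\ forall n, dom n (f n) >].

(* The formal sum of the x (x) n, x in I_n, is encoded by its family of       *)
(* coefficients.                                                              *)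
Record crossed := Crossed {
  crossed_fun :> int -> B; crossed_funP : crossed_fun \in crossed_pred }.

HB.instance Definition _ := [isSub for crossed_fun].
HB.instance Definition _ := [Choice of crossed by <:].

Lemma crossedP (f : int -> B) :
  reflect (finite_set [set n | f n != 0] /\ forall n, dom n (f n))
          (f \in crossed_pred).
Proof. exact: asboolP. Qed.

Lemma pa_domZ n (c : R[i]) x : dom n x -> dom n (c *: x).
Proof. by rewrite -mulr_algl; apply: idealMl; exact: pa_ideal. Qed.

Lemma pa_domB n x y : dom n x -> dom n y -> dom n (x - y).
Proof.
move=> hx hy; apply: (idealD (pa_ideal hP n)) => //.
by rewrite -scaleN1r; exact: pa_domZ.
Qed.

Lemma crossed_submod : submod_closed crossed_pred.
Proof.
split=> [|c f g /crossedP[ff df] /crossedP[fg dg]]; apply/crossedP; split.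
- by rewrite (_ : [set _ | _] = set0) // -subset0 => n /=; rewrite eqxx.
- by move=> n; exact: (ideal0 (pa_ideal hP n)).
- apply: (sub_finite_set _ (_ : finite_set
    ([set n | f n != 0] `|` [set n | g n != 0]))); last by rewrite finite_setU.
  move=> n /=; have [f0|] := eqVneq (f n) 0; last by left.
  have [g0|] := eqVneq (g n) 0; last by right.
  have -> : (c *: f + g) n = c *: f n + g n by [].
  by rewrite f0 g0 scaler0 addr0 eqxx.
- move=> n; apply: (idealD (pa_ideal hP n)); last exact: dg.
  by apply: pa_domZ; exact: df.
Qed.

HB.instance Definition _ :=
  GRing.isSubmodClosed.Build R[i] (int -> B) crossed_pred crossed_submod.
HB.instance Definition _ := [SubChoice_isSubLmodule of crossed by <:].

Lemma act_dom n x : dom (- n) x -> dom n (act n x).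
Proof. by case: (iso_bij (pa_iso hP n)) => h _ _ /h. Qed.

Lemma actV_dom n x : dom n x -> dom (- n) (act (- n) x).
Proof. by move=> dx; apply: act_dom; rewrite opprK. Qed.

Lemma actK n x : dom (- n) x -> act (- n) (act n x) = x.
Proof.
move=> dx; have [] := @pa_comp _ hP (- n) n x dx.
  by rewrite opprK; exact: act_dom.
by rewrite addNr pa_act0.
Qed.

Lemma actVK n x : dom n x -> act n (act (- n) x) = x.
Proof. by move=> dx; rewrite -{1}[n]opprK actK // opprK. Qed.

Lemma act_inter m n x : dom (- n) x -> dom m x ->
  dom (n + m) (act n x) /\ act (- (n + m)) (act n x) = act (- m) x.
Proof.
move=> dx dmx; have := @pa_comp _ hP (- m) (- n) (act n x).
rewrite opprK actK // opprK => /(_ (act_dom dx) dmx)[].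
by rewrite -opprD opprK addrC.
Qed.

Definition cterm n x y := act n (act (- n) x * y).

Lemma cterm_in n x y : dom n x -> dom (- n) (act (- n) x * y).
Proof. by move=> dx; apply: (idealMr (pa_ideal hP _)); exact: actV_dom. Qed.

Lemma cterm_dom n x y : dom n x -> dom n (cterm n x y).
Proof. by move=> dx; apply: act_dom; exact: cterm_in. Qed.

Lemma cterm_domD n m x y : dom n x -> dom m y -> dom (n + m) (cterm n x y).
Proof.
move=> dx dy; have [] // := act_inter (cterm_in y dx) (m := m).
exact: (idealMl (pa_ideal hP m)).
Qed.

Lemma actD n x y : dom (- n) x -> dom (- n) y ->
  act n (x + y) = act n x + act n y.
Proof. exact: (isoD (pa_iso hP n)). Qed.

Lemma actM n x y : dom (- n) x -> dom (- n) y ->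
  act n (x * y) = act n x * act n y.
Proof. exact: (isoM (pa_iso hP n)). Qed.

Lemma actVD n x y : dom n x -> dom n y ->
  act (- n) (x + y) = act (- n) x + act (- n) y.
Proof. by move=> dx dy; apply: actD; rewrite opprK. Qed.

Lemma actVM n x y : dom n x -> dom n y ->
  act (- n) (x * y) = act (- n) x * act (- n) y.
Proof. by move=> dx dy; apply: actM; rewrite opprK. Qed.

Lemma actZ n (c : R[i]) x : dom (- n) x -> act n (c *: x) = c *: act n x.
Proof. exact: (isoZ (pa_iso hP n)). Qed.

Lemma actVZ n (c : R[i]) x : dom n x -> act (- n) (c *: x) = c *: act (- n) x.
Proof. by move=> dx; apply: actZ; rewrite opprK. Qed.

Lemma act0 n : act n 0 = 0.
Proof.
by rewrite -(scale0r 0) actZ ?scale0r //; exact: (ideal0 (pa_ideal hP _)).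
Qed.

Lemma act_star n x : dom (- n) x -> act n (star x) = star (act n x).
Proof. exact: (iso_star (pa_iso hP n)). Qed.

Lemma actV_star n x : dom n x -> act (- n) (star x) = star (act (- n) x).
Proof. by move=> dx; apply: act_star; rewrite opprK. Qed.

Lemma cterm0r n x : cterm n x 0 = 0.
Proof. by rewrite /cterm mulr0 act0. Qed.

Lemma cterm0l n y : cterm n 0 y = 0.
Proof. by rewrite /cterm act0 mul0r act0. Qed.

Lemma ctermDr n x y z : dom n x ->
  cterm n x (y + z) = cterm n x y + cterm n x z.
Proof. by move=> dx; rewrite /cterm mulrDr actD //; exact: cterm_in. Qed.

Lemma ctermDl n x y z : dom n x -> dom n y ->
  cterm n (x + y) z = cterm n x z + cterm n y z.
Proof.
by move=> dx dy; rewrite /cterm actVD // mulrDl actD //; exact: cterm_in.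
Qed.

Lemma ctermZr n (c : R[i]) x y : dom n x -> cterm n x (c *: y) = c *: cterm n x y.
Proof. by move=> dx; rewrite /cterm -scalerAr actZ //; exact: cterm_in. Qed.

Lemma ctermZl n (c : R[i]) x y : dom n x -> cterm n (c *: x) y = c *: cterm n x y.
Proof.
by move=> dx; rewrite /cterm actVZ // -scalerAl actZ //; exact: cterm_in.
Qed.

(* Both sides lie in I_m and have the same product with every element of I_m. *)
Lemma act_pull m x y z : dom m y ->
  cterm m (x * y) z = x * cterm m y z.
Proof.
move=> dy; have dxy : dom m (x * y) by apply: (idealMl (pa_ideal hP m)).
have key v : dom m v -> v * cterm m (x * y) z = v * (x * cterm m y z).
  move=> dv; have dvx : dom m (v * x) by apply: (idealMr (pa_ideal hP m)).
  rewrite mulrA -{1}(actVK dv) -(actVK dvx) /cterm -!actM //;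
    try exact: cterm_in; try exact: actV_dom.
  by rewrite !mulrA -!actVM // mulrA.
apply/eqP; rewrite -subr_eq0; apply/eqP; apply: star_mul_eq0.
rewrite mulrBr key ?subrr //; apply: (ideal_star (pa_ideal hP m)).
apply: pa_domB; first exact: cterm_dom.
by apply: (idealMl (pa_ideal hP m)); exact: cterm_dom.
Qed.

Lemma cterm_assoc n m x y z : dom n x -> dom m y ->
  cterm (n + m) (cterm n x y) z = cterm n x (cterm m y z).
Proof.
move=> dx dy; rewrite {3}/cterm -act_pull //.
set u := act (- n) x * y.
have du : dom (- n) u by exact: cterm_in.
have dmu : dom m u by apply: (idealMl (pa_ideal hP m)).
have [_ e] := act_inter du dmu; rewrite {1}/cterm /cterm -/u e.
set w := act (- m) u * z.
have dw : dom (- m) w by exact: cterm_in.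
have dnmw : dom (- (n + m)) w.
  apply: (idealMr (pa_ideal hP _)).
  have [] := @act_inter (- n) (- m) u; rewrite ?opprK //.
  by rewrite -opprD addrC.
have dmw : dom (- n) (act m w).
  have [] // := @act_inter (- (n + m)) m w dw dnmw.
  by rewrite opprD addrCA subrr addr0.
by have [_ ->] := @pa_comp _ hP n m w dw dmw.
Qed.

Lemma star_cterm n m x y : dom n x -> dom m y ->
  act (- (n + m)) (star (cterm n x y)) =
  cterm (- m) (act (- m) (star y)) (act (- n) (star x)).
Proof.
move=> dx dy; have du := cterm_in y dx.
have dmu : dom m (act (- n) x * y) by apply: (idealMl (pa_ideal hP m)).
have [dnm e] := act_inter du dmu.
rewrite actV_star // /cterm e -actV_star // starM -actV_star //.
rewrite opprK actVK //; exact: (ideal_star (pa_ideal hP m)).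
Qed.

Section Support.
Implicit Types f g h : crossed.

Lemma crossed_dom f n : dom n (f n).
Proof. by have /crossedP[_] := crossed_funP f. Qed.

Definition csupp f : {fset int} := fset_set [set n | f n != 0].

Lemma csuppP f n : n \notin csupp f -> f n = 0.
Proof.
have /crossedP[ff _] := crossed_funP f.
by rewrite in_fset_set // notin_setE /= => /negP/negPn/eqP.
Qed.

Lemma finite_fset_supp (F : int -> B) (s : {fset int}) :
  (forall n, n \notin s -> F n = 0) -> finite_set [set n | F n != 0].
Proof.
move=> h; apply: sub_finite_set (finite_fset s) => n /=.
by apply: contraNT => /h ->.
Qed.

Definition cmul_fun f g : int -> B :=
  fun k => \sum_(n \in setT) cterm n (f n) (g (k - n)).

Lemma cmulE f g (s : {fset int}) k : (forall n, n \notin s -> f n = 0) ->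
  cmul_fun f g k = \sum_(n <- s) cterm n (f n) (g (k - n)).
Proof. by move=> h; apply: fsbigTE => n /h ->; rewrite cterm0l. Qed.

Lemma cmul_subproof f g : cmul_fun f g \in crossed_pred.
Proof.
apply/crossedP; split=> [|k].
  apply: (@finite_fset_supp _ [fset (p.1 + p.2)%R | p in csupp f `*` csupp g]%fset).
  move=> k hk; rewrite (cmulE _ _ (@csuppP f)) big_seq big1 // => n nf.
  rewrite (@csuppP g) ?cterm0r //; apply: contra hk => ng.
  by apply/imfsetP; exists (n, k - n) => /=; rewrite ?inE ?nf ?ng // addrC subrK.
rewrite (cmulE _ _ (@csuppP f)); elim/big_ind: _ => //.
- exact: (ideal0 (pa_ideal hP k)).
- exact: (idealD (pa_ideal hP k)).
- move=> n _; rewrite -[k in dom k](subrK n) addrC.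
  apply: cterm_domD; exact: crossed_dom.
Qed.
Definition cmul f g : crossed := Crossed (cmul_subproof f g).

Definition cone_fun : int -> B := fun n => if n == 0 then 1 else 0.
Lemma cone_subproof : cone_fun \in crossed_pred.
Proof.
apply/crossedP; split=> [|n].
  apply: (@finite_fset_supp _ [fset 0]%fset) => n; rewrite inE => /negPf h.
  by rewrite /cone_fun h.
rewrite /cone_fun; case: eqP => [->|_]; first by rewrite (pa_dom0 hP).
exact: (ideal0 (pa_ideal hP n)).
Qed.
Definition cone : crossed := Crossed cone_subproof.

Definition cstar_fun f : int -> B := fun n => act n (star (f (- n))).
Lemma cstar_subproof f : cstar_fun f \in crossed_pred.
Proof.
apply/crossedP; split=> [|n].
  apply: (@finite_fset_supp _ [fset - n | n in csupp f]%fset) => n hn.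
  rewrite /cstar_fun csuppP ?star0 ?act0 //; apply: contra hn => hn.
  by apply/imfsetP; exists (- n) => //=; rewrite opprK.
apply: act_dom; apply: (ideal_star (pa_ideal hP _)); exact: crossed_dom.
Qed.
Definition cstar f : crossed := Crossed (cstar_subproof f).

Lemma cmulEs f g (s : {fset int}) k : (forall n, n \notin s -> f n = 0) ->
  cmul f g k = \sum_(n <- s) cterm n (f n) (g (k - n)).
Proof. exact: cmulE. Qed.

Lemma crossed_eq f g : (forall n, f n = g n) -> f = g.
Proof. by move=> e; apply/val_inj/funext. Qed.

Lemma crossedD f g n : (f + g) n = f n + g n. Proof. by []. Qed.
Lemma crossedZ (c : R[i]) f n : (c *: f) n = c *: f n. Proof. by []. Qed.

Lemma csupp2l f g n : n \notin (csupp f `|` csupp g)%fset -> f n = 0.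
Proof. by rewrite inE negb_or => /andP[/csuppP]. Qed.
Lemma csupp2r f g n : n \notin (csupp f `|` csupp g)%fset -> g n = 0.
Proof. by rewrite inE negb_or => /andP[_ /csuppP]. Qed.

Lemma cmulDl : left_distributive cmul +%R.
Proof.
move=> f g h; apply: crossed_eq => k.
rewrite crossedD (cmulEs _ _ (@csupp2l f g)) (cmulEs _ _ (@csupp2r f g)).
rewrite (@cmulEs _ _ (csupp f `|` csupp g)%fset) -?big_split /=; last first.
  by move=> n hn; rewrite -[LHS]/(f n + g n) (csupp2l hn) (csupp2r hn) addr0.
apply: eq_bigr => n _; rewrite -ctermDl //; exact: crossed_dom.
Qed.

Lemma cmulDr : right_distributive cmul +%R.
Proof.
move=> f g h; apply: crossed_eq => k.
rewrite crossedD !(cmulEs _ _ (@csuppP f)) -big_split /=.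
by apply: eq_bigr => n _; rewrite -ctermDr //; exact: crossed_dom.
Qed.

Lemma cmulZl (c : R[i]) f g : c *: cmul f g = cmul (c *: f) g.
Proof.
apply: crossed_eq => k; rewrite crossedZ (cmulEs _ _ (@csuppP f)) scaler_sumr.
rewrite (@cmulEs _ _ (csupp f)); last first.
  by move=> n hn; rewrite -[LHS]/(c *: f n) (csuppP hn) scaler0.
by apply: eq_bigr => n _; rewrite -ctermZl //; exact: crossed_dom.
Qed.

Lemma cmulZr (c : R[i]) f g : c *: cmul f g = cmul f (c *: g).
Proof.
apply: crossed_eq => k; rewrite crossedZ !(cmulEs _ _ (@csuppP f)) scaler_sumr.
by apply: eq_bigr => n _; rewrite -ctermZr //; exact: crossed_dom.
Qed.

Lemma cmul1l : left_id cone cmul.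
Proof.
move=> f; apply: crossed_eq => k; rewrite (@cmulEs _ _ [fset 0]%fset).
  rewrite big_seq_fset1 /= /cone_fun eqxx subr0 /cterm oppr0.
  by rewrite !(pa_act0 hP) mul1r.
by move=> n; rewrite inE => /negPf h; rewrite /= /cone_fun h.
Qed.

Lemma cmul1r : right_id cone cmul.
Proof.
move=> f; apply: crossed_eq => k.
rewrite (@cmulEs _ _ (k |` csupp f)%fset); last first.
  by move=> n; rewrite !inE negb_or => /andP[_ /csuppP].
rewrite (big_fsetD1 k) ?fset1U1 //= big_seq big1 => [|n].
  rewrite addr0 /cone_fun subrr eqxx /cterm mulr1 actVK //; exact: crossed_dom.
rewrite !inE => /andP[nk _]; rewrite /cone_fun subr_eq0 eq_sym (negPf nk).
exact: cterm0r.
Qed.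

Lemma cterm_sumr (I : Type) (s : seq I) n x (F : I -> B) : dom n x ->
  cterm n x (\sum_(i <- s) F i) = \sum_(i <- s) cterm n x (F i).
Proof.
by move=> dx; apply: (big_morph _ _ (cterm0r n x)) => y z; rewrite ctermDr.
Qed.

Lemma cterm_suml (I : Type) (s : seq I) n y (F : I -> B) :
  (forall i, dom n (F i)) ->
  cterm n (\sum_(i <- s) F i) y = \sum_(i <- s) cterm n (F i) y.
Proof.
move=> dF; elim: s => [|i s IHs]; first by rewrite !big_nil cterm0l.
rewrite !big_cons ctermDl ?IHs //; elim/big_ind: _ => //.
  exact: (ideal0 (pa_ideal hP n)).
exact: (idealD (pa_ideal hP n)).
Qed.

Lemma cmulA : associative cmul.
Proof.
move=> f g h; apply: crossed_eq => k.
pose s := [fset (p.1 + p.2)%R | p in csupp f `*` csupp g]%fset.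
have hs p : p \notin s -> cmul f g p = 0.
  move=> hp; rewrite (cmulEs _ _ (@csuppP f)) big_seq big1 // => n nf.
  rewrite (@csuppP g) ?cterm0r //; apply: contra hp => ng.
  by apply/imfsetP; exists (n, p - n) => /=; rewrite ?inE ?nf ?ng // addrC subrK.
rewrite (cmulEs _ _ (@csuppP f)) (cmulEs _ _ hs).
under [RHS]eq_bigr => p _.
  rewrite (cmulEs _ _ (@csuppP f)) cterm_suml; last first.
    move=> n; rewrite -[p in dom p](subrK n) addrC.
    apply: cterm_domD; exact: crossed_dom.
  over.
rewrite exchange_big /=; apply: eq_big_seq => n nf.
rewrite -(fsbigTE s (fun p => cterm p (cterm n (f n) (g (p - n))) (h (k - p)))).
  rewrite (reindex_fsbigT (+%R n)); last first.
    by exists (+%R (- n)) => m; rewrite ?addKr ?addNKr.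
  have -> : cmul_fun g h (k - n) =
     \sum_(m <- csupp g) cterm m (g m) (h (k - n - m)) by exact: cmulE (@csuppP g).
  rewrite cterm_sumr; last exact: crossed_dom.
  rewrite (fsbigTE (csupp g)) => [|m /csuppP g0].
    apply: eq_bigr => m _; have -> : n + m - n = m by rewrite addrC addKr.
    by rewrite cterm_assoc ?opprD ?addrA //; exact: crossed_dom.
  have -> : n + m - n = m by rewrite addrC addKr.
  by rewrite g0 cterm0r cterm0l.
move=> p hp; rewrite (@csuppP g) ?cterm0r ?cterm0l //.
apply: contra hp => ng; apply/imfsetP; exists (n, p - n) => /=.
  by rewrite inE nf ng.
by rewrite addrC subrK.
Qed.

Lemma cone_neq0 : cone != 0.
Proof.
apply/eqP => /(congr1 (fun f : crossed => f 0)) /=.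
by rewrite /cone_fun eqxx => /eqP; rewrite oner_eq0.
Qed.

Lemma cstarK : involutive cstar.
Proof.
move=> f; apply: crossed_eq => n /=; rewrite /cstar_fun /= /cstar_fun opprK.
have df : dom n (star (f n)).
  by apply: (ideal_star (pa_ideal hP n)); exact: crossed_dom.
by rewrite -actV_star // starK actVK //; exact: crossed_dom.
Qed.

Lemma dom_star f n : dom n (star (f n)).
Proof. by apply: (ideal_star (pa_ideal hP n)); exact: crossed_dom. Qed.

Lemma cstarD : {morph cstar : f g / f + g}.
Proof.
move=> f g; apply: crossed_eq => n /=; rewrite /cstar_fun /= starD actD //;
  exact: dom_star.
Qed.

Lemma cstarZ (c : R[i]) f : cstar (c *: f) = c^* *: cstar f.
Proof.
apply: crossed_eq => n /=; rewrite /cstar_fun /= starZ actZ //; exact: dom_star.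
Qed.

Lemma cstarM f g : cstar (cmul f g) = cmul (cstar g) (cstar f).
Proof.
apply: crossed_eq => k; rewrite /= /cstar_fun.
rewrite (cmulEs _ _ (@csuppP f)) star_sum.
have hsum (s : seq int) (F : int -> B) : (forall i, dom (- k) (F i)) ->
    act k (\sum_(i <- s) F i) = \sum_(i <- s) act k (F i).
  move=> dF; elim: s => [|i s IHs]; first by rewrite !big_nil act0.
  rewrite !big_cons actD ?IHs //; elim/big_ind: _ => //.
    exact: (ideal0 (pa_ideal hP _)).
  exact: (idealD (pa_ideal hP _)).
have hk n : - k = n + (- k - n) by rewrite addrCA subrr addr0.
have hd n : dom (- k) (cterm n (f n) (g (- k - n))).
  by rewrite {1}(hk n); apply: cterm_domD; exact: crossed_dom.
rewrite hsum => [|n]; last by apply: (ideal_star (pa_ideal hP _)).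
rewrite -(fsbigTE (csupp f)
    (fun n => act k (star (cterm n (f n) (g (- k - n)))))); last first.
  by move=> n /csuppP ->; rewrite cterm0l star0 act0.
rewrite /cmul_fun [RHS](reindex_fsbigT (fun n => k + n)); last first.
  by exists (+%R (- k)) => m; rewrite ?addKr ?addNKr.
apply: eq_fsbigr => n _; rewrite /= /cstar_fun.
have -> : k - (k + n) = - n by rewrite opprD addrA subrr add0r.
have {1}-> : k = - (n + (- k - n)) by rewrite -hk opprK.
rewrite star_cterm; try exact: crossed_dom.
by have -> : - (- k - n) = k + n; rewrite ?opprD ?opprK.
Qed.

HB.instance Definition _ := GRing.Zmodule_isNzRing.Build crossed
  cmulA cmul1l cmul1r cmulDl cmulDr cone_neq0.
HB.instance Definition _ := GRing.Lmodule_isLalgebra.Build R[i] crossed cmulZl.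
HB.instance Definition _ := GRing.Lalgebra_isAlgebra.Build R[i] crossed cmulZr.
HB.instance Definition _ := isStarAlgebra.Build R[i] crossed
  cstarK cstarD cstarZ cstarM.
Fact tensor_subproof n x : dom n x ->
  (fun k => if k == n then x else 0) \in crossed_pred.
Proof.
move=> dx; apply/crossedP; split=> [|k].
  by apply: (@finite_fset_supp _ [fset n]%fset) => k; rewrite inE => /negPf ->.
by case: eqP => [->//|_]; exact: (ideal0 (pa_ideal hP k)).
Qed.
Definition tensor n x (dx : dom n x) : crossed := Crossed (tensor_subproof dx).

Lemma tensorM n m x y (dx : dom n x) (dy : dom m y) :
  tensor dx * tensor dy = tensor (cterm_domD dx dy).
Proof.
apply: crossed_eq => k; rewrite [LHS](@cmulE _ _ [fset n]%fset); last first.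
  by move=> i; rewrite inE /= => /negPf ->.
rewrite big_seq_fset1 /= eqxx subr_eq [m + n]addrC.
by case: eqP => // _; rewrite cterm0r.
Qed.

Fact star_tensor_subproof n x : dom n x -> dom (- n) (act (- n) (star x)).
Proof. by move=> dx; apply: actV_dom; exact: (ideal_star (pa_ideal hP n)). Qed.

Lemma star_tensor n x (dx : dom n x) :
  star (tensor dx) = tensor (star_tensor_subproof dx).
Proof.
apply: crossed_eq => k; rewrite /= /cstar_fun /= eqr_oppLR.
by case: eqP => [->|_]; rewrite ?star0 ?act0.
Qed.

End Support.
End Crossed.
End PartialActions.

Section CX.
Variables (R : realType) (X : ptopologicalType).
Implicit Types (x : X).

(* Boundedness is automatic on a compact space, see compact_cont below.       *)
Definition cont_pred : {pred X -> R[i]} := fun f =>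
  `[< continuous (f : X -> R[i]^o) /\ exists M : R, forall x, cmod (f x) <= M >].

Record Cfun := Cont { cont_fun :> X -> R[i]; cont_funP : cont_fun \in cont_pred }.
HB.instance Definition _ := [isSub for cont_fun].
HB.instance Definition _ := [Choice of Cfun by <:].

Lemma contP (f : X -> R[i]) :
  reflect (continuous (f : X -> R[i]^o) /\ exists M : R, forall x, cmod (f x) <= M)
          (f \in cont_pred).
Proof. exact: asboolP. Qed.

Lemma contE (f : X -> R[i]) : continuous (f : X -> R[i]^o) <->
  (forall x (e : R), 0 < e -> \forall y \near x, cmod (f x - f y) < e).
Proof.
split=> [cf x e e0|h x].
  have /cvgrPdist_lt h := cf x.
  near=> y; rewrite cmod_ltP; near: y; apply: h; by rewrite ltcR.
apply/cvgrPdist_lt => e e0.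
have er : e = real_complex R (complex.Re e).
  by rewrite RRe_real // realE ltW.
have := h x (complex.Re e); rewrite -ltcR -er => /(_ e0) h1.
near=> y; rewrite er -cmod_ltP; near: y; exact: h1.
Unshelve. all: by end_near. Qed.

Lemma compact_cont (f : X -> R[i]) : compact [set: X] ->
  continuous (f : X -> R[i]^o) -> f \in cont_pred.
Proof.
move=> cX cf; apply/contP; split=> //.
have cfX : compact ((fun x => cmod (f x) : R^o) @` [set: X]).
  apply: continuous_compact => //; apply: continuous_subspaceT => x.
  apply/cvgrPdist_lt => e e0; have /contE/(_ x e e0) := cf.
  apply: filterS => y; apply: le_lt_trans; rewrite ler_norml.
  have := cmodD (f x - f y) (f y); have := cmodD (f y - f x) (f x).
  by rewrite !subrK [cmod (f y - f x)]cmodBC; lra.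
have [M [Mr hM]] := @compact_bounded R R^o _ cfX.
exists (M + 1) => x; have := hM (M + 1); rewrite ltrDl ltr01 => /(_ isT) h.
by apply: le_trans (ler_norm _) _; apply: h; exists x.
Qed.

Lemma cont_bound (f : Cfun) : exists M : R, forall x, cmod (f x) <= M.
Proof. by have /contP[] := cont_funP f. Qed.

Lemma cont_continuous (f : Cfun) : continuous (f : X -> R[i]^o).
Proof. by have /contP[] := cont_funP f. Qed.

Lemma cst_cont (c : R[i]) : (fun=> c) \in cont_pred.
Proof.
by apply/contP; split=> [x|]; [exact: cst_continuous | exists (cmod c)].
Qed.

Lemma add_cont (f g : X -> R[i]) : f \in cont_pred -> g \in cont_pred ->
  (fun x => f x + g x) \in cont_pred.
Proof.
move=> /contP[cf [M hM]] /contP[cg [N hN]]; apply/contP; split=> [x|].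
  exact: (@continuousD R[i] R[i]^o X f g x (cf x) (cg x)).
exists (M + N) => x; apply: le_trans (cmodD _ _) _; exact: lerD.
Qed.

Lemma mul_cont (f g : X -> R[i]) : f \in cont_pred -> g \in cont_pred ->
  (fun x => f x * g x) \in cont_pred.
Proof.
move=> /contP[cf [M hM]] /contP[cg [N hN]]; apply/contP; split=> [x|].
  exact: (@continuousM R[i] X f g x (cf x) (cg x)).
exists (M * N) => x; rewrite cmodM; apply: ler_pM => //; exact: cmod_ge0.
Qed.

Lemma conj_cont (f : X -> R[i]) : f \in cont_pred ->
  (fun x => (f x)^*) \in cont_pred.
Proof.
move=> /contP[cf [M hM]]; apply/contP; split; last first.
  by exists M => x; rewrite cmodJ.
apply/contE => x e e0; have /contE/(_ x e e0) := cf.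
by apply: filterS => y; rewrite -rmorphB cmodJ.
Qed.

Lemma cont_submod : submod_closed cont_pred.
Proof.
split=> [|c f g hf hg]; first exact: (cst_cont 0).
by apply: (@add_cont (c *: f) g) => //; apply: (@mul_cont (fun=> c)) => //;
  exact: cst_cont.
Qed.
HB.instance Definition _ :=
  GRing.isSubmodClosed.Build R[i] (X -> R[i]) cont_pred cont_submod.
HB.instance Definition _ := [SubChoice_isSubLmodule of Cfun by <:].

Lemma cont_eq (f g : Cfun) : (forall x, f x = g x) -> f = g.
Proof. by move=> e; apply/val_inj/funext. Qed.

Definition cont_mul (f g : Cfun) : Cfun :=
  Cont (mul_cont (cont_funP f) (cont_funP g)).
Definition cont_one : Cfun := Cont (cst_cont 1).
Definition cont_star (f : Cfun) : Cfun := Cont (conj_cont (cont_funP f)).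

Fact cont_mulA : associative cont_mul.
Proof. by move=> f g h; apply: cont_eq => x /=; rewrite mulrA. Qed.
Fact cont_mul1l : left_id cont_one cont_mul.
Proof. by move=> f; apply: cont_eq => x /=; rewrite mul1r. Qed.
Fact cont_mul1r : right_id cont_one cont_mul.
Proof. by move=> f; apply: cont_eq => x /=; rewrite mulr1. Qed.
Fact cont_mulDl : left_distributive cont_mul +%R.
Proof. by move=> f g h; apply: cont_eq => x /=; rewrite -mulrDl. Qed.
Fact cont_mulDr : right_distributive cont_mul +%R.
Proof. by move=> f g h; apply: cont_eq => x /=; rewrite -mulrDr. Qed.
Fact cont_one_neq0 : cont_one != 0.
Proof.
apply/eqP => /(congr1 (fun f : Cfun => f point)) /= /eqP.
by rewrite oner_eq0.
Qed.
HB.instance Definition _ := GRing.Zmodule_isNzRing.Build Cfun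
  cont_mulA cont_mul1l cont_mul1r cont_mulDl cont_mulDr cont_one_neq0.

Fact cont_mulZl (c : R[i]) (f g : Cfun) : c *: (f * g) = (c *: f) * g.
Proof. by apply: cont_eq => x; apply: mulrA. Qed.
Fact cont_mulZr (c : R[i]) (f g : Cfun) : c *: (f * g) = f * (c *: g).
Proof. by apply: cont_eq => x; apply: mulrCA. Qed.
HB.instance Definition _ := GRing.Lmodule_isLalgebra.Build R[i] Cfun cont_mulZl.
HB.instance Definition _ := GRing.Lalgebra_isAlgebra.Build R[i] Cfun cont_mulZr.

Fact cont_starK : involutive cont_star.
Proof. by move=> f; apply: cont_eq => x /=; rewrite conjCK. Qed.
Fact cont_starD : {morph cont_star : f g / f + g}.
Proof. by move=> f g; apply: cont_eq => x; apply: rmorphD. Qed.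
Fact cont_starZ (c : R[i]) f : cont_star (c *: f) = c^* *: cont_star f.
Proof. by apply: cont_eq => x; apply: rmorphM. Qed.
Fact cont_starM f g : cont_star (f * g) = cont_star g * cont_star f.
Proof.
apply: cont_eq => x; transitivity ((f x * g x)^*) => //.
by rewrite rmorphM mulrC.
Qed.
HB.instance Definition _ := isStarAlgebra.Build R[i] Cfun
  cont_starK cont_starD cont_starZ cont_starM.

Definition cont_norm (f : Cfun) : R := sup [set cmod (f x) | x in [set: X]].

Lemma cont_norm_has_sup f : has_sup [set cmod (cont_fun f x) | x in [set: X]].
Proof.
split; first by exists (cmod (f point)), point.
by have [M hM] := cont_bound f; exists M => _ [x _ <-].
Qed.

Lemma cont_norm_ub f x : cmod (cont_fun f x) <= cont_norm f.
Proof. by apply: sup_upper_bound (cont_norm_has_sup f) _ _; exists x. Qed.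

Lemma cont_norm_le (f : Cfun) M : (forall x, cmod (f x) <= M) -> cont_norm f <= M.
Proof.
move=> h; apply: ge_sup; first by case: (cont_norm_has_sup f).
by move=> _ [x _ <-].
Qed.

Lemma cont_norm_ge0 f : 0 <= cont_norm f.
Proof. exact: le_trans (cmod_ge0 _) (cont_norm_ub f point). Qed.

Fact cont_normD (f g : Cfun) : cont_norm (f + g) <= cont_norm f + cont_norm g.
Proof.
apply: cont_norm_le => x; apply: le_trans (cmodD _ _) _.
by rewrite lerD // cont_norm_ub.
Qed.

Fact cont_normM (f g : Cfun) : cont_norm (f * g) <= cont_norm f * cont_norm g.
Proof.
apply: cont_norm_le => x; rewrite cmodM.
by apply: ler_pM; rewrite ?cmod_ge0 ?cont_norm_ub.
Qed.

Fact cont_normZ (c : R[i]) (f : Cfun) :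
  cont_norm (c *: f) = cmod c * cont_norm f.
Proof.
apply/eqP; rewrite eq_le; apply/andP; split.
  apply: cont_norm_le => x; rewrite [cmod _]cmodM.
  by rewrite ler_wpM2l ?cmod_ge0 ?cont_norm_ub.
have [c0|c0] := eqVneq (cmod c) 0.
  by rewrite c0 mul0r cont_norm_ge0.
have c_gt0 : 0 < cmod c by rewrite lt_def c0 cmod_ge0.
rewrite -ler_pdivlMl //; apply: cont_norm_le => x; rewrite ler_pdivlMl //.
by rewrite -cmodM; exact: (cont_norm_ub (c *: f) x).
Qed.

Fact cont_norm0_eq0 (f : Cfun) : cont_norm f = 0 -> f = 0.
Proof.
move=> h; apply: cont_eq => x; apply: cmod_eq0; apply/eqP.
by rewrite eq_le cmod_ge0 -h cont_norm_ub.
Qed.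

Fact cont_norm_star (f : Cfun) : cont_norm (star f * f) = cont_norm f ^+ 2.
Proof.
apply/eqP; rewrite eq_le; apply/andP; split.
  apply: cont_norm_le => x; rewrite [cmod _]cmodM cmodJ -expr2.
  by rewrite ler_sqr ?nnegrE ?cmod_ge0 ?cont_norm_ge0 ?cont_norm_ub.
rewrite -(sqr_sqrtr (cont_norm_ge0 (star f * f))).
rewrite ler_sqr ?nnegrE ?sqrtr_ge0 ?cont_norm_ge0 //.
apply: cont_norm_le => x.
rewrite -(ger0_norm (cmod_ge0 (f x))) -sqrtr_sqr ler_wsqrtr //.
by rewrite expr2 -{1}cmodJ -cmodM; exact: (cont_norm_ub (star f * f) x).
Qed.

Fact cont_norm_complete (u : nat -> Cfun) :
  (forall e : R, 0 < e -> exists N : nat, forall m n : nat,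
      (N <= m)%N -> (N <= n)%N -> cont_norm (u m - u n) < e) ->
    exists l, (fun n => cont_norm (u n - l)) @ \oo --> (0 : R).
Proof.
move=> hu.
have hx x : exists l, forall e : R, 0 < e -> exists N : nat, forall n,
      (N <= n)%N -> cmod (u n x - l) < e.
  apply: complex_cauchy => e e0; have [N hN] := hu e e0.
  exists N => m n hm hn; apply: le_lt_trans (hN _ _ hm hn).
  exact: (cont_norm_ub (u m - u n) x).
have [g hg] := choice hx.
have key (e : R) : 0 < e -> exists N : nat, forall n x, (N <= n)%N ->
    cmod (u n x - g x) <= e.
  move=> e0; have e20 : 0 < e / 2 by rewrite divr_gt0.
  have [N hN] := hu _ e20; exists N => n x hn.
  have [M hM] := hg x _ e20; pose m := maxn M N.
  have -> : u n x - g x = (u n x - u m x) + (u m x - g x) by rewrite addrA subrK.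
  apply: le_trans (cmodD _ _) _; rewrite [e]splitr lerD //.
    apply: ltW; apply: le_lt_trans (hN n m hn (leq_maxr _ _)).
    exact: (cont_norm_ub (u n - u m) x).
  by apply: ltW; apply: hM; exact: leq_maxl.
have gc : g \in cont_pred.
  apply/contP; split.
    apply/contE => x e e0; have e30 : 0 < e / 3 by rewrite divr_gt0.
    have [N hN] := key _ e30.
    have /contE/(_ x _ e30) := @cont_continuous (u N).
    apply: filterS => y hy.
    have -> : g x - g y = - (u N x - g x) + (u N x - u N y) + (u N y - g y).
      by ring.
    have -> : e = e / 3 + e / 3 + e / 3 by field.
    apply: le_lt_trans (cmodD _ _) _; apply: ltr_leD; last exact: hN.
    apply: le_lt_trans (cmodD _ _) _; apply: ler_ltD => //.
    by rewrite cmodN; exact: hN.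
  have [N hN] := key 1 ltr01; have [M hM] := cont_bound (u N).
  exists (1 + M) => x; have -> : g x = - (u N x - g x) + u N x.
    by rewrite opprB subrK.
  by apply: le_trans (cmodD _ _) _; rewrite lerD // cmodN hN.
exists (Cont gc); apply/cvgrPdist_le => e e0.
have [N hN] := key e e0; exists N => // n /= hn.
rewrite sub0r normrN ger0_norm ?cont_norm_ge0 //.
by apply: cont_norm_le => x; exact: hN.
Qed.

HB.instance Definition _ := isCstarAlgebra.Build R Cfun cont_normD cont_normZ
  cont_norm0_eq0 cont_normM cont_norm_star cont_norm_complete.

End CX.

Local Open Scope quotient_scope.
Local Open Scope complex_scope.

Definition is_character (R : realType) (B : starAlgType R[i])
    (chi : B -> R[i]) : Prop :=
  [/\ {morph chi : x y / x + y},
      forall (c : R[i]) x, chi (c *: x) = c * chi x,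
      {morph chi : x y / x * y},
      forall x, chi (star x) = ((chi x)^*)%R &
      exists x, chi x != 0].

Inductive s2_term (R : realType) :=
  | GenA | GenB | GenBs
  | Cst of R[i]
  | Add of s2_term R & s2_term R
  | Mul of s2_term R & s2_term R.
Arguments GenA {R}.
Arguments GenB {R}.
Arguments GenBs {R}.

HB.instance Definition _ (R : realType) := gen_eqMixin (s2_term R).
HB.instance Definition _ (R : realType) := gen_choiceMixin (s2_term R).

Fixpoint term_star (R : realType) (t : s2_term R) : s2_term R :=
  match t with
  | GenA => GenA
  | GenB => GenBs
  | GenBs => GenB
  | Cst c => Cst (c^*)%R
  | Add s t => Add (term_star s) (term_star t)
  | Mul s t => Mul (term_star t) (term_star s)
  end.

(* The congruence generated by the axioms of unital R[i]-algebras and the     *)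
(* defining relations of O(S^2_qr).                                           *)
Inductive s2_eq (R : realType) (q r : R) : s2_term R -> s2_term R -> Prop :=
  | s2_refl t : s2_eq q r t t
  | s2_sym s t : s2_eq q r s t -> s2_eq q r t s
  | s2_trans s t u : s2_eq q r s t -> s2_eq q r t u -> s2_eq q r s u
  | s2_add s s' t t' : s2_eq q r s s' -> s2_eq q r t t' ->
      s2_eq q r (Add s t) (Add s' t')
  | s2_mul s s' t t' : s2_eq q r s s' -> s2_eq q r t t' ->
      s2_eq q r (Mul s t) (Mul s' t')
  | s2_addA s t u : s2_eq q r (Add s (Add t u)) (Add (Add s t) u)
  | s2_addC s t : s2_eq q r (Add s t) (Add t s)
  | s2_add0 t : s2_eq q r (Add (Cst 0) t) t
  | s2_mulA s t u : s2_eq q r (Mul s (Mul t u)) (Mul (Mul s t) u)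
  | s2_mul1 t : s2_eq q r (Mul (Cst 1) t) t
  | s2_mul0 t : s2_eq q r (Mul (Cst 0) t) (Cst 0)
  | s2_mulDl s t u : s2_eq q r (Mul (Add s t) u) (Add (Mul s u) (Mul t u))
  | s2_mulDr s t u : s2_eq q r (Mul s (Add t u)) (Add (Mul s t) (Mul s u))
  | s2_cstD c d : s2_eq q r (Cst (c + d)) (Add (Cst c) (Cst d))
  | s2_cstM c d : s2_eq q r (Cst (c * d)) (Mul (Cst c) (Cst d))
  | s2_cstC c t : s2_eq q r (Mul (Cst c) t) (Mul t (Cst c))
  | s2_ab : s2_eq q r (Mul GenA GenB) (Mul (Cst (q ^- 2)%:C) (Mul GenB GenA))
  | s2_abs : s2_eq q r (Mul GenA GenBs) (Mul (Cst (q ^+ 2)%:C) (Mul GenBs GenA))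
  | s2_bsb : s2_eq q r (Mul GenBs GenB)
      (Add (Add GenA (Mul (Cst (-1)) (Mul GenA GenA))) (Cst r%:C))
  | s2_bbs : s2_eq q r (Mul GenB GenBs)
      (Add (Add (Mul (Cst (q ^+ 2)%:C) GenA)
                (Mul (Cst (- (q ^+ 4)%:C)) (Mul GenA GenA))) (Cst r%:C)).

Section Eval.
Variables (R : realType) (q r : R) (A : algType R[i]) (a b bs : A).

Fixpoint s2_eval (t : s2_term R) : A :=
  match t with
  | GenA => a
  | GenB => b
  | GenBs => bs
  | Cst c => c%:A
  | Add s t => s2_eval s + s2_eval t
  | Mul s t => s2_eval s * s2_eval t
  end.

Definition s2_relations : Prop :=
  [/\ a * b = (q ^- 2)%:C *: (b * a),
      a * bs = (q ^+ 2)%:C *: (bs * a),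
      bs * b = a - a ^+ 2 + r%:C%:A &
      b * bs = (q ^+ 2)%:C *: a - (q ^+ 4)%:C *: a ^+ 2 + r%:C%:A].

Lemma s2_evalP s t : s2_relations -> s2_eq q r s t -> s2_eval s = s2_eval t.
Proof.
case=> r1 r2 r3 r4; elim=> //= {s t}.
- by move=> s t u _ -> _ ->.
- by move=> s s' t t' _ -> _ ->.
- by move=> s s' t t' _ -> _ ->.
- by move=> *; rewrite addrA.
- by move=> *; rewrite addrC.
- by move=> *; rewrite scale0r add0r.
- by move=> *; rewrite mulrA.
- by move=> *; rewrite scale1r mul1r.
- by move=> *; rewrite scale0r mul0r.
- by move=> *; rewrite mulrDl.
- by move=> *; rewrite mulrDr.
- by move=> *; rewrite scalerDl.
- by move=> *; rewrite mulr_algl scalerA.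
- by move=> *; rewrite mulr_algl mulr_algr.
- by rewrite mulr_algl.
- by rewrite mulr_algl.
- by rewrite r3 mulr_algl scaleN1r.
- by rewrite r4 !mulr_algl scaleNr.
Qed.

End Eval.

Section Algebra.
Variables (R : realType) (qp rp : {posnum R}).
Let q := qp%:num.
Let r := rp%:num.

Let eqb (s t : s2_term R) := `[< s2_eq q r s t >].
Fact s2_equivP : equiv_class_of eqb.
Proof.
split=> [t|s t|t s u].
- by apply/asboolP; exact: s2_refl.
- by apply/asboolP/asboolP => h; exact: s2_sym.
- by move=> /asboolP h /asboolP h'; apply/asboolP; exact: s2_trans h h'.
Qed.
Canonical s2_equiv := EquivRelPack s2_equivP.

Definition S2qr := {eq_quot s2_equiv}.
HB.instance Definition _ := Choice.on S2qr.

Definition s2_class (t : s2_term R) : S2qr := \pi_({eq_quot s2_equiv}) t.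

Lemma s2_classP s t : s2_eq q r s t -> s2_class s = s2_class t.
Proof. by move=> h; apply/eqmodP/asboolP. Qed.

Lemma s2_class_inj s t : s2_class s = s2_class t -> s2_eq q r s t.
Proof. by move=> /eqmodP/asboolP. Qed.

Lemma s2_reprK (x : S2qr) : s2_class (repr x) = x.
Proof. exact: (@reprK _ {eq_quot s2_equiv}). Qed.

Lemma s2_repr t : s2_eq q r (repr (s2_class t)) t.
Proof. by apply: s2_class_inj; exact: s2_reprK. Qed.

Definition S2_add (x y : S2qr) := s2_class (Add (repr x) (repr y)).
Definition S2_mul (x y : S2qr) := s2_class (Mul (repr x) (repr y)).
Definition S2_opp (x : S2qr) := s2_class (Mul (Cst (-1)) (repr x)).
Definition S2_scale (c : R[i]) (x : S2qr) := s2_class (Mul (Cst c) (repr x)).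

Lemma S2_addE s t : S2_add (s2_class s) (s2_class t) = s2_class (Add s t).
Proof. by apply/s2_classP/s2_add; exact: s2_repr. Qed.
Lemma S2_mulE s t : S2_mul (s2_class s) (s2_class t) = s2_class (Mul s t).
Proof. by apply/s2_classP/s2_mul; exact: s2_repr. Qed.
Lemma S2_scaleE c t : S2_scale c (s2_class t) = s2_class (Mul (Cst c) t).
Proof. by apply/s2_classP/s2_mul; [exact: s2_refl|exact: s2_repr]. Qed.
Lemma S2_oppE t : S2_opp (s2_class t) = s2_class (Mul (Cst (-1)) t).
Proof. exact: S2_scaleE. Qed.

Lemma S2_ind (P : S2qr -> Prop) : (forall t, P (s2_class t)) -> forall x, P x.
Proof. by move=> h x; rewrite -(s2_reprK x). Qed.

Fact S2_addA : associative S2_add.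
Proof.
elim/S2_ind=> s; elim/S2_ind=> t; elim/S2_ind=> u.
by rewrite !S2_addE; apply/s2_classP/s2_addA.
Qed.
Fact S2_addC : commutative S2_add.
Proof.
elim/S2_ind=> s; elim/S2_ind=> t.
by rewrite !S2_addE; apply/s2_classP/s2_addC.
Qed.
Fact S2_add0 : left_id (s2_class (Cst 0)) S2_add.
Proof. by elim/S2_ind=> s; rewrite !S2_addE; apply/s2_classP/s2_add0. Qed.
Fact S2_addN : left_inverse (s2_class (Cst 0)) S2_opp S2_add.
Proof.
elim/S2_ind=> s; rewrite S2_oppE S2_addE.
rewrite -(s2_classP (s2_mul0 q r s)) -(addNr (1 : R[i])).
rewrite -[RHS]S2_mulE (s2_classP (s2_cstD q r (-1) 1)) S2_mulE.
rewrite (s2_classP (s2_mulDl _ _ _ _ _)) -!S2_addE.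
by rewrite (s2_classP (s2_mul1 q r s)).
Qed.
HB.instance Definition _ :=
  GRing.isZmodule.Build S2qr S2_addA S2_addC S2_add0 S2_addN.

Fact S2_mulA : associative S2_mul.
Proof.
elim/S2_ind=> s; elim/S2_ind=> t; elim/S2_ind=> u.
by rewrite !S2_mulE; apply/s2_classP/s2_mulA.
Qed.
Fact S2_mul1l : left_id (s2_class (Cst 1)) S2_mul.
Proof. by elim/S2_ind=> s; rewrite !S2_mulE; apply/s2_classP/s2_mul1. Qed.
Fact S2_mul1r : right_id (s2_class (Cst 1)) S2_mul.
Proof.
elim/S2_ind=> s; rewrite !S2_mulE -(s2_classP (s2_cstC _ _ _ _)).
exact/s2_classP/s2_mul1.
Qed.
Fact S2_mulDl : left_distributive S2_mul +%R.
Proof.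
elim/S2_ind=> s; elim/S2_ind=> t; elim/S2_ind=> u.
rewrite -[_ + _]/(S2_add _ _) -[RHS]/(S2_add _ _) !(S2_mulE, S2_addE).
exact/s2_classP/s2_mulDl.
Qed.
Fact S2_mulDr : right_distributive S2_mul +%R.
Proof.
elim/S2_ind=> s; elim/S2_ind=> t; elim/S2_ind=> u.
rewrite -[_ + _]/(S2_add _ _) -[RHS]/(S2_add _ _) !(S2_mulE, S2_addE).
exact/s2_classP/s2_mulDr.
Qed.
(* a |-> 0, b |-> r, b^* |-> 1 is a (non-involutive) character. *)
Fact S2_one_neq0 : s2_class (Cst 1) != s2_class (Cst 0).
Proof.
apply/eqP => /s2_class_inj h.
have rel : @s2_relations R q r R[i]^o 0 r%:C 1.
  have e : r%:C%:A = r%:C :> R[i]^o by exact: mulr1.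
  split; rewrite ?expr2.
  - by rewrite mul0r mulr0 scaler0.
  - by rewrite mul0r mulr0 scaler0.
  - by rewrite mul1r mul0r subr0 add0r e.
  - by rewrite mulr1 mul0r !scaler0 subr0 add0r e.
have /= /eqP := s2_evalP rel h.
by rewrite scale0r scale1r oner_eq0.
Qed.
HB.instance Definition _ := GRing.Zmodule_isNzRing.Build S2qr
  S2_mulA S2_mul1l S2_mul1r S2_mulDl S2_mulDr S2_one_neq0.

Lemma s2_classD s t : s2_class (Add s t) = s2_class s + s2_class t.
Proof. by rewrite -S2_addE. Qed.
Lemma s2_classM s t : s2_class (Mul s t) = s2_class s * s2_class t.
Proof. by rewrite -S2_mulE. Qed.
Lemma s2_class0 : s2_class (Cst 0) = 0. Proof. by []. Qed.
Lemma s2_class1 : s2_class (Cst 1) = 1. Proof. by []. Qed.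
Lemma S2_scale_mul c x : S2_scale c x = s2_class (Cst c) * x.
Proof. by elim/S2_ind: x => t; rewrite S2_scaleE s2_classM. Qed.
Lemma s2_cst_comm c x : s2_class (Cst c) * x = x * s2_class (Cst c).
Proof.
by elim/S2_ind: x => t; rewrite -!s2_classM; apply/s2_classP/s2_cstC.
Qed.

Fact S2_scalerA c d x : S2_scale c (S2_scale d x) = S2_scale (c * d) x.
Proof.
by rewrite !S2_scale_mul mulrA -s2_classM -(s2_classP (s2_cstM q r c d)).
Qed.
Fact S2_scale1r : left_id 1 S2_scale.
Proof. by move=> x; rewrite S2_scale_mul mul1r. Qed.
Fact S2_scalerDr : right_distributive S2_scale +%R.
Proof. by move=> c x y; rewrite !S2_scale_mul mulrDr. Qed.
Fact S2_scalerDl x : {morph S2_scale^~ x : c d / c + d}.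
Proof.
by move=> c d; rewrite !S2_scale_mul (s2_classP (s2_cstD q r c d)) s2_classD mulrDl.
Qed.
HB.instance Definition _ := GRing.Zmodule_isLmodule.Build R[i] S2qr
  S2_scalerA S2_scale1r S2_scalerDr S2_scalerDl.

Lemma S2_scaleE' c (x : S2qr) : c *: x = s2_class (Cst c) * x.
Proof. exact: S2_scale_mul. Qed.

Fact S2_scalerAl (c : R[i]) (x y : S2qr) : c *: (x * y) = (c *: x) * y.
Proof. by rewrite !S2_scaleE' mulrA. Qed.
HB.instance Definition _ := GRing.Lmodule_isLalgebra.Build R[i] S2qr S2_scalerAl.
Fact S2_scalerAr (c : R[i]) (x y : S2qr) : c *: (x * y) = x * (c *: y).
Proof. by rewrite !S2_scaleE' mulrA s2_cst_comm mulrA. Qed.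
HB.instance Definition _ := GRing.Lalgebra_isAlgebra.Build R[i] S2qr S2_scalerAr.

Lemma s2_classC c : s2_class (Cst c) = c%:A.
Proof. by rewrite S2_scaleE' mulr1. Qed.

Lemma term_starK : involutive (@term_star R).
Proof.
by elim=> //= [c|s -> t ->|s -> t ->] //; rewrite conjCK.
Qed.

Lemma conj_rc (x : R) : (x%:C^*)%R = x%:C :> R[i].
Proof. by apply: CrealP; apply/complex_realP; exists x. Qed.

Lemma term_star_eq s t :
  s2_eq q r s t -> s2_eq q r (term_star s) (term_star t).
Proof.
have q0 : q != 0 by rewrite /q.
have cmC c u : s2_eq q r (Mul u (Cst c)) (Mul (Cst c) u).
  exact/s2_sym/s2_cstC.
have cc c d u : c * d = 1 -> s2_eq q r u (Mul (Cst c) (Mul (Cst d) u)).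
  move=> cd; apply/s2_sym; apply: s2_trans (s2_mulA _ _ _ _ _) _.
  apply: s2_trans (s2_mul (s2_sym (s2_cstM _ _ _ _)) (s2_refl _ _ _)) _.
  by rewrite cd; exact: s2_mul1.
elim=> /=.
- by move=> *; exact: s2_refl.
- by move=> *; exact: s2_sym.
- by move=> ? ? ? _ h _ h'; exact: s2_trans h h'.
- by move=> *; exact: s2_add.
- by move=> *; exact: s2_mul.
- by move=> *; exact: s2_addA.
- by move=> *; exact: s2_addC.
- by move=> ?; rewrite conjC0; exact: s2_add0.
- by move=> *; exact/s2_sym/s2_mulA.
- by move=> ?; rewrite conjC1; apply: s2_trans (cmC _ _) _; exact: s2_mul1.
- by move=> ?; rewrite conjC0; apply: s2_trans (cmC _ _) _; exact: s2_mul0.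
- by move=> *; exact: s2_mulDr.
- by move=> *; exact: s2_mulDl.
- by move=> c d; rewrite rmorphD; exact: s2_cstD.
- by move=> c d; rewrite mulrC rmorphM; exact: s2_cstM.
- by move=> c u; exact: cmC.
- rewrite conj_rc; apply: s2_trans _ (s2_sym (cmC _ _)).
  apply: s2_trans _ (s2_mul (s2_refl _ _ _) (s2_sym (s2_abs _ _))).
  by apply: cc; rewrite -rmorphM mulVf ?expf_neq0.
- rewrite conj_rc; apply: s2_trans _ (s2_sym (cmC _ _)).
  apply: s2_trans _ (s2_mul (s2_refl _ _ _) (s2_sym (s2_ab _ _))).
  by apply: cc; rewrite -rmorphM mulfV ?expf_neq0.
- rewrite (conj_rc r) rmorphN /= conjC1; apply: s2_trans (s2_bsb _ _) _.
  apply: s2_add (s2_refl _ _ _); apply: s2_add (s2_refl _ _ _) _.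
  exact: s2_cstC.
- rewrite (conj_rc r) (conj_rc (q ^+ 2)) rmorphN /= (conj_rc (q ^+ 4)).
  apply: s2_trans (s2_bbs _ _) _.
  apply: s2_add (s2_refl _ _ _); apply: s2_add; exact: s2_cstC.
Qed.

Definition S2_star (x : S2qr) := s2_class (term_star (repr x)).

Lemma S2_starE t : S2_star (s2_class t) = s2_class (term_star t).
Proof. by apply/s2_classP/term_star_eq; exact: s2_repr. Qed.

Fact S2_starK : involutive S2_star.
Proof. by elim/S2_ind=> t; rewrite !S2_starE term_starK. Qed.
Fact S2_starD : {morph S2_star : x y / x + y}.
Proof.
elim/S2_ind=> s; elim/S2_ind=> t.
by rewrite -s2_classD (S2_starE (Add s t)) (S2_starE s) (S2_starE t) -s2_classD.
Qed.
Fact S2_starM x y : S2_star (x * y) = S2_star y * S2_star x.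
Proof.
elim/S2_ind: x => s; elim/S2_ind: y => t.
by rewrite -s2_classM (S2_starE (Mul s t)) (S2_starE s) (S2_starE t) -s2_classM.
Qed.
Fact S2_starZ (c : R[i]) x : S2_star (c *: x) = (c^*)%R *: S2_star x.
Proof. by rewrite !S2_scaleE' S2_starM (S2_starE (Cst c)) s2_cst_comm. Qed.
HB.instance Definition _ :=
  isStarAlgebra.Build R[i] S2qr S2_starK S2_starD S2_starZ S2_starM.

Definition s2a : S2qr := s2_class GenA.
Definition s2b : S2qr := s2_class GenB.

Lemma star_s2a : star s2a = s2a. Proof. exact: S2_starE. Qed.
Lemma star_s2b : star s2b = s2_class GenBs. Proof. exact: S2_starE. Qed.

Lemma s2_class_eval t : s2_class t = s2_eval s2a s2b (star s2b) t.
Proof.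
elim: t => [|||c|s es t et|s es t et] //=.
- by rewrite star_s2b.
- exact: s2_classC.
- by rewrite -es -et; exact: s2_classD.
- by rewrite -es -et; exact: s2_classM.
Qed.

Lemma S2_relations : s2_relations q r s2a s2b (star s2b).
Proof.
have E := s2_class_eval; split.
- by have := s2_classP (s2_ab q r); rewrite !E /= mulr_algl.
- by have := s2_classP (s2_abs q r); rewrite !E /= mulr_algl.
- by have := s2_classP (s2_bsb q r); rewrite !E /= mulr_algl scaleN1r expr2.
- have := s2_classP (s2_bbs q r).
  by rewrite !E /= !mulr_algl scaleNr expr2.
Qed.

Section Lift.
Variables (A : algType R[i]) (a b bs : A).
Hypothesis rel : s2_relations q r a b bs.

Definition s2_lift (x : S2qr) : A := s2_eval a b bs (repr x).

Lemma s2_liftE t : s2_lift (s2_class t) = s2_eval a b bs t.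
Proof. exact: s2_evalP rel (s2_repr t). Qed.
Lemma s2_liftD : {morph s2_lift : x y / x + y}.
Proof.
by elim/S2_ind=> s; elim/S2_ind=> t; rewrite -s2_classD !s2_liftE.
Qed.
Lemma s2_liftM : {morph s2_lift : x y / x * y}.
Proof.
by elim/S2_ind=> s; elim/S2_ind=> t; rewrite -s2_classM !s2_liftE.
Qed.
Lemma s2_liftZ c x : s2_lift (c *: x) = c *: s2_lift x.
Proof.
by elim/S2_ind: x => t; rewrite S2_scaleE' -s2_classM !s2_liftE /= mulr_algl.
Qed.
Lemma s2_lift1 : s2_lift 1 = 1.
Proof. by rewrite -s2_class1 s2_liftE /= scale1r. Qed.

End Lift.

Lemma S2_universal (A : starAlgType R[i]) (a b : A) :
  star a = a -> s2_relations q r a b (star b) ->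
  exists! f : S2qr -> A, [/\ star_hom f, f s2a = a & f s2b = b].
Proof.
move=> sa rel; exists (s2_lift a b (star b)); split=> [|f [[fD fZ fM f1 fS] fa fb]].
  split; [split|by rewrite s2_liftE|by rewrite s2_liftE].
  - exact: s2_liftD.
  - exact: s2_liftZ.
  - exact: s2_liftM.
  - exact: s2_lift1.
  - elim/S2_ind=> t; rewrite (_ : star _ = s2_class (term_star t)); last exact: S2_starE.
    rewrite !s2_liftE //; elim: t => //= [|c|s -> t ->|s -> t ->].
    + by rewrite starK.
    + by rewrite starZ star1.
    + by rewrite starD.
    + by rewrite starM.
apply/funext; elim/S2_ind=> t; rewrite s2_liftE //.
elim: t => [|||c|s es t et|s es t et] /=.
- exact: esym fa.
- exact: esym fb.
- by rewrite -star_s2b fS fb.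
- by rewrite s2_classC fZ f1.
- by rewrite es et s2_classD fD.
- by rewrite es et s2_classM fM.
Qed.

(* The grading generated by deg a = 0, deg b = 1, deg b^* = -1. *)
Inductive s2_homog : int -> S2qr -> Prop :=
  | homog_a : s2_homog 0 s2a
  | homog_b : s2_homog 1 s2b
  | homog_bs : s2_homog (-1) (star s2b)
  | homog_1 : s2_homog 0 1
  | homog_0 n : s2_homog n 0
  | homogD n x y : s2_homog n x -> s2_homog n y -> s2_homog n (x + y)
  | homogZ n (c : R[i]) x : s2_homog n x -> s2_homog n (c *: x)
  | homogM m n x y : s2_homog m x -> s2_homog n y -> s2_homog (m + n) (x * y).

Lemma homog_star n x : s2_homog n x -> s2_homog (- n) (star x).
Proof.
elim=> {n x}.
- by rewrite oppr0 star_s2a; exact: homog_a.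
- exact: homog_bs.
- by rewrite opprK starK; exact: homog_b.
- by rewrite oppr0 star1; exact: homog_1.
- by move=> n; rewrite star0; exact: homog_0.
- by move=> n x y _ hx _ hy; rewrite starD; exact: homogD.
- by move=> n c x _ hx; rewrite starZ; exact: homogZ.
- by move=> m n x y _ hx _ hy; rewrite starM opprD addrC; exact: homogM.
Qed.

(* The homogeneous component A_n. *)
Definition s2_gr (n : int) : {pred S2qr} := fun x => `[< s2_homog n x >].

Lemma s2_grP n x : reflect (s2_homog n x) (x \in s2_gr n).
Proof. exact: asboolP. Qed.

Fact s2_gr0_subalg : subalg_closed (s2_gr 0).
Proof.
split=> [|c x y /s2_grP hx /s2_grP hy|x y /s2_grP hx /s2_grP hy]; apply/s2_grP.
- exact: homog_1.
- by apply: homogD => //; exact: homogZ.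
- by rewrite -[0]addr0; exact: homogM.
Qed.
HB.instance Definition _ :=
  GRing.isSubalgClosed.Build R[i] S2qr (s2_gr 0) s2_gr0_subalg.

(* The commutative *-subalgebra B = A_0. *)
Record S2base := Base { base_val :> S2qr; base_valP : base_val \in s2_gr 0 }.
HB.instance Definition _ := [isSub for base_val].
HB.instance Definition _ := [Choice of S2base by <:].
HB.instance Definition _ := [SubChoice_isSubAlgebra of S2base by <:].

Fact base_star_subproof (x : S2base) : star (base_val x) \in s2_gr 0.
Proof.
by apply/s2_grP; rewrite -oppr0; apply: homog_star; apply/s2_grP/base_valP.
Qed.
Definition base_star (x : S2base) : S2base := Base (base_star_subproof x).

Fact base_starK : involutive base_star.
Proof. by move=> x; apply: val_inj; exact: starK. Qed.
Fact base_starD : {morph base_star : x y / x + y}.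
Proof. by move=> x y; apply: val_inj; exact: starD. Qed.
Fact base_starZ (c : R[i]) x : base_star (c *: x) = (c^*)%R *: base_star x.
Proof. by apply: val_inj; exact: starZ. Qed.
Fact base_starM x y : base_star (x * y) = base_star y * base_star x.
Proof. by apply: val_inj; exact: starM. Qed.
HB.instance Definition _ := isStarAlgebra.Build R[i] S2base
  base_starK base_starD base_starZ base_starM.

Fact sandwich_subproof n c (hc : c \in s2_gr n) (x : S2base) :
  star c * base_val x * c \in s2_gr 0.
Proof.
apply/s2_grP; rewrite -(addNr n) -[- n]addr0; apply: homogM; last exact/s2_grP.
by apply: homogM; [apply: homog_star; exact/s2_grP | exact/s2_grP/base_valP].
Qed.
(* [sandwich hc x] is the element c^* x c of B, and [star_sq hc] is c^* c. *)
Definition sandwich n c (hc : c \in s2_gr n) (x : S2base) : S2base :=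
  Base (sandwich_subproof hc x).

Fact star_sq_subproof n c (hc : c \in s2_gr n) : star c * c \in s2_gr 0.
Proof.
apply/s2_grP; rewrite -(addNr n); apply: homogM; last exact/s2_grP.
by apply: homog_star; exact/s2_grP.
Qed.
Definition star_sq n c (hc : c \in s2_gr n) : S2base :=
  Base (star_sq_subproof hc).

Definition spectrum : set {ptws S2base -> R[i]^o} :=
  [set chi | is_character chi].

Definition pos_spectrum : set {ptws S2base -> R[i]^o} :=
  [set chi | spectrum chi /\
    forall n c (hc : c \in s2_gr n), 0 <= chi (star_sq hc) :> R[i]].

(* The character with t = 0; it makes the spectrum a pointed type. *)
Let chi0 (x : S2base) : R[i]^o :=
  s2_lift (0 : R[i]^o) (Num.sqrt r)%:C (Num.sqrt r)%:C x.

Let rel0 : @s2_relations R q r R[i]^o 0 (Num.sqrt r)%:C (Num.sqrt r)%:C.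
Proof.
have e : r%:C%:A = r%:C :> R[i]^o by exact: mulr1.
have rr : ((Num.sqrt r)%:C : R[i]^o) * (Num.sqrt r)%:C = r%:C.
  by rewrite -rmorphM /= -expr2 sqr_sqrtr // /r.
split; rewrite ?expr2.
- by rewrite mul0r mulr0 scaler0.
- by rewrite mul0r mulr0 scaler0.
- by rewrite rr mul0r subr0 add0r e.
- by rewrite rr mul0r !scaler0 subr0 add0r e.
Qed.

Let chi0_star x : s2_lift (0 : R[i]^o) (Num.sqrt r)%:C (Num.sqrt r)%:C (star x)
  = ((s2_lift (0 : R[i]^o) (Num.sqrt r)%:C (Num.sqrt r)%:C x : R[i])^*)%R.
Proof.
elim/S2_ind: x => t; rewrite (_ : star _ = s2_class (term_star t)); last exact: S2_starE.
rewrite !s2_liftE //; elim: t => /= [|||c|s -> t ->|s -> t ->].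
- by rewrite conjC0.
- by rewrite (conj_rc (Num.sqrt r)).
- by rewrite (conj_rc (Num.sqrt r)).
- by rewrite -[c%:A]/(c * 1) -[_ *: _]/((c^*)%R * 1) !mulr1.
- by rewrite -rmorphD.
- by rewrite mulrC -rmorphM.
Qed.

Lemma pos_spectrum_chi0 : pos_spectrum chi0.
Proof.
split=> [|n c hc].
  split.
  - by move=> x y; exact: (s2_liftD rel0).
  - by move=> k x; exact: (s2_liftZ rel0).
  - by move=> x y; exact: (s2_liftM rel0).
  - by move=> x; exact: chi0_star.
  - by exists 1; rewrite /chi0 (s2_lift1 rel0) oner_neq0.
rewrite /chi0 /= (s2_liftM rel0) chi0_star.
by rewrite -[X in 0 <= X]/(_ * _ : R[i]) mulrC mul_conjC_ge0.
Qed.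

Definition S2spec : Type := pos_spectrum.
HB.instance Definition _ := Topological.copy S2spec (set_type pos_spectrum).
HB.instance Definition _ := isPointed.Build S2spec
  (SigSub (mem_set pos_spectrum_chi0)).

Definition spec_eval (chi : S2spec) (x : S2base) : R[i] := set_val chi x.

(* The set D_n. *)
Definition alpha_dom (n : int) : set S2spec := [set chi |
  exists c (hc : c \in s2_gr (- n)), spec_eval chi (star_sq hc) != 0].

(* For chi in D_{-n} there is exactly one such psi; elsewhere the value of    *)
(* [alpha n] is irrelevant. The same convention applies to [dual_act n] off   *)
(* [dual_dom (- n)].                                                          *)
Definition alpha (n : int) (chi : S2spec) : S2spec :=
  xget chi [set psi | forall c (hc : c \in s2_gr n),
    spec_eval chi (star_sq hc) != 0 -> forall x : S2base,
    spec_eval psi x = spec_eval chi (sandwich hc x) / spec_eval chi (star_sq hc)].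

(* C(D_n), as the ideal of the functions vanishing off D_n. *)
Definition dual_dom (n : int) : set (Cfun R S2spec) :=
  [set f | forall chi, ~ alpha_dom n chi -> f chi = 0].

Definition dual_act (n : int) (f : Cfun R S2spec) : Cfun R S2spec :=
  xget 0 [set g | dual_dom n g /\
    forall chi, alpha_dom n chi -> g chi = f (alpha (- n) chi)].

Definition dual_paction : pa_data (Cfun R S2spec) := PaData dual_dom dual_act.

Definition S2theta : pauto_data (Cfun R S2spec) :=
  PautoData (dual_dom (-1)) (dual_dom 1) (dual_act 1).

End Algebra.

(* Main.v *)
Require Import Defs.
From HB Require Import structures.
From mathcomp Require Import all_boot all_order all_algebra.
From mathcomp Require Import complex finmap ring lra.
From mathcomp Require Import all_classical all_reals all_analysis.

(* Let f(t) = t - t^2 + r, with roots t_- < 0 < t_+. Since                      *)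
(* b^* b = f(a) and b b^* = f(q^2 a), positivity of h(q^2 a) and of h(t_+-)     *)
(* gives positivity of h(a); iterating, |p(a)| is bounded by the maximum of |p| *)
(* on K = {0} u {q^2n t_+-}. The positive spectrum is K, polynomials are dense  *)
(* in C(K), so the envelope E of A receives a calculus psi : C(K) -> E.         *)
(* The map a |-> t (x) 0, b |-> f(q^2 t)^(1/2) (x) 1 defines a homomorphism     *)
(* of A into the crossed product. Conversely s = psi(f(q^2 t)^(-1/2)) b is a    *)
(* coisometry implementing the partial action, so x (x) n |-> psi(x) s_n is a   *)
(* homomorphism of the crossed product into E inverting the former on A. As     *)
(* representations of A extend to E, both algebras have the same representation *)
(* norm on A, and the image of A is dense in every envelope of the crossed      *)
(* product; isometries with dense range extend to isomorphisms of completions.  *)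

Set Implicit Arguments.
Unset Strict Implicit.
Unset Printing Implicit Defensive.

Import Order.TTheory GRing.Theory Num.Theory.
Import numFieldNormedType.Exports.
Local Open Scope classical_set_scope.
Local Open Scope ring_scope.
Local Open Scope complex_scope.

(** * Hilbert space representations and their norms *)

(** Write Q for the square of q and K for [spec_set]. The algebra A is graded with A_n = C[a] b^n
    ([homogP]), its positive characters are the evaluations of a at the points of K ([tau_ev]), and
    alpha_n is division by Q^n there ([tau_alpha]). Two facts carry the theorem.

    In every representation the norm of p(a) is at most the supremum of |p| on K ([s2poly_norm_le]).
    This is a positivity statement for polynomials in a, obtained from products of commuting
    positive operators ([pos_eltM]) and from a step that passes from h(Qa) to h(a)
    ([pos_poly_step]). Together with the density of the polynomials in C(K) ([gelfand_dense]) it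
    gives a continuous calculus psi in the envelope E of A ([calculus_ex]).

    The element b has a polar decomposition b = w s with w = f(Qa)^(1/2) invertible, because f has
    no zero on QK. So s exists in E ([coiso]), it is a coisometry whose initial projection is the
    indicator of D_{-1}, and its powers implement the dual action ([coison_psi], [coisonM]). Hence
    the crossed product maps to E ([crossed_to_envelope]), while A maps to the crossed product
    ([S2_crossed]), and the composite is iota. Pulling representations back along these maps, with
    [rep_extend] in one direction, shows that [S2_crossed] preserves the representation norm
    ([rep_norm_S2_crossed]). Its range is dense in every envelope of the crossed product
    ([S2_crossed_dense]), and [star_iso_dense] concludes. The covariance algebra and the dual
    crossed product are treated at once, through any partial action that agrees with the dual one
    ([same_theta]). *)

Lemma cmod_real (R : realType) (x : R) : cmod x%:C = `|x|.
Proof. by rewrite /cmod normc_def /= expr0n addr0 sqrtr_sqr. Qed.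

Section HilbertSpace.
Variables (R : realType) (H : hilbert R[i]).
Implicit Types u v w : H.

Definition hnorm v : R := complex.Re `|v|.
Local Notation "'<< u , v >>" := (dot H u v) (at level 0, u, v at level 50).

Lemma hnormE v : `|v| = (hnorm v)%:C.
Proof. by rewrite /hnorm RRe_real // realE normr_ge0. Qed.

Lemma hnorm_ge0 v : 0 <= hnorm v.
Proof. by have := normr_ge0 v; rewrite hnormE ler0c. Qed.

Lemma ler_hnormD u v : hnorm (u + v) <= hnorm u + hnorm v.
Proof. by rewrite -lecR rmorphD /= -!hnormE ler_normD. Qed.

Lemma hnormZ (c : R[i]) v : hnorm (c *: v) = cmod c * hnorm v.
Proof. by apply: (@complexI R); rewrite rmorphM /= -!hnormE -cmodE normrZ. Qed.

Lemma hnorm_opp v : hnorm (- v) = hnorm v.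
Proof. by rewrite /hnorm normrN. Qed.

Lemma hnorm0_eq0 v : hnorm v = 0 -> v = 0.
Proof. by move=> h; apply/normr0_eq0; rewrite hnormE h. Qed.

Lemma dot_sqr v : '<<v, v>> = (hnorm v ^+ 2)%:C.
Proof. by rewrite -hilbert_norm hnormE rmorphXn. Qed.

Lemma dotC u v : '<<u, v>> = ('<<v, u>>)^*%R.
Proof. by rewrite hermC expr0 mul1r. Qed.

Lemma dotZl (c : R[i]) u v : '<<c *: u, v>> = c * '<<u, v>>.
Proof. exact: linearZl_LR. Qed.

Lemma dotZr (c : R[i]) u v : '<<u, c *: v>> = c^*%R * '<<u, v>>.
Proof. exact: linearZr_LR. Qed.

Lemma dotDl u v w : '<<u + v, w>> = '<<u, w>> + '<<v, w>>.
Proof. exact: linearDl. Qed.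

Lemma dotDr u v w : '<<u, v + w>> = '<<u, v>> + '<<u, w>>.
Proof. exact: linearDr. Qed.

Lemma dotBl u v w : '<<u - v, w>> = '<<u, w>> - '<<v, w>>.
Proof. exact: linearBl. Qed.

Lemma dotBr u v w : '<<u, v - w>> = '<<u, v>> - '<<u, w>>.
Proof. exact: linearBr. Qed.

Lemma cmod_dot_le u v : cmod (dot H u v) <= hnorm u * hnorm v.
Proof.
have [->|v0] := eqVneq v 0.
  by rewrite linear0r cmod0 mulr_ge0 ?hnorm_ge0.
have hv0 : 0 < hnorm v.
  by rewrite lt_def hnorm_ge0 andbT; apply: contra_neq v0; exact: hnorm0_eq0.
set a := (hnorm v ^+ 2)%:C; set b := dot H u v.
(* The vector |v|^2 u - <u, v> v has a nonnegative square, which is |v|^2 times the Cauchy-Schwarz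
   gap. *)
have := dnorm_ge0 (dot H) (a *: u + (- b) *: v).
rewrite dotDl !dotDr !dotZl !dotZr (dotC v u) !dot_sqr -/b.
rewrite rmorphN (conj_rc (hnorm v ^+ 2)) -/a.
have -> : a * (a * (hnorm u ^+ 2)%:C) + a * (- b^*%R * b) +
    (- b * (a * b^*%R) + - b * (- b^*%R * a)) =
    a * (a * (hnorm u ^+ 2)%:C - b^*%R * b) by ring.
rewrite cmod_sqr /a -!rmorphM -!rmorphB -!rmorphM /= ler0c.
set x := cmod b; set y := hnorm u; set z := hnorm v => h.
have h2 : 0 <= z ^+ 2 * ((y * z) ^+ 2 - x ^+ 2).
  by move: h; congr (0 <= _); ring.
rewrite pmulr_rge0 ?exprn_gt0 // subr_ge0 in h2.
by rewrite -ler_sqr // ?nnegrE ?mulr_ge0 ?hnorm_ge0 ?cmod_ge0.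
Qed.

Lemma hilbert_complete (u : nat -> H) :
  (forall e : R, 0 < e -> exists N : nat, forall m n : nat,
      (N <= m)%N -> (N <= n)%N -> hnorm (u m - u n) < e) ->
  exists l, forall e : R, 0 < e -> exists N : nat, forall n,
      (N <= n)%N -> hnorm (u n - l) < e.
Proof.
move=> hu; have : cvg (u @ \oo).
  apply: cauchy_cvg; apply: cauchy_exP => e e0.
  have er : e = (complex.Re e)%:C by rewrite RRe_real // realE ltW.
  have [|N hN] := hu (complex.Re e); first by rewrite -ltcR -er.
  exists (u N); exists N => // n /= hn.
  by rewrite -ball_normE /= hnormE er ltcR; exact: hN.
move=> /cvg_ex[l /cvgrPdist_lt hl]; exists l => e e0.
have [|N _ hN] := hl e%:C; first by rewrite ltcR.
by exists N => n hn; rewrite -ltcR -hnormE distrC; exact: hN.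
Qed.

End HilbertSpace.

(** * Norm bounds valid in all representations *)

Section Representations.
Variables (R : realType) (A : starAlgType R[i]).
Implicit Types (x y : A) (M : R).

Lemma rep_bounded_by (H : hilbert R[i]) (pi : A -> {linear H -> H}) x :
  star_rep pi -> exists M, 0 <= M /\ forall v, hnorm (pi x v) <= M * hnorm v.
Proof.
move=> rpi; have /linear_bounded_continuous/linear_boundedP := @rep_bounded _ _ _ _ rpi x.
move=> [M [Mr hM]].
have := hM (`|M| + 1)%R; rewrite (le_lt_trans (real_ler_norm Mr)) ?ltrDl ?ltr01 //.
move=> /(_ isT) h; exists (cmod M + 1); split=> [|v].
  by rewrite addr_ge0 ?cmod_ge0.
by rewrite -lecR rmorphM rmorphD /= -!hnormE -cmodE.
Qed.

Lemma rep0 (H : hilbert R[i]) (pi : A -> {linear H -> H}) v :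
  star_rep pi -> pi 0 v = 0.
Proof. by move=> rpi; rewrite -(scale0r (0 : A)) (repZ rpi) scale0r. Qed.

Lemma repN (H : hilbert R[i]) (pi : A -> {linear H -> H}) x v :
  star_rep pi -> pi (- x) v = - pi x v.
Proof. by move=> rpi; rewrite -scaleN1r (repZ rpi) scaleN1r. Qed.

Lemma repB (H : hilbert R[i]) (pi : A -> {linear H -> H}) x y v :
  star_rep pi -> pi (x - y) v = pi x v - pi y v.
Proof. by move=> rpi; rewrite (repD rpi) repN. Qed.

Lemma rep_sqr (H : hilbert R[i]) (pi : A -> {linear H -> H}) x v :
  star_rep pi -> (hnorm (pi x v) ^+ 2)%:C = dot H (pi (star x * x) v) v.
Proof.
move=> rpi.
by rewrite -conj_rc -dot_sqr (rep_star rpi) -dotC -(repM rpi).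
Qed.

(** Stated vector by vector, so that bounds add and multiply without extended-real suprema;
    [rep_normP] translates back to [rep_norm]. *)
Definition rep_le x M := forall (H : hilbert R[i]) (pi : A -> {linear H -> H}),
  star_rep pi -> forall v, hnorm (pi x v) <= M * hnorm v.

Lemma rep_normP x M : 0 <= M -> (rep_norm x <= M%:E)%E <-> rep_le x M.
Proof.
move=> M0; split=> [h H pi rpi v|h].
  have [->|v0] := eqVneq v 0; first by rewrite linear0 /hnorm normr0 /= mulr0.
  have nv0 : 0 < hnorm v.
    by rewrite lt_def hnorm_ge0 andbT; apply: contra_neq v0; exact: hnorm0_eq0.
  have cE : cmod ((hnorm v)^-1)%:C = (hnorm v)^-1.
    by rewrite cmod_real ger0_norm // invr_ge0 hnorm_ge0.
  have : (op_norm (pi x) <= M%:E)%E.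
    by apply: le_trans h; apply: ereal_sup_ubound; exists H, pi.
  (* The operator norm is tested on the unit vector v / |v|. *)
  move=> /(le_trans _) => /(_ (hnorm (pi x (((hnorm v)^-1)%:C *: v)))%:E).
  rewrite linearZ /= hnormZ lee_fin cE -ler_pdivlMl ?invr_gt0 // invrK [hnorm v * M]mulrC.
  apply; apply: ereal_sup_ubound; exists (((hnorm v)^-1)%:C *: v) => /=.
    by rewrite hnormE hnormZ cE mulVf ?gt_eqF.
  by rewrite linearZ -[complex.Re _]/(hnorm _) hnormZ cE.
apply: ge_ereal_sup => _ [H [pi [rpi ->]]]; apply: ge_ereal_sup => _ [v /= v1 <-].
rewrite lee_fin; apply: le_trans (h _ _ rpi v) _.
by rewrite ler_piMr // -lecR -hnormE.
Qed.

Lemma rep_leD x y M N : rep_le x M -> rep_le y N -> rep_le (x + y) (M + N).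
Proof.
move=> hx hy H pi rpi v; rewrite (repD rpi) mulrDl.
by apply: le_trans (ler_hnormD _ _) _; apply: lerD; [exact: hx | exact: hy].
Qed.

Lemma rep_leZ (c : R[i]) x M : rep_le x M -> rep_le (c *: x) (cmod c * M).
Proof.
move=> hx H pi rpi v; rewrite (repZ rpi) hnormZ -mulrA.
by rewrite ler_wpM2l ?cmod_ge0 //; exact: hx.
Qed.

Lemma rep_leM x y M N : 0 <= M -> rep_le x M -> rep_le y N -> rep_le (x * y) (M * N).
Proof.
move=> M0 hx hy H pi rpi v; rewrite (repM rpi) -mulrA.
by apply: le_trans (hx _ _ rpi _) _; rewrite ler_wpM2l //; exact: hy.
Qed.

Lemma rep_le1 : rep_le 1 1.
Proof. by move=> H pi rpi v; rewrite (rep1 rpi) mul1r. Qed.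

(** Cauchy-Schwarz applied to |pi(x) v|^2 = <pi(x^* x) v, v>. *)
Lemma rep_le_star_sqr x M : 0 <= M -> rep_le (star x * x) (M ^+ 2) -> rep_le x M.
Proof.
move=> M0 hx H pi rpi v.
rewrite -ler_sqr ?nnegrE ?mulr_ge0 ?hnorm_ge0 //.
rewrite -[hnorm (pi x v) ^+ 2]ger0_norm ?sqr_ge0 // exprMn.
rewrite -cmod_real.
rewrite rep_sqr //; apply: le_trans (cmod_dot_le _ _) _.
by rewrite [hnorm v ^+ 2]expr2 mulrA ler_wpM2r ?hnorm_ge0 //; exact: hx.
Qed.

(** For y the adjoint of x one has |y v|^2 = <v, x y v> <= M |y v| |v|, and one factor |y v|
    cancels. *)
Lemma rep_le_star x M : 0 <= M -> rep_le x M -> rep_le (star x) M.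
Proof.
move=> M0 hx H pi rpi v.
have [e|n0] := eqVneq (hnorm (pi (star x) v)) 0.
  by rewrite e mulr_ge0 ?hnorm_ge0.
rewrite -(ler_pM2l (_ : 0 < hnorm (pi (star x) v))); last first.
  by rewrite lt_def n0 hnorm_ge0.
rewrite -expr2 -[_ ^+ 2]ger0_norm ?sqr_ge0 //.
rewrite -cmod_real -dot_sqr (rep_star rpi) starK dotC cmodJ.
apply: le_trans (cmod_dot_le _ _) _.
by rewrite mulrA ler_wpM2r ?hnorm_ge0 // mulrC; exact: hx.
Qed.

(** The second clause makes the norm of 1 nonzero, so that the completion is a ring in which 1
    differs from 0. *)
Definition bounded_reps :=
  (forall x, exists2 M, 0 <= M & rep_le x M) /\
  (exists (H : hilbert R[i]) (pi : A -> {linear H -> H}) (v : H),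
     star_rep pi /\ v != 0).

Hypothesis hA : bounded_reps.

Definition rnorm x : R := fine (rep_norm x).

Lemma rep_norm_ge0 x : (0 <= rep_norm x)%E.
Proof.
have [_ [H [pi [v [rpi _]]]]] := hA.
apply: (@le_trans _ _ (op_norm (pi x))).
  by apply: ereal_sup_ubound; exists 0; rewrite /= ?normr0 ?ler01 // linear0 normr0.
by apply: ereal_sup_ubound; exists H, pi.
Qed.

Lemma rnormE x : rep_norm x = (rnorm x)%:E.
Proof.
rewrite fineK // ge0_fin_numE ?rep_norm_ge0 //.
have [M M0 /(rep_normP x M0) h] := hA.1 x.
exact: le_lt_trans h (ltry _).
Qed.

Lemma rnorm_ge0 x : 0 <= rnorm x.
Proof. by rewrite -lee_fin -rnormE rep_norm_ge0. Qed.

Lemma rnorm_leP x M : 0 <= M -> rnorm x <= M <-> rep_le x M.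
Proof. by move=> M0; rewrite -lee_fin -rnormE; exact: rep_normP. Qed.

Lemma rep_le_rnorm x : rep_le x (rnorm x).
Proof. by apply/rnorm_leP => //; exact: rnorm_ge0. Qed.

Lemma rnormD x y : rnorm (x + y) <= rnorm x + rnorm y.
Proof.
by apply/rnorm_leP; rewrite ?addr_ge0 ?rnorm_ge0 //; apply: rep_leD; exact: rep_le_rnorm.
Qed.

Lemma rnormM x y : rnorm (x * y) <= rnorm x * rnorm y.
Proof.
apply/rnorm_leP; rewrite ?mulr_ge0 ?rnorm_ge0 //.
by apply: rep_leM; rewrite ?rnorm_ge0 //; exact: rep_le_rnorm.
Qed.

Lemma rnormZ_le c x : rnorm (c *: x) <= cmod c * rnorm x.
Proof.
apply/rnorm_leP; rewrite ?mulr_ge0 ?cmod_ge0 ?rnorm_ge0 //.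
by apply: rep_leZ; exact: rep_le_rnorm.
Qed.

Lemma rnormZ c x : rnorm (c *: x) = cmod c * rnorm x.
Proof.
apply/eqP; rewrite eq_le rnormZ_le /=.
have [->|c0] := eqVneq c 0; first by rewrite cmod0 mul0r rnorm_ge0.
have cc : cmod c * cmod c^-1 = 1.
  by rewrite -cmodM mulfV // (_ : 1 = (1 : R)%:C) // cmod_real normr1.
have cp : 0 < cmod c.
  by rewrite lt_def cmod_ge0 andbT; apply: contra_neq c0; exact: cmod_eq0.
have := rnormZ_le c^-1 (c *: x); rewrite scalerA mulVf // scale1r.
by rewrite -(ler_pM2l cp) mulrA cc mul1r.
Qed.

Lemma rnorm_star_sqr x : rnorm (star x * x) = rnorm x ^+ 2.
Proof.
apply/eqP; rewrite eq_le; apply/andP; split.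
  apply: le_trans (rnormM _ _) _; rewrite expr2 ler_wpM2r ?rnorm_ge0 //.
  by apply/rnorm_leP; rewrite ?rnorm_ge0 //; apply: rep_le_star;
    rewrite ?rnorm_ge0 //; exact: rep_le_rnorm.
rewrite -(sqr_sqrtr (rnorm_ge0 (star x * x))) ler_sqr ?nnegrE ?sqrtr_ge0 ?rnorm_ge0 //.
apply/rnorm_leP; rewrite ?sqrtr_ge0 //; apply: rep_le_star_sqr; rewrite ?sqrtr_ge0 //.
by rewrite sqr_sqrtr ?rnorm_ge0 //; exact: rep_le_rnorm.
Qed.

Lemma rnorm1_neq0 : rnorm 1 != 0.
Proof.
have [_ [H [pi [v [rpi v0]]]]] := hA.
apply/eqP => h; have := rep_le_rnorm 1 rpi v; rewrite h mul0r (rep1 rpi) => h'.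
by move/eqP: v0; apply; apply: hnorm0_eq0; apply/eqP; rewrite eq_le h' hnorm_ge0.
Qed.

End Representations.

(** * Completion of a star-algebra in a C*-seminorm *)

Local Open Scope quotient_scope.

Lemma cvg0P (R : realType) (f : nat -> R) : (forall n, 0 <= f n) ->
  f @ \oo --> (0 : R) <->
  (forall e : R, 0 < e -> exists k, forall n, (k <= n)%N -> f n < e).
Proof.
move=> f0; split=> [/cvgrPdist_lt h e e0|h].
  have [k _ hk] := h e e0; exists k => n hn.
  by have := hk n hn; rewrite sub0r normrN ger0_norm.
apply/cvgrPdist_lt => e e0; have [k hk] := h e e0; exists k => // n /= hn.
by rewrite sub0r normrN ger0_norm //; exact: hk.
Qed.

Record cstar_seminorm (R : realType) (A : starAlgType R[i]) (N : A -> R) : Prop :=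
  CstarSeminorm {
  seminormD : forall x y, N (x + y) <= N x + N y;
  seminormZ : forall (c : R[i]) x, N (c *: x) = cmod c * N x;
  seminormM : forall x y, N (x * y) <= N x * N y;
  seminorm_star : forall x, N (star x * x) = N x ^+ 2;
  seminorm1 : N 1 != 0
}.

Section Completion.
Variables (R : realType) (A : starAlgType R[i]) (N : A -> R).
Hypothesis hN : cstar_seminorm N.

Let ND := seminormD hN.
Let NZ := seminormZ hN.
Let NM := seminormM hN.
Let NS := seminorm_star hN.
Let N1 := seminorm1 hN.

Let N0 : N 0 = 0.
Proof. by rewrite -(scale0r (0 : A)) NZ cmod0 mul0r. Qed.
Let NN x : N (- x) = N x.
Proof. by rewrite -scaleN1r NZ cmodN (_ : 1 = (1 : R)%:C) // cmod_real normr1 mul1r. Qed.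
Let N_ge0 x : 0 <= N x.
Proof. by have := ND x (- x); rewrite subrr N0 NN -mulr2n pmulrn_lge0. Qed.
Let Nstar x : N (star x) = N x.
Proof.
have le z : N z <= N (star z).
  have [z0|z0] := eqVneq (N z) 0; first by rewrite z0 N_ge0.
  have zp : 0 < N z by rewrite lt_def z0 N_ge0.
  by rewrite -(ler_pM2r zp) -expr2 -NS.
by apply/eqP; rewrite eq_le le -{2}[x]starK le.
Qed.
Let NBC x y : N (x - y) = N (y - x).
Proof. by rewrite -NN opprB. Qed.
Let N_dist x y : `|N x - N y| <= N (x - y).
Proof.
have := ND (x - y) y; have := ND (y - x) x; rewrite !subrK (NBC y x) => h1 h2.
by rewrite ler_norml; apply/andP; split; lra.
Qed.

Definition cauchy_in (u : nat -> A) := forall e : R, 0 < e ->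
  exists k : nat, forall m n : nat, (k <= m)%N -> (k <= n)%N -> N (u m - u n) < e.

Definition null_in (u : nat -> A) := forall e : R, 0 < e ->
  exists k : nat, forall n : nat, (k <= n)%N -> N (u n) < e.

Record cseq := CSeq { cseq_fun :> nat -> A; cseqP : cauchy_in cseq_fun }.

HB.instance Definition _ := gen_eqMixin cseq.
HB.instance Definition _ := gen_choiceMixin cseq.

Lemma cseq_eq (u v : cseq) : (forall n, u n = v n) -> u = v.
Proof.
case: u v => [u hu] [v hv] /= /funext e; move: hu; rewrite e => hu.
by congr CSeq; exact: Prop_irrelevance.
Qed.

Lemma null_inD u v : null_in u -> null_in v -> null_in (fun n => u n + v n).
Proof.
move=> hu hv e e0; have e2 : 0 < e / 2 by rewrite divr_gt0.
have [k hk] := hu _ e2; have [l hl] := hv _ e2.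
exists (maxn k l) => n; rewrite geq_max => /andP[kn ln].
by apply: le_lt_trans (ND _ _) _; rewrite [e]splitr ltrD ?hk ?hl.
Qed.

Lemma null_in_le (u v : nat -> A) (M : R) :
  null_in u -> (forall n, N (v n) <= M * N (u n)) -> null_in v.
Proof.
move=> hu huv e e0; have M0 : 0 < `|M| + 1 by rewrite ltr_wpDl.
have [k hk] := hu (e / (`|M| + 1)) (divr_gt0 e0 M0); exists k => n kn.
apply: le_lt_trans (huv n) _; have := hk n kn; rewrite ltr_pdivlMr //.
apply: le_lt_trans; rewrite mulrC ler_wpM2l ?N_ge0 //.
by rewrite ler_wpDr // ler_norm.
Qed.

Lemma cseq_bounded (u : cseq) : exists M : R, forall n, N (u n) <= M.
Proof.
have [k hk] := cseqP u ltr01.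
have hm m : exists M : R, forall n, (n < m)%N -> N (u n) <= M.
  elim: m => [|m [M hM]]; first by exists 0.
  exists (Num.max M (N (u m))) => n; rewrite ltnS leq_eqVlt le_max.
  by case/orP => [/eqP ->|/hM ->] //; rewrite lexx orbT.
have [M hM] := hm k; exists (Num.max M (N (u k) + 1)) => n; rewrite le_max.
have [kn|/hM ->//] := leqP k n; apply/orP; right.
rewrite -(subrK (u k) (u n)); apply: le_trans (ND _ _) _.
by rewrite addrC lerD2l ltW // hk.
Qed.

Definition cseq_eqv (u v : cseq) := `[< null_in (fun n => u n - v n) >].

Fact cseq_equiv : equiv_class_of cseq_eqv.
Proof.
split=> [u|u v|v u w].
- by apply/asboolP => e e0; exists 0%N => n _; rewrite subrr N0.
- have h a b : null_in (fun n => cseq_fun a n - cseq_fun b n) ->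
      null_in (fun n => cseq_fun b n - cseq_fun a n).
    by move=> /(@null_in_le _ _ 1); apply => n; rewrite mul1r NBC.
  by apply/asboolP/asboolP; exact: h.
- move=> /asboolP h /asboolP h'; apply/asboolP => e e0.
  have [k hk] := null_inD h h' e0; exists k => n /hk.
  by rewrite addrA subrK.
Qed.
Canonical cseq_equiv_rel := EquivRelPack cseq_equiv.

Definition completion := {eq_quot cseq_equiv_rel}.
HB.instance Definition _ := Choice.on completion.

Definition climit (u : cseq) : completion := \pi_({eq_quot cseq_equiv_rel}) u.

Lemma climitP (u v : cseq) : climit u = climit v <-> null_in (fun n => u n - v n).
Proof. by split=> [/eqmodP/asboolP//|h]; apply/eqmodP/asboolP. Qed.

Lemma completion_ind (P : completion -> Prop) :
  (forall u, P (climit u)) -> forall x, P x.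
Proof.
by move=> h x; rewrite -(@reprK _ {eq_quot cseq_equiv_rel} x); exact: h.
Qed.

Lemma repr_climit u : null_in (fun n => repr (climit u) n - u n).
Proof. by apply/climitP; exact: (@reprK _ {eq_quot cseq_equiv_rel}). Qed.

Fact cseq_add_subproof (u v : cseq) : cauchy_in (fun n => u n + v n).
Proof.
move=> e e0; have e2 : 0 < e / 2 by rewrite divr_gt0.
have [k hk] := cseqP u e2; have [l hl] := cseqP v e2.
exists (maxn k l) => m n; rewrite !geq_max => /andP[km lm] /andP[kn ln].
rewrite opprD addrACA; apply: le_lt_trans (ND _ _) _.
by rewrite [e]splitr ltrD ?hk ?hl.
Qed.
Definition cseq_add u v := CSeq (cseq_add_subproof u v).

Fact cseq_scale_subproof (c : R[i]) (u : cseq) : cauchy_in (fun n => c *: u n).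
Proof.
move=> e e0; have M0 : 0 < cmod c + 1 by rewrite ltr_wpDl ?cmod_ge0.
have [k hk] := cseqP u (divr_gt0 e0 M0); exists k => m n km kn.
rewrite -scalerBr NZ; have := hk m n km kn; rewrite ltr_pdivlMr //.
by apply: le_lt_trans; rewrite mulrC ler_wpM2l // lerDl.
Qed.
Definition cseq_scale c u := CSeq (cseq_scale_subproof c u).

Fact cseq_mul_subproof (u v : cseq) : cauchy_in (fun n => u n * v n).
Proof.
move=> e e0; have [M hM] := cseq_bounded u; have [L hL] := cseq_bounded v.
have M0 : 0 <= M by exact: le_trans (hM 0%N).
have L0 : 0 <= L by exact: le_trans (hL 0%N).
have K0 : 0 < M + L + 1 by rewrite ltr_wpDl // addr_ge0.
have [k hk] := cseqP u (divr_gt0 e0 K0).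
have [l hl] := cseqP v (divr_gt0 e0 K0).
exists (maxn k l) => m n; rewrite !geq_max => /andP[km lm] /andP[kn ln].
have -> : u m * v m - u n * v n = u m * (v m - v n) + (u m - u n) * v n.
  by rewrite mulrBr mulrBl addrA subrK.
apply: le_lt_trans (ND _ _) _.
have h1 : N (u m * (v m - v n)) <= M * (e / (M + L + 1)).
  apply: le_trans (NM _ _) _; apply: ler_pM => //; exact/ltW/hl.
have h2 : N ((u m - u n) * v n) <= (e / (M + L + 1)) * L.
  apply: le_trans (NM _ _) _; apply: ler_pM => //; exact/ltW/hk.
apply: le_lt_trans (lerD h1 h2) _.
rewrite -[ltRHS](divfK (lt0r_neq0 K0) e) mulrC -mulrDr ltr_pM2l ?divr_gt0 //.
by rewrite ltrDl.
Qed.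
Definition cseq_mul u v := CSeq (cseq_mul_subproof u v).

Fact cseq_star_subproof (u : cseq) : cauchy_in (fun n => star (u n)).
Proof.
move=> e e0; have [k hk] := cseqP u e0; exists k => m n km kn.
by rewrite -starN -starD Nstar hk.
Qed.
Definition cseq_star u := CSeq (cseq_star_subproof u).

Fact cseq_cst_subproof (x : A) : cauchy_in (fun=> x).
Proof. by move=> e e0; exists 0%N => m n _ _; rewrite subrr N0. Qed.
Definition cseq_cst x := CSeq (cseq_cst_subproof x).

Definition comp_add (x y : completion) := climit (cseq_add (repr x) (repr y)).
Definition comp_mul (x y : completion) := climit (cseq_mul (repr x) (repr y)).
Definition comp_scale c (x : completion) := climit (cseq_scale c (repr x)).
Definition comp_star (x : completion) := climit (cseq_star (repr x)).
Definition comp_opp (x : completion) := comp_scale (-1) x.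
Definition comp_in (x : A) : completion := climit (cseq_cst x).

Lemma comp_addE u v : comp_add (climit u) (climit v) = climit (cseq_add u v).
Proof.
apply/climitP; have := null_inD (repr_climit u) (repr_climit v).
by move=> /(@null_in_le _ _ 1); apply => n; rewrite mul1r /= opprD addrACA.
Qed.

Lemma comp_scaleE c u : comp_scale c (climit u) = climit (cseq_scale c u).
Proof.
apply/climitP; have := repr_climit u.
by move=> /(@null_in_le _ _ (cmod c)); apply => n; rewrite /= -scalerBr NZ.
Qed.

Lemma comp_starE u : comp_star (climit u) = climit (cseq_star u).
Proof.
apply/climitP; have := repr_climit u.
by move=> /(@null_in_le _ _ 1); apply => n; rewrite /= -starN -starD Nstar mul1r.
Qed.

Lemma comp_mulE u v : comp_mul (climit u) (climit v) = climit (cseq_mul u v).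
Proof.
apply/climitP; set u' := repr _; set v' := repr _.
have [M hM] := cseq_bounded u'; have [L hL] := cseq_bounded v.
have h1 : null_in (fun n => u' n * (v' n - v n)).
  apply: null_in_le (repr_climit v) _ => n; apply: le_trans (NM _ _) _.
  by apply: ler_wpM2r => //; exact: hM.
have h2 : null_in (fun n => (u' n - u n) * v n).
  apply: null_in_le (repr_climit u) _ => n; apply: le_trans (NM _ _) _.
  by rewrite mulrC; apply: ler_wpM2r => //; exact: hL.
have := null_inD h1 h2; move=> /(@null_in_le _ _ 1); apply => n.
by rewrite mul1r /= mulrBr mulrBl addrA subrK.
Qed.

Let compE := (comp_addE, comp_mulE, comp_scaleE, comp_starE).

Fact comp_addA : associative comp_add.
Proof.
elim/completion_ind=> u; elim/completion_ind=> v; elim/completion_ind=> w.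
by rewrite !compE; congr climit; apply: cseq_eq => n; exact: addrA.
Qed.
Fact comp_addC : commutative comp_add.
Proof.
elim/completion_ind=> u; elim/completion_ind=> v.
by rewrite !compE; congr climit; apply: cseq_eq => n; exact: addrC.
Qed.
Fact comp_add0 : left_id (comp_in 0) comp_add.
Proof.
elim/completion_ind=> u.
by rewrite !compE; congr climit; apply: cseq_eq => n; exact: add0r.
Qed.
Fact comp_addN : left_inverse (comp_in 0) comp_opp comp_add.
Proof.
elim/completion_ind=> u; rewrite /comp_opp.
rewrite !compE; congr climit; apply: cseq_eq => n /=.
by rewrite scaleN1r addNr.
Qed.
HB.instance Definition _ :=
  GRing.isZmodule.Build completion comp_addA comp_addC comp_add0 comp_addN.

Fact comp_mulA : associative comp_mul.
Proof.
elim/completion_ind=> u; elim/completion_ind=> v; elim/completion_ind=> w.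
by rewrite !compE; congr climit; apply: cseq_eq => n; exact: mulrA.
Qed.
Fact comp_mul1l : left_id (comp_in 1) comp_mul.
Proof.
elim/completion_ind=> u.
by rewrite !compE; congr climit; apply: cseq_eq => n; exact: mul1r.
Qed.
Fact comp_mul1r : right_id (comp_in 1) comp_mul.
Proof.
elim/completion_ind=> u.
by rewrite !compE; congr climit; apply: cseq_eq => n; exact: mulr1.
Qed.
Fact comp_mulDl : left_distributive comp_mul comp_add.
Proof.
elim/completion_ind=> u; elim/completion_ind=> v; elim/completion_ind=> w.
by rewrite !compE; congr climit; apply: cseq_eq => n; exact: mulrDl.
Qed.
Fact comp_mulDr : right_distributive comp_mul comp_add.
Proof.
elim/completion_ind=> u; elim/completion_ind=> v; elim/completion_ind=> w.
by rewrite !compE; congr climit; apply: cseq_eq => n; exact: mulrDr.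
Qed.
Fact comp_1_neq0 : comp_in 1 != comp_in 0.
Proof.
apply/eqP => /climitP h; have N1p : 0 < N 1 by rewrite lt_def N1 N_ge0.
have [k hk] := h _ N1p; have := hk k (leqnn k).
by rewrite /= subr0 ltxx.
Qed.
HB.instance Definition _ := GRing.Zmodule_isNzRing.Build completion
  comp_mulA comp_mul1l comp_mul1r comp_mulDl comp_mulDr comp_1_neq0.

Fact comp_scaleA c d x : comp_scale c (comp_scale d x) = comp_scale (c * d) x.
Proof.
elim/completion_ind: x => u.
by rewrite !compE; congr climit; apply: cseq_eq => n; exact: scalerA.
Qed.
Fact comp_scale1 : left_id 1 comp_scale.
Proof.
elim/completion_ind=> u.
by rewrite !compE; congr climit; apply: cseq_eq => n; exact: scale1r.
Qed.
Fact comp_scaleDr : right_distributive comp_scale +%R.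
Proof.
move=> c; elim/completion_ind=> u; elim/completion_ind=> v.
rewrite -[_ + _]/(comp_add _ _) -[RHS]/(comp_add _ _) !compE.
by congr climit; apply: cseq_eq => n; exact: scalerDr.
Qed.
Fact comp_scaleDl x : {morph comp_scale^~ x : c d / c + d}.
Proof.
move=> c d; elim/completion_ind: x => u.
rewrite -[RHS]/(comp_add _ _) !compE.
by congr climit; apply: cseq_eq => n; exact: scalerDl.
Qed.
HB.instance Definition _ := GRing.Zmodule_isLmodule.Build R[i] completion
  comp_scaleA comp_scale1 comp_scaleDr comp_scaleDl.

Fact comp_scaleAl (c : R[i]) (x y : completion) : c *: (x * y) = (c *: x) * y.
Proof.
elim/completion_ind: x => u; elim/completion_ind: y => v.
rewrite -[LHS]/(comp_scale _ (comp_mul _ _)) -[RHS]/(comp_mul (comp_scale _ _) _).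
by rewrite !compE; congr climit; apply: cseq_eq => n; exact: scalerAl.
Qed.
HB.instance Definition _ :=
  GRing.Lmodule_isLalgebra.Build R[i] completion comp_scaleAl.
Fact comp_scaleAr (c : R[i]) (x y : completion) : c *: (x * y) = x * (c *: y).
Proof.
elim/completion_ind: x => u; elim/completion_ind: y => v.
rewrite -[LHS]/(comp_scale _ (comp_mul _ _)) -[RHS]/(comp_mul _ (comp_scale _ _)).
by rewrite !compE; congr climit; apply: cseq_eq => n; exact: scalerAr.
Qed.
HB.instance Definition _ :=
  GRing.Lalgebra_isAlgebra.Build R[i] completion comp_scaleAr.

Fact comp_starK : involutive comp_star.
Proof.
elim/completion_ind=> u.
by rewrite !compE; congr climit; apply: cseq_eq => n; exact: starK.
Qed.
Fact comp_starD : {morph comp_star : x y / x + y}.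
Proof.
elim/completion_ind=> u; elim/completion_ind=> v.
rewrite -[_ + _]/(comp_add _ _) -[RHS]/(comp_add _ _) !compE.
by congr climit; apply: cseq_eq => n; exact: starD.
Qed.
Fact comp_starZ (c : R[i]) x : comp_star (c *: x) = (c^*)%R *: comp_star x.
Proof.
elim/completion_ind: x => u.
rewrite -[_ *: _]/(comp_scale _ _) -[RHS]/(comp_scale _ _) !compE.
by congr climit; apply: cseq_eq => n; exact: starZ.
Qed.
Fact comp_starM x y : comp_star (x * y) = comp_star y * comp_star x.
Proof.
elim/completion_ind: x => u; elim/completion_ind: y => v.
rewrite -[_ * _]/(comp_mul _ _) -[RHS]/(comp_mul _ _) !compE.
by congr climit; apply: cseq_eq => n; exact: starM.
Qed.
HB.instance Definition _ := isStarAlgebra.Build R[i] completion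
  comp_starK comp_starD comp_starZ comp_starM.

Lemma cseq_norm_cvg (u : cseq) : cvg ((fun n => N (u n)) @ \oo).
Proof.
have [|l hl] := @real_cauchy R (fun n => N (u n)).
  move=> e e0; have [k hk] := cseqP u e0; exists k => m n km kn.
  exact: le_lt_trans (N_dist _ _) (hk m n km kn).
apply/cvg_ex; exists l; apply/cvgrPdist_lt => e e0.
have [k hk] := hl e e0; exists k => // n /= kn; rewrite distrC; exact: hk.
Qed.

Definition cseq_norm (u : cseq) : R := lim ((fun n => N (u n)) @ \oo).

Lemma cseq_normP (u : cseq) : (fun n => N (u n)) @ \oo --> cseq_norm u.
Proof. exact: cseq_norm_cvg. Qed.

Definition comp_norm (x : completion) := cseq_norm (repr x).

Lemma comp_normP (u : cseq) : (fun n => N (u n)) @ \oo --> comp_norm (climit u).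
Proof.
apply/cvgrPdist_lt => e e0; have e2 : 0 < e / 2 by rewrite divr_gt0.
have /cvgrPdist_lt/(_ _ e2)[k _ hk] := @cseq_normP (repr (climit u)).
have [l hl] := repr_climit u e2; exists (maxn k l) => // n /=.
rewrite geq_max => /andP[kn ln]; have := hk n kn => /= h1.
have := le_lt_trans (N_dist _ _) (hl n ln) => h2; rewrite [e]splitr.
apply: le_lt_trans (ltrD h1 h2).
by rewrite -[X in `|X - _|](subrK (N (repr (climit u) n))) -addrA; exact: ler_normD.
Qed.

Fact comp_normD x y : comp_norm (x + y) <= comp_norm x + comp_norm y.
Proof.
elim/completion_ind: x => u; elim/completion_ind: y => v.
rewrite -[_ + climit v]/(comp_add _ _) comp_addE.
apply: (ler_cvg_to (@comp_normP _) (cvgD (@comp_normP u) (@comp_normP v))).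
by apply: nearW => n; exact: ND.
Qed.

Fact comp_normZ (c : R[i]) x : comp_norm (c *: x) = cmod c * comp_norm x.
Proof.
elim/completion_ind: x => u; rewrite -[_ *: _]/(comp_scale _ _) comp_scaleE.
have := @comp_normP (cseq_scale c u).
have -> : (fun n => N (cseq_scale c u n)) = (fun n => cmod c * N (u n)).
  by apply/funext => n; exact: NZ.
move=> /(cvg_unique _); apply => //.
by apply: cvgM; [exact: cvg_cst | exact: comp_normP].
Qed.

Lemma comp_norm_ge0 x : 0 <= comp_norm x.
Proof.
elim/completion_ind: x => u; apply: (ler_cvg_to (cvg_cst 0) (@comp_normP u)).
by apply: nearW => n.
Qed.

Fact comp_norm0_eq0 x : comp_norm x = 0 -> x = 0.
Proof.
elim/completion_ind: x => u u0; apply/climitP => e e0.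
have := @comp_normP u; rewrite u0 => /cvg0P /(_ e e0)[] // k hk.
by exists k => n kn; rewrite /= subr0 hk.
Qed.

Fact comp_normM x y : comp_norm (x * y) <= comp_norm x * comp_norm y.
Proof.
elim/completion_ind: x => u; elim/completion_ind: y => v.
rewrite -[_ * climit v]/(comp_mul _ _) comp_mulE.
apply: (ler_cvg_to (@comp_normP _) (cvgM (@comp_normP u) (@comp_normP v))).
by apply: nearW => n; exact: NM.
Qed.

Fact comp_norm_star x : comp_norm (star x * x) = comp_norm x ^+ 2.
Proof.
elim/completion_ind: x => u.
rewrite -[_ * _]/(comp_mul (comp_star _) _) comp_starE comp_mulE.
have := @comp_normP (cseq_mul (cseq_star u) u).
have -> : (fun n => N (cseq_mul (cseq_star u) u n)) = (fun n => N (u n) * N (u n)).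
  by apply/funext => n; rewrite -expr2 -NS.
move=> /(cvg_unique _); apply => //.
by rewrite expr2; apply: cvgM; exact: comp_normP.
Qed.

Lemma comp_inP x : comp_norm (comp_in x) = N x.
Proof.
apply: (@cvg_unique R _ ((fun _ : nat => N x) @ \oo)).
- exact: norm_hausdorff.
- exact: (@comp_normP (cseq_cst x)).
- exact: cvg_cst.
Qed.

Lemma comp_in_lim (u : cseq) (e : R) : 0 < e ->
  exists k : nat, forall n, (k <= n)%N -> comp_norm (climit u - comp_in (u n)) < e.
Proof.
move=> e0; have e2 : 0 < e / 2 by rewrite divr_gt0.
have [k hk] := cseqP u e2; exists k => n kn.
have -> : climit u - comp_in (u n) =
    comp_add (climit u) (comp_scale (-1) (comp_in (u n))) by rewrite -scaleN1r.
rewrite /comp_in comp_scaleE comp_addE.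
apply: le_lt_trans (_ : e / 2 < e); last by rewrite ltr_pdivrMr // ltr_pMr // ltr1n.
apply: (ler_cvg_to (@comp_normP _) (cvg_cst _)).
by exists k => // m /= km; rewrite scaleN1r ltW // hk.
Qed.

Lemma comp_in_dense x (e : R) : 0 < e -> exists y, comp_norm (x - comp_in y) < e.
Proof.
move=> e0; elim/completion_ind: x => u.
by have [k hk] := comp_in_lim u e0; exists (u k); exact: hk.
Qed.

Let comp_inB x y : comp_in (x - y) = comp_in x - comp_in y.
Proof.
rewrite -(scaleN1r (comp_in y)) -[RHS]/(comp_add _ (comp_scale _ _)).
rewrite /comp_in comp_scaleE comp_addE; congr climit.
by apply: cseq_eq => n /=; rewrite scaleN1r.
Qed.

Let comp_normN x : comp_norm (- x) = comp_norm x.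
Proof.
by rewrite -scaleN1r comp_normZ cmodN (_ : 1 = (1 : R)%:C) // cmod_real normr1 mul1r.
Qed.

(** Diagonal argument: choose a_n in A within 1/(n+1) of u_n; the sequence a is Cauchy in A and its
    class is the limit of u. *)
Fact comp_complete (u : nat -> completion) :
  (forall e : R, 0 < e -> exists k : nat, forall m n : nat,
    (k <= m)%N -> (k <= n)%N -> comp_norm (u m - u n) < e) ->
  exists l, (fun n => comp_norm (u n - l)) @ \oo --> (0 : R).
Proof.
move=> hu.
have /choice[a ha] n : exists y, comp_norm (u n - comp_in y) < n.+1%:R^-1.
  by apply: comp_in_dense; rewrite invr_gt0.
have small (e : R) : 0 < e -> exists k : nat, forall n, (k <= n)%N ->
    comp_norm (u n - comp_in (a n)) < e.
  move=> e0; have [k _ hk] := near_infty_natSinv_lt (PosNum e0).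
  by exists k => n kn; apply: lt_trans (ha n) _; exact: hk.
have ca : cauchy_in a.
  move=> e e0; have e3 : 0 < e / 3 by rewrite divr_gt0.
  have [k hk] := small _ e3; have [l hl] := hu _ e3.
  exists (maxn k l) => m n; rewrite !geq_max => /andP[km lm] /andP[kn ln].
  rewrite -comp_inP comp_inB.
  have -> : comp_in (a m) - comp_in (a n) = - (u m - comp_in (a m)) +
      (u m - u n) + (u n - comp_in (a n)).
    by rewrite opprB !addrA !subrK.
  have -> : e = e / 3 + e / 3 + e / 3 by field.
  apply: le_lt_trans (comp_normD _ _) _; apply: ltrD; last exact: hk.
  apply: le_lt_trans (comp_normD _ _) _.
  by apply: ltrD; [rewrite comp_normN; exact: hk | exact: hl].
exists (climit (CSeq ca)); apply/cvg0P => [n|e e0]; first exact: comp_norm_ge0.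
have e2 : 0 < e / 2 by rewrite divr_gt0.
have [k hk] := small _ e2; have [l hl] := comp_in_lim (CSeq ca) e2.
exists (maxn k l) => n; rewrite geq_max => /andP[kn ln].
have -> : u n - climit (CSeq ca) = (u n - comp_in (a n)) -
    (climit (CSeq ca) - comp_in (a n)) by rewrite opprB addrA subrK.
rewrite [e]splitr; apply: le_lt_trans (comp_normD _ _) _.
by apply: ltrD; [exact: hk | rewrite comp_normN; exact: hl].
Qed.

HB.instance Definition _ := isCstarAlgebra.Build R completion comp_normD comp_normZ
  comp_norm0_eq0 comp_normM comp_norm_star comp_complete.

Lemma comp_in_star_hom : star_hom comp_in.
Proof.
split=> [x y|c x|x y||x].
- rewrite -[RHS]/(comp_add _ _) /comp_in comp_addE.
  by congr climit; exact: cseq_eq.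
- rewrite -[RHS]/(comp_scale _ _) /comp_in comp_scaleE.
  by congr climit; exact: cseq_eq.
- rewrite -[RHS]/(comp_mul _ _) /comp_in comp_mulE.
  by congr climit; exact: cseq_eq.
- by [].
- rewrite -[RHS]/(comp_star _) /comp_in comp_starE.
  by congr climit; exact: cseq_eq.
Qed.

End Completion.

Lemma bounded_reps_envelope (R : realType) (A : starAlgType R[i]) :
  bounded_reps A -> has_envelope A.
Proof.
move=> hA; pose N := @rnorm R A.
have hN : cstar_seminorm N.
  split; [exact: rnormD|exact: rnormZ|exact: rnormM|exact: rnorm_star_sqr|].
  exact: rnorm1_neq0.
exists (completion hN), (comp_in hN); split.
- exact: comp_in_star_hom.
- by move=> x; rewrite (rnormE hA) -[cnorm _]/(comp_norm _) comp_inP.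
- by move=> y e e0; exact: comp_in_dense.
Qed.

(** * Extension by density *)

(** The part of a norm shared by C*-algebras and Hilbert spaces that suffices for limits of
    sequences. *)
Record group_norm (R : realType) (M : zmodType) (nm : M -> R) : Prop := GroupNorm {
  gnormD : forall x y, nm (x + y) <= nm x + nm y;
  gnormN : forall x, nm (- x) = nm x;
  gnorm0 : nm 0 = 0;
  gnorm0_eq0 : forall x, nm x = 0 -> x = 0
}.

Definition tends (R : realType) (M : zmodType) (nm : M -> R) (u : nat -> M) (l : M) :=
  (fun n => nm (u n - l)) @ \oo --> (0 : R).

Section GroupNorm.
Variables (R : realType) (M : zmodType) (nm : M -> R).
Hypothesis h : group_norm nm.

Lemma gnorm_ge0 x : 0 <= nm x.
Proof. by have := gnormD h x (- x); rewrite subrr gnorm0 // gnormN // -mulr2n pmulrn_lge0. Qed.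

Lemma gnormB_sym x y : nm (x - y) = nm (y - x).
Proof. by rewrite -gnormN // opprB. Qed.

Lemma gnormB_trans z x y : nm (x - y) <= nm (x - z) + nm (z - y).
Proof. by rewrite -{1}(subrK z x) -addrA; exact: gnormD. Qed.

Lemma tendsP u l : tends nm u l <->
  forall e : R, 0 < e -> exists k, forall n, (k <= n)%N -> nm (u n - l) < e.
Proof. by apply: cvg0P => n; exact: gnorm_ge0. Qed.

Lemma tends_unique u l m : tends nm u l -> tends nm u m -> l = m.
Proof.
move=> /tendsP hl /tendsP hm; apply/eqP; rewrite -subr_eq0; apply/eqP.
apply: (gnorm0_eq0 h); apply/eqP; rewrite eq_le gnorm_ge0 andbT.
apply/ler_addgt0Pr => e e0; rewrite add0r; have e2 : 0 < e / 2 by rewrite divr_gt0.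
have [k hk] := hl _ e2; have [k' hk'] := hm _ e2; pose n := maxn k k'.
apply: le_trans (gnormB_trans (u n) _ _) _; rewrite [e]splitr lerD //.
  by rewrite gnormB_sym ltW // hk // leq_maxl.
by rewrite ltW // hk' // leq_maxr.
Qed.

Lemma tends_cst l : tends nm (fun=> l) l.
Proof. by apply/tendsP => e e0; exists 0%N => n _; rewrite subrr gnorm0. Qed.

Lemma tendsD u v l m : tends nm u l -> tends nm v m ->
  tends nm (fun n => u n + v n) (l + m).
Proof.
move=> /tendsP hl /tendsP hm; apply/tendsP => e e0.
have e2 : 0 < e / 2 by rewrite divr_gt0.
have [k hk] := hl _ e2; have [k' hk'] := hm _ e2; exists (maxn k k') => n.
rewrite geq_max => /andP[kn kn']; rewrite opprD addrACA [e]splitr.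
by apply: le_lt_trans (gnormD h _ _) _; rewrite ltrD ?hk ?hk'.
Qed.

End GroupNorm.

Lemma tends_le (R : realType) (M M' : zmodType) (nm : M -> R) (nm' : M' -> R)
    (K : R) u l v m : group_norm nm -> group_norm nm' ->
  (forall n, nm' (v n - m) <= K * nm (u n - l)) -> tends nm u l -> tends nm' v m.
Proof.
move=> h h' le /(tendsP h) hu; apply/(tendsP h') => e e0.
have K0 : 0 < `|K| + 1 by rewrite ltr_wpDl.
have [k hk] := hu _ (divr_gt0 e0 K0); exists k => n kn.
apply: le_lt_trans (le n) _; have := hk n kn; rewrite ltr_pdivlMr //.
apply: le_lt_trans; rewrite mulrC ler_wpM2l ?(gnorm_ge0 h) //.
by rewrite ler_wpDr // ler_norm.
Qed.

Lemma dense_tends (R : realType) (P : Type) (D : zmodType) (nd : D -> R) (i : P -> D) d :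
  group_norm nd -> (forall e : R, 0 < e -> exists x, nd (d - i x) < e) ->
  exists u : nat -> P, tends nd (fun n => i (u n)) d.
Proof.
move=> hd dense; have /choice[u hu] n : exists x, nd (d - i x) < n.+1%:R^-1.
  by apply: dense; rewrite invr_gt0.
exists u; apply/tendsP => // e e0.
have [k _ hk] := near_infty_natSinv_lt (PosNum e0).
by exists k => n kn; rewrite gnormB_sym //; apply: lt_trans (hu n) _; exact: hk.
Qed.

Section ExtendDense.
Variables (R : realType) (P D M : zmodType) (nd : D -> R) (nm : M -> R).
Variables (i : P -> D) (j : P -> M) (K : R).
Hypothesis hd : group_norm nd.
Hypothesis hm : group_norm nm.
Hypothesis complete : forall u : nat -> M,
  (forall e : R, 0 < e -> exists k : nat, forall m n : nat,
    (k <= m)%N -> (k <= n)%N -> nm (u m - u n) < e) ->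
  exists l, tends nm u l.
Hypothesis iB : forall x y, i (x - y) = i x - i y.
Hypothesis jB : forall x y, j (x - y) = j x - j y.
Hypothesis K_ge0 : 0 <= K.
Hypothesis le_ji : forall x, nm (j x) <= K * nd (i x).
Hypothesis dense : forall d (e : R), 0 < e -> exists x, nd (d - i x) < e.

(** One l serves all sequences u, so that choice turns the lemma into a well-defined extension of j
    along i. *)
Lemma extend_tends d : exists l, forall u : nat -> P,
  tends nd (fun n => i (u n)) d -> tends nm (fun n => j (u n)) l.
Proof.
have [u hu] := dense_tends hd (dense d); have [l hl] : exists l, tends nm (fun n => j (u n)) l.
  apply: complete => e e0; have K0 : 0 < K + 1 by rewrite ltr_wpDl.
  have e2 : 0 < e / (K + 1) / 2 by rewrite !divr_gt0.
  have [k hk] := (tendsP hd _ _).1 hu _ e2; exists k => m n km kn.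
  rewrite -jB; apply: le_lt_trans (le_ji _) _; rewrite iB.
  have : nd (i (u m) - i (u n)) < e / (K + 1).
    rewrite [ltRHS]splitr; apply: le_lt_trans (gnormB_trans hd d _ _) _.
    by rewrite ltrD ?hk // gnormB_sym // hk.
  rewrite ltr_pdivlMr //; apply: le_lt_trans.
  by rewrite mulrC ler_wpM2l ?(gnorm_ge0 hd) // lerDl.
exists l => v hv; apply/tendsP => // e e0.
have e2 : 0 < e / 2 by rewrite divr_gt0.
have K0 : 0 < K + 1 by rewrite ltr_wpDl.
have e4 : 0 < e / 2 / (K + 1) / 2 by rewrite !divr_gt0.
have [k1 h1] := (tendsP hm _ _).1 hl _ e2.
have [k2 h2] := (tendsP hd _ _).1 hu _ e4.
have [k3 h3] := (tendsP hd _ _).1 hv _ e4.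
exists (maxn k1 (maxn k2 k3)) => n; rewrite !geq_max => /and3P[n1 n2 n3].
apply: le_lt_trans (gnormB_trans hm (j (u n)) _ _) _.
rewrite [e]splitr ltrD ?h1 // -jB; apply: le_lt_trans (le_ji _) _; rewrite iB.
have : nd (i (v n) - i (u n)) < e / 2 / (K + 1).
  rewrite [ltRHS]splitr; apply: le_lt_trans (gnormB_trans hd d _ _) _.
  by rewrite ltrD ?h3 // gnormB_sym // h2.
rewrite ltr_pdivlMr //; apply: le_lt_trans.
by rewrite mulrC ler_wpM2l ?(gnorm_ge0 hd) // lerDl.
Qed.

End ExtendDense.

Section CstarNorm.
Variables (R : realType) (A : cstarAlgType R).

Lemma cnorm_group : group_norm (@cnorm R A).
Proof.
split; [exact: cnormD| |exact: cnorm0|exact: cnorm0_eq0].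
by move=> x; rewrite -scaleN1r cnormZ cmodN (_ : 1 = (1 : R)%:C) // cmod_real normr1 mul1r.
Qed.

Local Notation "u ~> l" := (tends (@cnorm R A) u l) (at level 70).
Implicit Types (u v : nat -> A).

Lemma cnorm_ge0 (x : A) : 0 <= cnorm x.
Proof. exact: gnorm_ge0 cnorm_group x. Qed.

Lemma cnormS (x : A) : cnorm (star x) = cnorm x.
Proof.
have le (z : A) : cnorm z <= cnorm (star z).
  have [z0|z0] := eqVneq (cnorm z) 0; first by rewrite z0 cnorm_ge0.
  have zp : 0 < cnorm z by rewrite lt_def z0 cnorm_ge0.
  by rewrite -(ler_pM2r zp) -expr2 -cnorm_star cnormM.
by apply/eqP; rewrite eq_le le -{2}[x]starK le.
Qed.

Lemma ctendsM u v l m : u ~> l -> v ~> m -> (fun n => u n * v n) ~> l * m.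
Proof.
move=> hu hv.
have h : (fun n => cnorm (u n - l) * (cnorm (v n - m) + cnorm m) +
    cnorm l * cnorm (v n - m)) @ \oo --> (0 * (0 + cnorm m) + cnorm l * 0 : R).
  apply: cvgD; apply: cvgM => //; last exact: cvg_cst.
  by apply: cvgD => //; exact: cvg_cst.
rewrite mul0r mulr0 addr0 in h; apply: squeeze_cvgr (cvg_cst _) h.
apply: nearW => n; rewrite cnorm_ge0 /=.
have -> : u n * v n - l * m = (u n - l) * v n + l * (v n - m).
  by rewrite mulrBl mulrBr addrA subrK.
apply: le_trans (cnormD _ _) _; apply: lerD; apply: le_trans (cnormM _ _) _ => //.
by rewrite ler_wpM2l ?cnorm_ge0 // -{1}(subrK m (v n)) cnormD.
Qed.

Lemma ctendsZ (c : R[i]) u l : u ~> l -> (fun n => c *: u n) ~> c *: l.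
Proof.
apply: (tends_le (K := cmod c) cnorm_group cnorm_group) => n.
by rewrite -scalerBr cnormZ.
Qed.

Lemma ctendsS u l : u ~> l -> (fun n => star (u n)) ~> star l.
Proof.
apply: (tends_le (K := 1) cnorm_group cnorm_group) => n.
by rewrite -starN -starD cnormS mul1r.
Qed.

End CstarNorm.

Lemma star_homB (C : numClosedFieldType) (A B : starAlgType C) (f : A -> B) :
  star_hom f -> forall x y, f (x - y) = f x - f y.
Proof. by case=> fD fZ _ _ _ x y; rewrite fD -scaleN1r fZ scaleN1r. Qed.

Definition dense_range (R : realType) (A : Type) (D : cstarAlgType R) (i : A -> D) :=
  forall d (e : R), 0 < e -> exists x, cnorm (d - i x) < e.

Definition in_closure (R : realType) (A : Type) (D : cstarAlgType R) (i : A -> D) d :=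
  forall e : R, 0 < e -> exists x, cnorm (d - i x) < e.

Lemma in_closureP (R : realType) (A : Type) (D : cstarAlgType R) (i : A -> D) d :
  in_closure i d <-> exists u : nat -> A, tends (@cnorm R D) (fun n => i (u n)) d.
Proof.
split=> [h|[u /(tendsP (cnorm_group _)) hu] e e0].
  exact: dense_tends (cnorm_group _) h.
have [k hk] := hu e e0; exists (u k).
by rewrite (gnormB_sym (cnorm_group _)) hk.
Qed.

Lemma in_closure_range (R : realType) (A : Type) (D : cstarAlgType R) (i : A -> D) x :
  in_closure i (i x).
Proof. by move=> e e0; exists x; rewrite subrr cnorm0. Qed.

Lemma in_closure_closed (R : realType) (A : Type) (D : cstarAlgType R) (i : A -> D) d :
  (forall e : R, 0 < e -> exists2 d', in_closure i d' & cnorm (d - d') < e) -> in_closure i d.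
Proof.
move=> H e e0; have e2 : 0 < e / 2 by rewrite divr_gt0.
have [h hh gh] := H _ e2; have [p hp] := hh _ e2; exists p.
apply: le_lt_trans (gnormB_trans (cnorm_group _) h _ _) _.
by rewrite [e]splitr ltrD.
Qed.

Section ClosureStar.
Variables (R : realType) (A : starAlgType R[i]) (D : cstarAlgType R) (i : A -> D).
Hypothesis hi : star_hom i.

Lemma in_closureD d d' : in_closure i d -> in_closure i d' -> in_closure i (d + d').
Proof.
move=> /in_closureP[u hu] /in_closureP[v hv]; apply/in_closureP.
exists (fun n => u n + v n); rewrite (_ : (fun n => _) = fun n => i (u n) + i (v n)).
  exact: (@tendsD _ _ _ (cnorm_group _) _ _ _ _ hu hv).
by apply/funext => n; case: hi => ->.
Qed.

Lemma in_closureM d d' : in_closure i d -> in_closure i d' -> in_closure i (d * d').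
Proof.
move=> /in_closureP[u hu] /in_closureP[v hv]; apply/in_closureP.
exists (fun n => u n * v n); rewrite (_ : (fun n => _) = fun n => i (u n) * i (v n)).
  exact: (@ctendsM _ _ _ _ _ _ hu hv).
by apply/funext => n; case: hi => _ _ ->.
Qed.

Lemma in_closure_star d : in_closure i d -> in_closure i (star d).
Proof.
move=> /in_closureP[u hu]; apply/in_closureP; exists (fun n => star (u n)).
rewrite (_ : (fun n => _) = fun n => star (i (u n))); first exact: (@ctendsS _ _ _ _ hu).
by apply/funext => n; case: hi => _ _ _ _ ->.
Qed.

Lemma in_closure1 : in_closure i 1.
Proof. by case: hi => _ _ _ <- _; exact: in_closure_range. Qed.

Lemma in_closureX d n : in_closure i d -> in_closure i (d ^+ n).
Proof.
move=> hd; elim: n => [|n IH]; first by rewrite expr0; exact: in_closure1.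
by rewrite exprS; exact: in_closureM.
Qed.

Lemma in_closureB d d' : in_closure i d -> in_closure i d' -> in_closure i (d - d').
Proof.
move=> hd hd'; rewrite -mulN1r; apply: in_closureD => //; apply: in_closureM => //.
have [_ hZ _ h1 _] := hi.
have -> : -1 = i ((- 1 : R[i]) *: 1) by rewrite hZ h1 scaleN1r.
exact: in_closure_range.
Qed.

End ClosureStar.

(** Extension by uniform continuity; each algebraic law holds along approximating sequences and
    passes to the limit. *)
Lemma star_hom_extend (R : realType) (P : starAlgType R[i]) (D E : cstarAlgType R)
    (i : P -> D) (j : P -> E) :
  star_hom i -> star_hom j -> dense_range i ->
  (forall x, cnorm (j x) <= cnorm (i x)) ->
  exists f : D -> E, [/\ star_hom f, forall x, f (i x) = j x &
    forall d, cnorm (f d) <= cnorm d].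
Proof.
move=> hi hj di le_ji.
have gD := cnorm_group D; have gE := cnorm_group E.
have le1 x : cnorm (j x) <= 1 * cnorm (i x) by rewrite mul1r.
have /choice[f hf] := extend_tends gD gE (@cnorm_complete R E) (star_homB hi)
  (star_homB hj) ler01 le1 di.
have dt d := dense_tends gD (di d); exists f.
have fi x : f (i x) = j x.
  by apply: (tends_unique gE (hf _ (fun=> x) _)); apply: tends_cst.
case: hi => iD iZ iM i1 iS; case: hj => jD jZ jM j1 jS; split=> //; last first.
  move=> d; have [u hu] := dt d; have hv := hf _ _ hu.
  have cvgn (F : cstarAlgType R) (w : nat -> F) l : tends (@cnorm R F) w l ->
      (fun n => cnorm (w n)) @ \oo --> cnorm l.
    move=> /(tendsP (cnorm_group F)) hw; apply/cvgrPdist_lt => e e0.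
    have [k hk] := hw e e0; exists k => // n /= kn; apply: le_lt_trans (hk n kn).
    have gF := cnorm_group F.
    have := gnormD gF (w n - l) l; have := gnormD gF (l - w n) (w n).
    rewrite !subrK (gnormB_sym gF l) => h1 h2.
    by rewrite ler_norml; apply/andP; split; lra.
  by apply: ler_cvg_to (cvgn _ _ _ hv) (cvgn _ _ _ hu) _; apply: nearW => n.
split=> [x y|c x|x y||x].
- have [u hu] := dt x; have [v hv] := dt y.
  apply: (tends_unique gE (hf _ (fun n => u n + v n) _)).
    by under eq_fun do rewrite iD; exact: tendsD.
  by under eq_fun do rewrite jD; apply: tendsD => //; exact: hf.
- have [u hu] := dt x.
  apply: (tends_unique gE (hf _ (fun n => c *: u n) _)).
    by under eq_fun do rewrite iZ; exact: ctendsZ.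
  by under eq_fun do rewrite jZ; apply: ctendsZ; exact: hf.
- have [u hu] := dt x; have [v hv] := dt y.
  apply: (tends_unique gE (hf _ (fun n => u n * v n) _)).
    by under eq_fun do rewrite iM; exact: ctendsM.
  by under eq_fun do rewrite jM; apply: ctendsM; exact: hf.
- by rewrite -i1 fi.
- have [u hu] := dt x.
  apply: (tends_unique gE (hf _ (fun n => star (u n)) _)).
    by under eq_fun do rewrite iS; exact: ctendsS.
  by under eq_fun do rewrite jS; apply: ctendsS; exact: hf.
Qed.

Lemma contraction_dense_eq (R : realType) (P : Type) (D E : cstarAlgType R)
    (i : P -> D) (f g : D -> E) :
  {morph f : x y / x - y} -> {morph g : x y / x - y} ->
  (forall d, cnorm (f d) <= cnorm d) -> (forall d, cnorm (g d) <= cnorm d) ->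
  dense_range i -> (forall x, f (i x) = g (i x)) -> f =1 g.
Proof.
move=> fB gB f1 g1 di e d; have [u hu] := dense_tends (cnorm_group D) (di d).
have h (k : D -> E) : {morph k : x y / x - y} -> (forall d, cnorm (k d) <= cnorm d) ->
    tends (@cnorm R E) (fun n => k (i (u n))) (k d).
  move=> kB k1; apply: (tends_le (K := 1) (cnorm_group D) (cnorm_group E)) _ hu => n.
  by rewrite -kB mul1r.
apply: (tends_unique (cnorm_group E)) (h f fB f1) _.
by have := h g gB g1; under eq_fun do rewrite -e.
Qed.

(** The assignments i x |-> j x and j x |-> i x are isometric, so both extend; the composites agree
    with the identity on a dense set. *)
Lemma star_iso_dense (R : realType) (P : starAlgType R[i]) (D E : cstarAlgType R)
    (i : P -> D) (j : P -> E) :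
  star_hom i -> star_hom j -> dense_range i -> dense_range j ->
  (forall x, cnorm (j x) = cnorm (i x)) -> star_iso D E.
Proof.
move=> hi hj di dj e.
have le1 x : cnorm (j x) <= cnorm (i x) by rewrite e.
have le2 x : cnorm (i x) <= cnorm (j x) by rewrite e.
have [f [hf fi f1]] := star_hom_extend hi hj di le1.
have [g [hg gj g1]] := star_hom_extend hj hi dj le2.
have [fB gB] := (star_homB hf, star_homB hg).
exists f; split=> //; exists g.
- apply: (@contraction_dense_eq _ _ _ _ i (g \o f) id) => //= [x y|d|x].
  + by rewrite /= fB gB.
  + exact: le_trans (g1 _) (f1 _).
  + by rewrite fi gj.
- apply: (@contraction_dense_eq _ _ _ _ j (f \o g) id) => //= [x y|d|x].
  + by rewrite /= gB fB.
  + exact: le_trans (f1 _) (g1 _).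
  + by rewrite gj fi.
Qed.

(** * Extension of representations to the envelope *)

Lemma hnorm_group (R : realType) (H : hilbert R[i]) : group_norm (@hnorm R H).
Proof.
split; [exact: ler_hnormD|exact: hnorm_opp| |exact: hnorm0_eq0].
by rewrite /hnorm normr0.
Qed.

Lemma htends_complete (R : realType) (H : hilbert R[i]) (u : nat -> H) :
  (forall e : R, 0 < e -> exists k : nat, forall m n : nat,
    (k <= m)%N -> (k <= n)%N -> hnorm (u m - u n) < e) ->
  exists l, tends (@hnorm R H) u l.
Proof.
move=> /hilbert_complete[l hl]; exists l; apply/tendsP => //.
exact: hnorm_group.
Qed.

(** For fixed v the map x |-> pi x v is Lipschitz with constant |v| in the norm of iota x, hence
    extends to E by [extend_tends]; the laws of a representation follow by limits. *)
Lemma rep_extend (R : realType) (A : starAlgType R[i]) (E : cstarAlgType R)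
    (iota : A -> E) (H : hilbert R[i]) (pi : A -> {linear H -> H}) :
  enveloping iota -> star_rep pi ->
  exists pi' : E -> {linear H -> H}, star_rep pi' /\
    forall x v, pi' (iota x) v = pi x v.
Proof.
move=> [hi ni di] rpi.
have gE := cnorm_group E; have gH := hnorm_group H.
have le_pi x v : hnorm (pi x v) <= cnorm (iota x) * hnorm v.
  by apply: (rep_normP x (cnorm_ge0 _)).1 => //; rewrite ni.
have hvy v y : exists l, forall u : nat -> A,
    tends (@cnorm R E) (fun n => iota (u n)) y ->
    tends (@hnorm R H) (fun n => pi (u n) v) l.
  apply: (@extend_tends R A E H (@cnorm R E) (@hnorm R H) iota (fun x => pi x v)
    (hnorm v) gE gH (@htends_complete R H) (star_homB hi) _ (hnorm_ge0 v) _ di) => [x z|x].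
    exact: repB.
  by rewrite mulrC.
have hv v := choice (hvy v).
pose F v := projT1 (hv v); pose hF v := projT2 (hv v); have dt y := dense_tends gE (di y).
have Fi x v : F v (iota x) = pi x v.
  by apply: (tends_unique gH (hF _ _ (fun=> x) _)); exact: tends_cst.
have htZ c u l : tends (@hnorm R H) u l -> tends (@hnorm R H) (fun n => c *: u n) (c *: l).
  apply: (tends_le (K := cmod c) gH gH) => n.
  by rewrite -scalerBr hnormZ.
have lin y : linear (F^~ y).
  move=> c v w; have [u hu] := dt y; apply: (tends_unique gH (hF _ _ _ hu)).
  under eq_fun do rewrite linearD linearZ.
  by apply: (tendsD gH); [apply: htZ|]; exact: hF.
pose pi' y : {linear H -> H} := HB.pack (F^~ y) (GRing.isLinear.Build _ _ _ _ (F^~ y) (lin y)).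
have bnd y v : hnorm (F v y) <= cnorm y * hnorm v.
  have cvgn (M : zmodType) (nm : M -> R) (w : nat -> M) l : group_norm nm ->
      tends nm w l -> (fun n => nm (w n)) @ \oo --> nm l.
    move=> g /(tendsP g) hw; apply/cvgrPdist_lt => e e0.
    have [k hk] := hw e e0; exists k => // n /= kn; apply: le_lt_trans (hk n kn).
    have := gnormD g (w n - l) l; have := gnormD g (l - w n) (w n).
    rewrite !subrK (gnormB_sym g l) => h1 h2.
    by rewrite ler_norml; apply/andP; split; lra.
  have [u hu] := dt y.
  apply: ler_cvg_to (cvgn _ _ _ _ gH (hF v _ _ hu))
    (cvgM (cvgn _ _ _ _ gE hu) (cvg_cst (hnorm v))) _.
  by apply: nearW => n; exact: le_pi.
exists pi'; split; last exact: Fi.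
case: (hi) => iD iZ iM i1 iS; split.
- move=> y; apply/linear_bounded_continuous/linear_boundedP.
  near=> r => v; rewrite !hnormE.
  have -> : r = (complex.Re r)%:C.
    by rewrite RRe_real //; near: r; exact: nbhs_pinfty_real.
  rewrite -rmorphM lecR; apply: le_trans (bnd y v) _.
  rewrite ler_wpM2r ?hnorm_ge0 // -lecR RRe_real; last first.
    by near: r; exact: nbhs_pinfty_real.
  by near: r; apply: nbhs_pinfty_ge; rewrite realE ler0c cnorm_ge0.
- move=> x y v; have [u hu] := dt x; have [w hw] := dt y.
  apply: (tends_unique gH (hF _ _ (fun n => u n + w n) _)).
    by under eq_fun do rewrite iD; exact: tendsD.
  by under eq_fun do rewrite (repD rpi); apply: tendsD => //; exact: hF.
- move=> c x v; have [u hu] := dt x.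
  apply: (tends_unique gH (hF _ _ (fun n => c *: u n) _)).
    by under eq_fun do rewrite iZ; exact: ctendsZ.
  by under eq_fun do rewrite (repZ rpi); apply: htZ; exact: hF.
- move=> x y v; have [u hu] := dt x; have [w hw] := dt y.
  apply: (tends_unique gH (hF _ _ (fun n => u n * w n) _)).
    by under eq_fun do rewrite iM; exact: ctendsM.
  have h1 : tends (@hnorm R H) (fun n => pi (u n) (F v y)) (F (F v y) x) by exact: hF.
  (* The operators vary together with their arguments; this error tends to 0 because the norms of
     the [iota (u n)] are bounded. *)
  have h2 : tends (@hnorm R H) (fun n => pi (u n) (pi (w n) v - F v y)) 0.
    have [M hM] : exists M : R, forall n, cnorm (iota (u n)) <= M.
      have /(tendsP gE) hu' := hu; have [k hk] := hu' 1 ltr01.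
      have [M hM] : exists M : R, forall n, (n < k)%N -> cnorm (iota (u n)) <= M.
        elim: k {hk} => [|k [M hM]]; first by exists 0.
        exists (Num.max M (cnorm (iota (u k)))) => n; rewrite ltnS leq_eqVlt le_max.
        by case/orP => [/eqP ->|/hM ->] //; rewrite lexx orbT.
      exists (Num.max M (1 + cnorm x)) => n; rewrite le_max.
      have [kn|/hM ->//] := leqP k n; apply/orP; right.
      rewrite -(subrK x (iota (u n))); apply: le_trans (cnormD _ _) _.
      by rewrite lerD2r ltW // hk.
    apply: (tends_le (K := M) gH gH) (hF v _ _ hw) => n.
    rewrite subr0; apply: le_trans (le_pi _ _) _.
    by rewrite ler_wpM2r ?hnorm_ge0.
  have := tendsD gH h1 h2; rewrite addr0.
  by under eq_fun do rewrite linearB addrC subrK -(repM rpi).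
- by move=> v; rewrite /= -i1 Fi (rep1 rpi).
- move=> x v w; have [u hu] := dt x.
  have hs : tends (@cnorm R E) (fun n => iota (star (u n))) (star x).
    by under eq_fun do rewrite iS; exact: ctendsS.
  have h1 := hF v _ _ hu; have h2 := hF w _ _ hs.
  apply/eqP; rewrite -subr_eq0; apply/eqP/cmod_eq0/eqP.
  rewrite eq_le cmod_ge0 andbT; apply/ler_addgt0Pr => e e0; rewrite add0r.
  have K0 : 0 < hnorm v + hnorm w + 1.
    by rewrite ltr_wpDl // addr_ge0 ?hnorm_ge0.
  have e' := divr_gt0 e0 K0.
  have [k hk] := (tendsP gH _ _).1 h1 _ e'; have [l hl] := (tendsP gH _ _).1 h2 _ e'.
  pose n := maxn k l; have := hk n (leq_maxl _ _); have := hl n (leq_maxr _ _).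
  rewrite /= => a1 a2.
  (* Adjointness is exact for the approximants, so only two approximation errors remain, and both
     are controlled by Cauchy-Schwarz. *)
  have -> : dot H (F v x) w - dot H v (F w (star x)) =
     dot H v (pi (star (u n)) w - F w (star x)) - dot H (pi (u n) v - F v x) w.
    by rewrite dotBl dotBr (rep_star rpi) opprB [RHS]addrC addrA subrK.
  apply: le_trans (cmodD _ _) _; rewrite cmodN.
  apply: le_trans (lerD (cmod_dot_le _ _) (cmod_dot_le _ _)) _.
  apply: le_trans (lerD (ler_wpM2l (hnorm_ge0 _) (ltW a1))
    (ler_wpM2r (hnorm_ge0 _) (ltW a2))) _.
  rewrite mulrC -mulrDr -[leRHS](divfK (lt0r_neq0 K0) e) ler_wpM2l ?ltW //.
  by rewrite ltrDl.
Unshelve. all: by end_near. Qed.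

(** * Positive operators *)

Section Positivity.
Variables (R : realType) (A : starAlgType R[i]) (H : hilbert R[i]).
Variables (pi : A -> {linear H -> H}) (rpi : star_rep pi).
Implicit Types (x y z : A) (v : H) (c : R).

(** Taking the real part makes positivity an inequality in R for every element, self-adjoint or
    not. *)
Definition quad x v : R := complex.Re (dot H (pi x v) v).

Definition pos_elt x := forall v, 0 <= quad x v.

Lemma quadD x y v : quad (x + y) v = quad x v + quad y v.
Proof. by rewrite /quad (repD rpi) dotDl raddfD. Qed.

Lemma quadZ c x v : quad (c%:C *: x) v = c * quad x v.
Proof.
rewrite /quad (repZ rpi) dotZl; case: (dot H (pi x v) v) => u w /=.
by rewrite mul0r subr0.
Qed.

Lemma quadN x v : quad (- x) v = - quad x v.
Proof. by rewrite -scaleN1r (_ : -1 = (-1 : R)%:C) ?quadZ ?mulN1r // rmorphN. Qed.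

Lemma quad1 v : quad 1 v = hnorm v ^+ 2.
Proof. by rewrite /quad (rep1 rpi) dot_sqr. Qed.

Lemma quad_conj x y v : quad (star y * x * y) v = quad x (pi y v).
Proof. by rewrite /quad !(repM rpi) (rep_star rpi) starK. Qed.

Lemma quad_sqr x v : quad (star x * x) v = hnorm (pi x v) ^+ 2.
Proof. by rewrite /quad -rep_sqr. Qed.

Lemma quad_le x M v : (forall v, hnorm (pi x v) <= M * hnorm v) ->
  `|quad x v| <= M * hnorm v ^+ 2.
Proof.
move=> hM; apply: le_trans (Re_le_cmod _) _; apply: le_trans (cmod_dot_le _ _) _.
by rewrite expr2 mulrA ler_wpM2r ?hnorm_ge0.
Qed.

Lemma pos_eltD x y : pos_elt x -> pos_elt y -> pos_elt (x + y).
Proof. by move=> hx hy v; rewrite quadD addr_ge0. Qed.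

Lemma pos_eltZ c x : 0 <= c -> pos_elt x -> pos_elt (c%:C *: x).
Proof. by move=> c0 hx v; rewrite quadZ mulr_ge0. Qed.

Lemma pos_elt_conj x y : pos_elt x -> pos_elt (star y * x * y).
Proof. by move=> hx v; rewrite quad_conj. Qed.

Lemma pos_elt_sqr x : pos_elt (star x * x).
Proof. by move=> v; rewrite quad_sqr sqr_ge0. Qed.

Lemma pos_elt_bound x : exists K : R, [/\ 0 <= K, pos_elt (K%:C%:A - x) &
  pos_elt (K%:C%:A + x)].
Proof.
have [M [M0 hM]] := rep_bounded_by x rpi; exists M; split=> // v;
  rewrite quadD quadZ quad1 ?quadN; have := quad_le v hM; rewrite ler_norml; lra.
Qed.

Lemma pos_elt_lim x : (forall e : R, 0 < e -> pos_elt (x + e%:C%:A)) -> pos_elt x.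
Proof.
move=> hx v; apply/ler_addgt0Pr => e e0.
have d0 : 0 < hnorm v ^+ 2 + 1 by rewrite ltr_wpDl // sqr_ge0.
have := hx _ (divr_gt0 e0 d0) v; rewrite quadD quadZ quad1.
move/le_trans; apply; rewrite lerD2l -[leRHS](divfK (lt0r_neq0 d0) e).
by rewrite ler_wpM2l ?divr_ge0 ?ltW // ltrDl.
Qed.

(* F. Riesz: with [a_0 = x], [a_(k+1) = a_k - a_k^2] one has                  *)
(* [x = a_n + sum_(k < n) a_k^2], so [x y] is a sum of the positive elements  *)
(* [a_k y a_k] up to [a_n y], and the [a_k] tend strongly to 0.               *)
Lemma pos_eltM x y : star x = x -> x * y = y * x ->
  pos_elt x -> pos_elt y -> pos_elt (x * y).
Proof.
move=> sx xy px py.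
have [K [K0 pK _]] := pos_elt_bound x.
(* Dividing x by K + 1 brings it between 0 and 1, where the iteration below stays. *)
wlog p1 : x sx xy px {K K0 pK} / pos_elt (1 - x) => [wl|].
  have K10 : 0 < K + 1 by rewrite ltr_wpDl.
  have := wl ((K + 1)^-1%:C *: x).
  rewrite starZ conj_rc sx -scalerAl -scalerAr xy => /(_ erefl erefl) h.
  have {}h : pos_elt ((K + 1)^-1%:C *: (y * x)).
    apply: h; first by apply: pos_eltZ => //; rewrite invr_ge0 ltW.
    have -> : 1 - (K + 1)^-1%:C *: x =
        (K + 1)^-1%:C *: ((K%:C%:A - x) + 1) :> A.
      have e1 : K%:C%:A + 1 = (K + 1)%:C%:A :> A by rewrite rmorphD scalerDl scale1r.
      by rewrite addrAC e1 scalerBr scalerA -rmorphM mulVf ?gt_eqF // rmorph1 scale1r.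
    apply: pos_eltZ; first by rewrite invr_ge0 ltW.
    by apply: pos_eltD => // v; rewrite quad1 sqr_ge0.
  have -> : y * x = (K + 1)%:C *: ((K + 1)^-1%:C *: (y * x)).
    by rewrite scalerA -rmorphM mulfV ?gt_eqF // rmorph1 scale1r.
  by apply: pos_eltZ => //; exact: ltW.
pose a n := iter n (fun z => z - z * z) x.
have sa n : star (a n) = a n.
  by elim: n => //= n IH; rewrite starD starN starM !IH.
have ay n : a n * y = y * a n.
  by elim: n => //= n IH; rewrite mulrBl mulrBr -mulrA IH mulrA IH mulrA.
have pa n : pos_elt (a n) /\ pos_elt (1 - a n).
  elim: n => [//|n [IH1 IH2]] /=; set z := a n in IH1 IH2 *.
  have sz : star z = z by exact: sa.
  split.
    (* The identity z - z^2 = z (1 - z) z + (1 - z) z (1 - z) keeps the iterates positive. *)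
    have -> : z - z * z = star z * (1 - z) * z + star (1 - z) * z * (1 - z).
      rewrite starD starN star1 sz mulrBr mulr1 !mulrBl !mulrBr !mul1r !mulr1.
      by rewrite [RHS]addrC subrK.
    by apply: pos_eltD; exact: pos_elt_conj.
  rewrite opprB addrA addrAC; apply: pos_eltD => //.
  by rewrite -{1}sz; exact: pos_elt_sqr.
have xE n : x = a n + \sum_(k < n) a k * a k.
  elim: n => [|n IH]; first by rewrite big_ord0 addr0.
  by rewrite big_ord_recr /= [X in _ + X]addrC addrA subrK.
move=> v; have [M [M0 hM]] := rep_bounded_by y rpi.
have quad_sum n (F : nat -> A) w :
    quad (\sum_(k < n) F k) w = \sum_(k < n) quad (F k) w.
  elim: n => [|n IH]; last by rewrite !big_ord_recr /= quadD IH.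
  by rewrite !big_ord0 /quad rep0 // linear0l.
have bound n : \sum_(k < n) hnorm (pi (a k) v) ^+ 2 <= quad x v.
  rewrite [in quad x v](xE n) quadD (quad_sum n (fun k => a k * a k)) ler_wpDl ?((pa n).1 v) //.
  by apply: ler_sum => k _; rewrite -quad_sqr sa.
apply/ler_addgt0Pr => e e0.
(* The partial sums of |a_k v|^2 are bounded by <x v, v>, so the |a_k v| cannot stay away from 0. *)
have [k hk] : exists k, hnorm (pi (a k) v) * (M * hnorm v) < e.
  apply: contrapT => /forallNP hn.
  have c0 : 0 < M * hnorm v + 1 by rewrite ltr_wpDl // mulr_ge0 ?hnorm_ge0.
  have {}hn k : (e / (M * hnorm v + 1)) ^+ 2 <= hnorm (pi (a k) v) ^+ 2.
    have q0 := ltW (divr_gt0 e0 c0).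
    rewrite ler_sqr ?nnegrE ?hnorm_ge0 ?q0 // ler_pdivrMr //.
    have /negP := hn k; rewrite -leNgt => /le_trans; apply.
    by rewrite ler_wpM2l ?hnorm_ge0 // lerDl.
  have d0 : 0 < (e / (M * hnorm v + 1)) ^+ 2 by rewrite exprn_gt0 ?divr_gt0.
  have := archi_boundP (divr_ge0 (px v) (ltW d0)); set n := Num.bound _.
  rewrite ltr_pdivrMr // => /lt_le_trans /(_ (_ : _ <= quad x v)).
  rewrite ltxx => h; apply/notF/h; apply: le_trans (bound n).
  by rewrite -[n in n%:R]card_ord mulr_natl -sumr_const ler_sum.
rewrite (xE k) mulrDl quadD mulr_suml (quad_sum k (fun j => a j * a j * y)) addrAC.
apply: addr_ge0; last first.
  apply: sumr_ge0 => j _; rewrite -mulrA ay mulrA -{1}(sa j).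
  exact: pos_elt_conj.
rewrite -lerBlDr sub0r.
have : `|quad (a k * y) v| <= e.
  rewrite /quad ay (repM rpi); apply: le_trans (Re_le_cmod _) _.
  apply: le_trans (cmod_dot_le _ _) _.
  apply: le_trans (_ : M * hnorm (pi (a k) v) * hnorm v <= _).
    by rewrite ler_wpM2r ?hnorm_ge0.
  by rewrite mulrAC mulrC ltW.
by rewrite ler_norml => /andP[].
Qed.

End Positivity.

(** * Spectral bound for polynomials in [a] *)

Section Sphere.
Variables (R : realType) (q r : {posnum R}).
Hypothesis q_lt1 : q%:num < 1.
Local Notation A := (S2qr q r).
Local Notation a := (s2a q r).
Local Notation b := (s2b q r).
Local Notation Q := (q%:num ^+ 2).
Local Notation cpoly := (map_poly (real_complex R)).

Local Notation s2poly := (horner_alg a).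

Lemma s2polyC c : s2poly c%:P = c%:A.
Proof. exact: horner_algC. Qed.

Lemma s2polyX : s2poly 'X = a.
Proof. exact: horner_algX. Qed.

Lemma s2polyZ c p : s2poly (c *: p) = c *: s2poly p.
Proof. by rewrite -mul_polyC rmorphM /= s2polyC mulr_algl. Qed.

Lemma s2poly_comm p p' : s2poly p * s2poly p' = s2poly p' * s2poly p.
Proof. by rewrite -!rmorphM mulrC. Qed.

Lemma s2a_comm p : a * s2poly p = s2poly p * a.
Proof. by have := s2poly_comm 'X p; rewrite s2polyX. Qed.

Definition conj_poly (p : {poly R[i]}) : {poly R[i]} := map_poly (@Num.conj R[i]) p.

Lemma star_s2poly p : star (s2poly p) = s2poly (conj_poly p).
Proof.
rewrite /conj_poly; elim/poly_ind: p => [|p c IH]; first by rewrite !rmorph0 star0.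
rewrite !rmorphD !rmorphM /= starD starM IH s2polyX star_s2a map_polyX map_polyC.
by rewrite !s2polyC starZ star1 s2polyX s2a_comm.
Qed.

Lemma conj_poly_real (p : {poly R}) : conj_poly (cpoly p) = (cpoly p).
Proof.
rewrite /conj_poly -map_poly_comp; apply: eq_map_poly => x; exact: conj_rc.
Qed.

Lemma star_s2poly_real (p : {poly R}) : star (s2poly (cpoly p)) = s2poly (cpoly p).
Proof. by rewrite star_s2poly conj_poly_real. Qed.

Lemma s2ab : b * a = Q%:C *: (a * b).
Proof.
have [-> _ _ _] := S2_relations q r.
by rewrite scalerA -rmorphM mulfV ?rmorph1 ?scale1r // expf_neq0 // gt_eqF.
Qed.

Definition dilate (c : R) (p : {poly R[i]}) := p \Po (c%:C *: 'X).

Lemma b_s2poly p : b * s2poly p = s2poly (dilate Q p) * b.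
Proof.
have := s2ab; rewrite /dilate; move: Q%:C => s sab.
elim/poly_ind: p => [|p c IH]; first by rewrite !(rmorph0, linear0, mulr0, mul0r).
rewrite comp_poly_MXaddC !rmorphD !rmorphM /= mulrDr mulrDl !s2polyC s2polyX s2polyZ s2polyX.
rewrite mulr_algl mulr_algr [b * (_ * _)]mulrA IH -[_ * b * a]mulrA sab.
by rewrite -!scalerAr -!scalerAl mulrA.
Qed.

Lemma s2poly_bs p : s2poly p * star b = star b * s2poly (dilate Q p).
Proof.
have h p' : s2poly (conj_poly p') * star b = star b * s2poly (conj_poly (dilate Q p')).
  by rewrite -!star_s2poly -!starM b_s2poly.
have e p' : conj_poly (dilate Q p') = dilate Q (conj_poly p').
  by rewrite /conj_poly /dilate map_comp_poly map_polyZ map_polyX /= conj_rc.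
have := h (conj_poly p); rewrite e.
by rewrite /conj_poly -map_poly_comp map_poly_id // => x _ /=; exact: conjCK.
Qed.

Definition fpoly : {poly R} := 'X - 'X^2 + r%:num%:P.

Lemma bs_b : star b * b = s2poly (cpoly fpoly).
Proof.
have [_ _ -> _] := S2_relations q r.
by rewrite /fpoly rmorphD rmorphB /= map_polyXn map_polyX map_polyC !rmorphD
  rmorphN rmorphXn /= s2polyX s2polyC.
Qed.

Lemma b_bs : b * star b = s2poly (dilate Q (cpoly fpoly)).
Proof.
have [_ _ _ ->] := S2_relations q r.
rewrite /fpoly /dilate rmorphD rmorphB /= map_polyXn map_polyX map_polyC.
rewrite !rmorphD rmorphN /= comp_polyX comp_Xn_poly comp_polyC.
have e : (q%:num ^+ 4)%:C = Q%:C ^+ 2 :> R[i] by rewrite -rmorphXn -exprM.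
have eX : s2poly (Q%:C *: 'X) = Q%:C *: a by rewrite s2polyZ s2polyX.
by rewrite rmorphN /= s2polyC [horner_alg a (_ ^+ 2)]rmorphXn /= eX e exprZn.
Qed.

Definition tplus : R := (1 + Num.sqrt (1 + 4 * r%:num)) / 2.
Definition tminus : R := (1 - Num.sqrt (1 + 4 * r%:num)) / 2.
Local Notation tp := tplus.
Local Notation tm := tminus.

Let sqrt_gt1 : 1 < Num.sqrt (1 + 4 * r%:num).
Proof.
rewrite -{1}sqrtr1 ltr_sqrt; first by rewrite ltrDl mulr_gt0.
by rewrite addr_gt0 // mulr_gt0.
Qed.

Lemma tplus_gt1 : 1 < tp.
Proof. by have := sqrt_gt1; rewrite /tp; lra. Qed.

Lemma tplus_gt0 : 0 < tp.
Proof. exact: lt_trans ltr01 tplus_gt1. Qed.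

Lemma tminus_lt0 : tm < 0.
Proof. by have := sqrt_gt1; rewrite /tm; lra. Qed.

Lemma tplus_tminus : tp + tm = 1.
Proof. by rewrite /tp /tm; field. Qed.

Lemma tplusMtminus : tp * tm = - r%:num.
Proof.
have := sqr_sqrtr (ltW (lt_trans ltr01 (_ : 1 < 1 + 4 * r%:num))).
rewrite ltrDl mulr_gt0 // => /(_ isT) h; rewrite /tp /tm.
move: h; set s := Num.sqrt _ => h.
have -> : r%:num = (s ^+ 2 - 1) / 4 by rewrite h; field.
by field.
Qed.

Lemma fpolyE : fpoly = (tp%:P - 'X) * ('X - tm%:P).
Proof.
have -> : (tp%:P - 'X) * ('X - tm%:P) = (tp + tm)%:P * 'X - 'X ^+ 2 + (- (tp * tm))%:P.
  by move: tp tm => x y; rewrite polyCN polyCD polyCM; ring.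
by rewrite tplus_tminus tplusMtminus opprK polyC1 mul1r.
Qed.

(** * Positivity of polynomials in [a] within one representation *)

Section Spectrum.
Variables (H : hilbert R[i]) (pi : A -> {linear H -> H}) (rpi : star_rep pi).

Definition pos_poly (p : {poly R}) := pos_elt pi (s2poly (cpoly p)).

Lemma pos_polyD p p' : pos_poly p -> pos_poly p' -> pos_poly (p + p').
Proof. by rewrite /pos_poly !rmorphD; exact: pos_eltD. Qed.

Lemma pos_polyZ c p : 0 <= c -> pos_poly p -> pos_poly (c *: p).
Proof. by rewrite /pos_poly map_polyZ s2polyZ; exact: pos_eltZ. Qed.

Lemma pos_polyM p p' : pos_poly p -> pos_poly p' -> pos_poly (p * p').
Proof.
rewrite /pos_poly !rmorphM; apply: pos_eltM => //; first exact: star_s2poly_real.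
exact: s2poly_comm.
Qed.

Lemma pos_poly_sqr p : pos_poly (p ^+ 2).
Proof.
rewrite /pos_poly expr2 !rmorphM /= -{1}star_s2poly_real; exact: pos_elt_sqr.
Qed.

Lemma pos_polyC c : 0 <= c -> pos_poly c%:P.
Proof.
move=> c0; rewrite -[c%:P]mulr1 mul_polyC; apply: pos_polyZ => //.
by rewrite -(expr1n _ 2); exact: pos_poly_sqr.
Qed.

Lemma pos_poly_sum n (F : nat -> {poly R}) :
  (forall i, pos_poly (F i)) -> pos_poly (\sum_(i < n) F i).
Proof.
move=> h; elim: n => [|n IH]; first by rewrite big_ord0; exact: (pos_polyC (lexx 0)).
by rewrite big_ord_recr; exact: pos_polyD.
Qed.

Lemma pos_polyX p n : pos_poly p -> pos_poly (p ^+ n).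
Proof.
move=> h; elim: n => [|n IH]; first exact: (pos_polyC ler01).
by rewrite exprS; exact: pos_polyM.
Qed.

Lemma pos_poly_lim p (K : R) : (forall n : nat, pos_poly (p + (K / n.+1%:R)%:P)) ->
  pos_poly p.
Proof.
move=> h; apply: pos_elt_lim => // e e0.
have K0 : 0 < `|K| + 1 by rewrite ltr_wpDl.
have [n _ hn] := near_infty_natSinv_lt (PosNum (divr_gt0 e0 K0)).
have {hn} := hn n (leqnn n); rewrite ltr_pdivlMr //= => hn.
have -> : s2poly (cpoly p) + e%:C%:A =
   s2poly (cpoly ((p + (K / n.+1%:R)%:P) + (e - K / n.+1%:R)%:P)).
  rewrite -addrA -polyCD [_ / _ + _]addrC subrK.
  by rewrite !rmorphD /= map_polyC /= s2polyC.
apply: pos_polyD => //; apply: pos_polyC; rewrite subr_ge0 mulrC.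
apply: le_trans (ltW hn); rewrite ler_wpM2l ?invr_ge0 //.
by rewrite ler_wpDr // ler_norm.
Qed.

Lemma pos_poly_bound p : exists2 K : R, 0 <= K & pos_poly (K%:P - p) /\ pos_poly (K%:P + p).
Proof.
have [K [K0 h1 h2]] := pos_elt_bound rpi (s2poly (cpoly p)); exists K => //.
by rewrite /pos_poly !rmorphB !rmorphD /= map_polyC /= s2polyC.
Qed.

Lemma pos_fpoly : pos_poly fpoly.
Proof. by rewrite /pos_poly -bs_b; exact: pos_elt_sqr. Qed.

(** f + (X - t_-)^2 = (t_+ - t_-) (X - t_-), a positive polynomial plus a square. *)
Lemma pos_XBtm : pos_poly ('X - tm%:P).
Proof.
have d0 : 0 < tp - tm by have := tplus_gt0; have := tminus_lt0; lra.
have -> : 'X - tm%:P = (tp - tm)^-1 *: (fpoly + ('X - tm%:P) ^+ 2).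
  rewrite fpolyE expr2 -mulrDl addrA subrK -polyCB mul_polyC scalerA mulVf ?gt_eqF //.
  by rewrite scale1r.
apply: pos_polyZ; first by rewrite invr_ge0 ltW.
by apply: pos_polyD; [exact: pos_fpoly|exact: pos_poly_sqr].
Qed.

Lemma pos_tpBX : pos_poly (tp%:P - 'X).
Proof.
have d0 : 0 < tp - tm by have := tplus_gt0; have := tminus_lt0; lra.
have -> : tp%:P - 'X = (tp - tm)^-1 *: (fpoly + (tp%:P - 'X) ^+ 2).
  have e : ('X - tm%:P) + (tp%:P - 'X) = (tp - tm)%:P.
    by rewrite polyCB addrC addrA subrK.
  rewrite fpolyE expr2 -mulrDr e mulrC mul_polyC scalerA mulVf ?gt_eqF //.
  by rewrite scale1r.
apply: pos_polyZ; first by rewrite invr_ge0 ltW.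
by apply: pos_polyD; [exact: pos_fpoly|exact: pos_poly_sqr].
Qed.

Lemma cpoly_scale (c : R) p : cpoly (p \Po (c *: 'X)) = dilate c (cpoly p).
Proof. by rewrite /dilate map_comp_poly map_polyZ map_polyX. Qed.

(** Since h(Qa) b = b h(a), conjugating h(Qa) by b yields f(a) h(a). *)
Lemma pos_fpolyM h : pos_poly (h \Po (Q *: 'X)) -> pos_poly (fpoly * h).
Proof.
rewrite /pos_poly cpoly_scale rmorphM rmorphM /= -bs_b -mulrA b_s2poly mulrA.
by move=> hh; exact: pos_elt_conj.
Qed.

(** The remainder modulo f is the Lagrange interpolant at the two roots, written in the two linear
    forms that are positive in [a]. *)
Lemma poly_interp (h : {poly R}) : exists k, h = k * fpoly +
  ((h.[tp] / (tp - tm)) *: ('X - tm%:P) + (h.[tm] / (tp - tm)) *: (tp%:P - 'X)).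
Proof.
have d0 : tp - tm != 0 by have := tplus_gt0; have := tminus_lt0; lra.
set l := _ *: _ + _ *: _.
have : \prod_(z <- [:: tp; tm]) ('X - z%:P) %| h - l.
  apply: uniq_roots_dvdp.
    rewrite /= /root /l !hornerE /= !(subrr tp, subrr tm) !mulr0 add0r addr0.
    by rewrite !divfK // !subrr eqxx.
  by rewrite uniq_rootsE /= inE -subr_eq0 d0.
rewrite !big_cons big_nil mulr1 => /dvdpP[k hk]; exists (- k).
by apply/eqP; rewrite -subr_eq hk fpolyE; apply/eqP; ring.
Qed.

(* With [V = 1 - f / C], split [h = h V^n + h f / C * sum_(j < n) V^j]. The   *)
(* second summand is positive; modulo the interpolating linear polynomial,    *)
(* which is positive, the first one is a multiple of [f V^n <= C / (n + 1)].  *)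
Lemma pos_poly_step h : pos_poly (h \Po (Q *: 'X)) ->
  0 <= h.[tp] -> 0 <= h.[tm] -> pos_poly h.
Proof.
move=> /pos_fpolyM pfh hp hm.
have d0 : 0 < tp - tm by have := tplus_gt0; have := tminus_lt0; lra.
have [k hk] := poly_interp h; set l := (_ *: _ + _ *: _) in hk.
have pl : pos_poly l.
  apply: pos_polyD; apply: pos_polyZ; rewrite ?divr_ge0 ?(ltW d0) //.
    exact: pos_XBtm.
  exact: pos_tpBX.
have [K K0 [Kk1 Kk2]] := pos_poly_bound k.
(* C is the maximum of f, attained at 1/2, so that V is a positive multiple of a square. *)
pose C := 4^-1 + r%:num; have C0 : 0 < C by rewrite addr_gt0 ?invr_gt0.
pose U : {poly R} := C^-1 *: fpoly; pose V : {poly R} := 1 - U.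
have VE : V = C^-1 *: ('X - (2^-1)%:P) ^+ 2.
  have CE : C%:P - fpoly = ('X - (2^-1)%:P) ^+ 2.
    rewrite /C /fpoly polyCD sqrrB.
    have -> : 'X * (2^-1)%:P *+ 2 = 'X :> {poly R}.
      rewrite -mulrnAr -polyCMn (_ : 2^-1 *+ 2 = 1) ?mulr1 //.
      by rewrite -[LHS]mulr_natr mulVf ?pnatr_eq0.
    have -> : (2^-1)%:P ^+ 2 = (4^-1)%:P :> {poly R}.
      by rewrite -polyC_exp; congr (_%:P); field.
    by move: (4^-1)%:P (r%:num)%:P 'X => x y z; ring.
  by rewrite -CE scalerBr -mul_polyC -polyCM mulVf ?gt_eqF.
have pV : pos_poly V.
  by rewrite VE; apply: pos_polyZ; [rewrite invr_ge0 ltW|exact: pos_poly_sqr].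
have pU : pos_poly U by apply: pos_polyZ; [rewrite invr_ge0 ltW|exact: pos_fpoly].
have geo n : 1 - V ^+ n = U * \sum_(i < n) V ^+ i.
  have UE : V - 1 = - U by rewrite /V addrAC subrr sub0r.
  by have := subrX1 V n; rewrite UE mulNr -[V ^+ n - 1]opprB => /oppr_inj.
(* An algebraic form of u (1 - u)^n <= 1/(n+1): multiplied by n + 1, the difference is the sum of
   V^(n+1) and the products U V^i (1 - V^(n-i)) for i <= n. *)
have pUV n : pos_poly (n.+1%:R^-1%:P - U * V ^+ n).
  have -> : n.+1%:R^-1%:P - U * V ^+ n = n.+1%:R^-1 *:
      (V ^+ n.+1 + U * \sum_(i < n.+1) (V ^+ i * (U * \sum_(j < n - i) V ^+ j))).
    have -> : \sum_(i < n.+1) V ^+ i * (U * \sum_(j < n - i) V ^+ j) =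
        \sum_(i < n.+1) V ^+ i - n.+1%:R * V ^+ n.
      have -> : n.+1%:R * V ^+ n = \sum_(i < n.+1) V ^+ n.
        by rewrite sumr_const card_ord mulr_natl.
      rewrite -sumrB.
      apply: eq_bigr => i _; rewrite -geo mulrBr mulr1 -exprD subnKC //.
      by rewrite -ltnS.
    rewrite mulrBr -geo addrCA addrA subrK scalerBr mulrCA.
    rewrite mulr_natl -[U * _ *+ _]scaler_nat scalerA mulVf ?pnatr_eq0 // scale1r.
    by rewrite alg_polyC.
  apply: pos_polyZ; rewrite ?invr_ge0 //; apply: pos_polyD; first exact: pos_polyX.
  apply: pos_polyM => //.
  apply: (@pos_poly_sum _ (fun i => V ^+ i * (U * \sum_(j < n - i) V ^+ j))) => i.
  apply: pos_polyM; first exact: pos_polyX.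
  by apply: pos_polyM => //; apply: pos_poly_sum => j; exact: pos_polyX.
apply: (@pos_poly_lim _ (K * C)) => n.
(* In h V^n the factor h is replaced by k f + l. Adding K f V^n turns the coefficient k into the
   positive K + k, and costs K C U V^n <= K C / (n+1). *)
have -> : h + (K * C / n.+1%:R)%:P = C^-1 *: (fpoly * h * \sum_(i < n) V ^+ i)
    + (l * V ^+ n + (K * C)%:P * (n.+1%:R^-1%:P - U * V ^+ n)
    + (K%:P + k) * fpoly * V ^+ n).
  have e1 : h = h * V ^+ n + h * (1 - V ^+ n) by rewrite -mulrDr addrC subrK mulr1.
  have fE : fpoly = C%:P * U by rewrite mul_polyC scalerA mulfV ?gt_eqF // scale1r.
  have -> : C^-1 *: (fpoly * h * \sum_(i < n) V ^+ i) = h * (1 - V ^+ n).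
    rewrite geo fE -!mulrA mul_polyC scalerA mulVf ?gt_eqF // scale1r.
    by rewrite mulrCA.
  rewrite {1}e1 {1}hk fE !polyCM; ring.
apply: pos_polyD.
  apply: pos_polyZ; first by rewrite invr_ge0 ltW.
  by apply: pos_polyM => //; apply: pos_poly_sum => i; exact: pos_polyX.
apply: pos_polyD; last first.
  by apply: pos_polyM; [apply: pos_polyM => //; exact: pos_fpoly|exact: pos_polyX].
apply: pos_polyD; first by apply: pos_polyM => //; exact: pos_polyX.
by apply: pos_polyM => //; apply: pos_polyC; rewrite mulr_ge0 // ltW.
Qed.

(** The uniformity in c is the point: it makes h(c a) tend to the constant h(0) in norm as c tends
    to 0. *)
Lemma s2poly_scale_bound (p : {poly R}) : exists2 K : R, 0 <= K &
  forall c, 0 <= c -> c <= 1 -> forall v,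
  hnorm (pi (s2poly (cpoly (p \Po (c *: 'X)))) v) <= K * hnorm v.
Proof.
have [M [M0 hM]] := rep_bounded_by a rpi.
elim/poly_ind: p => [|p d [K K0 hK]].
  exists 0 => // c _ _ v; rewrite comp_poly0 rmorph0 rmorph0 rep0 //.
  by rewrite /hnorm normr0 mul0r.
exists (K * M + `|d|) => [|c c0 c1 v].
  by rewrite addr_ge0 // mulr_ge0.
rewrite comp_poly_MXaddC rmorphD rmorphM /= map_polyC map_polyZ map_polyX.
rewrite rmorphD rmorphM /= s2polyZ s2polyX s2polyC (repD rpi) (repM rpi) !(repZ rpi).
rewrite (rep1 rpi) mulrDl; apply: le_trans (ler_hnormD _ _) _.
apply: lerD; last by rewrite hnormZ cmod_real.
apply: le_trans (hK c c0 c1 _) _; rewrite hnormZ cmod_real ger0_norm // -mulrA.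
rewrite ler_wpM2l //; apply: le_trans (hM v).
by rewrite ler_piMl ?hnorm_ge0.
Qed.

(** After adding e > 0 the value h(0) is positive, hence so is the operator h(Q^N a) for large N.
    Then [pos_poly_step] descends from N to 0; the boundary values it asks for are those of h at Q^n
    t_+ and Q^n t_-. *)
Lemma pos_poly_spectrum h : (forall n, 0 <= h.[Q ^+ n * tp]) ->
  (forall n, 0 <= h.[Q ^+ n * tm]) -> 0 <= h.[0] -> pos_poly h.
Proof.
move=> hp hm h0; apply: (@pos_poly_lim _ 1) => m; set e := _ / _.
have e0 : 0 < e by rewrite divr_gt0.
have {h0} : 0 < (h + e%:P).[0] by rewrite !hornerE ltr_wpDl.
have {}hp n : 0 <= (h + e%:P).[Q ^+ n * tp].
  by rewrite hornerD hornerC addr_ge0 ?hp // ltW.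
have {}hm n : 0 <= (h + e%:P).[Q ^+ n * tm].
  by rewrite hornerD hornerC addr_ge0 ?hm // ltW.
move: (h + _) hp hm => {}h hp hm h0 {e e0 m}.
have Q1 : `|Q| < 1 by rewrite ger0_norm ?sqr_ge0 // expr_lt1.
have [N hN] : exists N, pos_poly (h \Po (Q ^+ N *: 'X)).
  have [g [d hE]] : exists g d, h = g * 'X + d%:P.
    by elim/poly_ind: (h) => [|g d _]; [exists 0, 0; rewrite mul0r addr0|exists g, d].
  have d0 : 0 < d by move: h0; rewrite hE !hornerE.
  have [K K0 hK] := s2poly_scale_bound g.
  have [M [M0 hM]] := rep_bounded_by a rpi.
  have KM : 0 < K * M + 1 by rewrite ltr_wpDl // mulr_ge0.
  have /cvgrPdist_lt /(_ _ (divr_gt0 d0 KM)) [N _ /(_ N (leqnn N))] := cvg_expr Q1.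
  rewrite /= sub0r normrN ger0_norm ?exprn_ge0 // ltr_pdivlMr // => hN.
  have QN0 : 0 <= Q ^+ N by rewrite exprn_ge0.
  have QN1 : Q ^+ N <= 1 by rewrite exprn_ile1 // ltW // expr_lt1.
  exists N; rewrite hE comp_poly_MXaddC => v; rewrite rmorphD rmorphM /= map_polyC.
  rewrite map_polyZ map_polyX rmorphD rmorphM /= s2polyZ s2polyX s2polyC -scalerAr.
  rewrite (quadD rpi) !(quadZ rpi) quad1 //.
  have : `|quad pi (s2poly (cpoly (g \Po (Q ^+ N *: 'X))) * a) v| <= K * M * hnorm v ^+ 2.
    apply: quad_le => w; rewrite (repM rpi) -mulrA; apply: le_trans (hK _ QN0 QN1 _) _.
    by rewrite ler_wpM2l.
  rewrite ler_norml => /andP[h1 _].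
  have := ler_wpM2l QN0 h1 => h2; rewrite -[leLHS](addNr (Q ^+ N * (K * M * hnorm v ^+ 2))).
  apply: lerD; first by rewrite -mulrN.
  rewrite mulrA ler_wpM2r ?sqr_ge0 //; apply: le_trans (ltW hN).
  by rewrite ler_wpM2l // lerDl.
elim: N hN => [|N IH hN]; first by rewrite expr0 scale1r comp_polyXr.
apply: IH; apply: pos_poly_step; last 2 first.
- by rewrite horner_comp hornerZ hornerX.
- by rewrite horner_comp hornerZ hornerX.
by rewrite -comp_polyA linearZ /= comp_polyX scalerA -exprSr.
Qed.

(** [pos_poly_spectrum] applies to M^2 - |p|^2, where |p|^2 = p1^2 + p2^2 is a real polynomial, p1
    and p2 having the real and imaginary parts of the coefficients of p. *)
Lemma s2poly_norm_le (p : {poly R[i]}) (M : R) : 0 <= M ->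
  (forall n, cmod p.[(Q ^+ n * tp)%:C] <= M) ->
  (forall n, cmod p.[(Q ^+ n * tm)%:C] <= M) -> cmod p.[0] <= M ->
  forall v, hnorm (pi (s2poly p) v) <= M * hnorm v.
Proof.
move=> M0 hp hm h0 v.
pose p1 := map_poly (@complex.Re R) p; pose p2 := map_poly (@complex.Im R) p.
have pE : p = cpoly p1 + 'i%:P * cpoly p2.
  apply/polyP => i; rewrite coefD coefCM !coef_map [LHS]complexE.
  by rewrite complexiE.
have pc : conj_poly p = cpoly p1 - 'i%:P * cpoly p2.
  rewrite pE /conj_poly rmorphD rmorphM /= map_polyC -!/(conj_poly _) !conj_poly_real.
  by rewrite /= conjCi polyCN mulNr.
have pp : conj_poly p * p = cpoly (p1 ^+ 2 + p2 ^+ 2).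
  rewrite pc {1}pE -subr_sqr exprMn -polyC_exp sqrCi polyCN mulN1r opprK.
  by rewrite rmorphD !rmorphXn.
have pv x : (p1 ^+ 2 + p2 ^+ 2).[x] = cmod p.[x%:C] ^+ 2.
  apply: (@complexI R); rewrite -cmod_sqr -horner_map /= -pp hornerM; congr (_ * _).
  by rewrite /conj_poly -{1}[x%:C]conj_rc horner_map.
have : pos_poly ((M ^+ 2)%:P - (p1 ^+ 2 + p2 ^+ 2)).
  apply: pos_poly_spectrum => [n|n|]; rewrite hornerD hornerN hornerC pv subr_ge0;
    by rewrite ler_sqr ?nnegrE ?cmod_ge0.
rewrite /pos_poly rmorphB /= map_polyC -pp rmorphB rmorphM /= s2polyC => /(_ v).
rewrite -star_s2poly quadD // quadN // quad_sqr // quadZ // quad1 // subr_ge0.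
by rewrite -exprMn ler_sqr // nnegrE ?mulr_ge0 ?hnorm_ge0.
Qed.

End Spectrum.
End Sphere.

(** * The graded components *)

Lemma starX (C : numClosedFieldType) (B : starAlgType C) (x : B) k : star (x ^+ k) = star x ^+ k.
Proof. by elim: k => [|k IH]; rewrite ?star1 // exprS starM IH -exprSr. Qed.

Section Grading.
Variables (R : realType) (q r : {posnum R}).
Local Notation A := (S2qr q r).
Local Notation a := (s2a q r).
Local Notation b := (s2b q r).
Local Notation Q := (q%:num ^+ 2).
Local Notation s2poly := (horner_alg a).
Local Notation cpoly := (map_poly (real_complex R)).


Lemma dilateM c d p : dilate c (dilate d p) = @dilate R (c * d) p.
Proof.
by rewrite /dilate -comp_polyA linearZ /= comp_polyX scalerA -rmorphM mulrC.
Qed.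

Lemma dilate1 p : @dilate R 1 p = p.
Proof. by rewrite /dilate rmorph1 scale1r comp_polyXr. Qed.

Lemma horner_dilate c p (t : R) : (@dilate R c p).[t%:C] = p.[(c * t)%:C].
Proof. by rewrite /dilate horner_comp hornerZ hornerX rmorphM. Qed.

(** Integer powers of b with the adjoint in place of the inverse; [bpow n] generates the component
    of degree n over C[a]. *)
Definition bpow (n : int) : A := if n is Posz k then b ^+ k else star b ^+ `|n|%N.

Lemma bs_s2poly p : star b * s2poly p = s2poly (dilate Q^-1 p) * star b.
Proof. by rewrite s2poly_bs dilateM mulfV // dilate1. Qed.

Lemma bpow_s2poly n p : bpow n * s2poly p = s2poly (dilate (Q ^ n) p) * bpow n.
Proof.
have pos c (x : A) : (forall p, x * s2poly p = s2poly (dilate c p) * x) ->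
    forall k p, x ^+ k * s2poly p = s2poly (dilate (c ^+ k) p) * x ^+ k.
  move=> h; elim=> [|k IH] p'; first by rewrite mul1r dilate1 mulr1.
  by rewrite exprSr -mulrA h mulrA IH dilateM -exprSr mulrA.
case: n => k; first exact: (pos _ _ (@b_s2poly R q r)).
by rewrite NegzE -exprz_inv; exact: (pos _ _ bs_s2poly).
Qed.

Lemma star_bpow n : star (bpow n) = bpow (- n).
Proof.
case: n => [[|k]|k].
- by rewrite oppr0 star1.
- by rewrite /= starX.
- by rewrite -[- Negz k]/(Posz k.+1) /= starX starK.
Qed.

Lemma bpow0 : bpow 0 = 1. Proof. by []. Qed.

Lemma bpowS n : exists g, b * bpow n = s2poly g * bpow (1 + n).
Proof.
case: n => [k|[|k]].
- by exists 1; rewrite rmorph1 mul1r /= -exprS.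
- exists (dilate Q (cpoly (fpoly r))).
  by rewrite -[1 + _]/(0 : int) bpow0 mulr1 /= expr1 b_bs.
- exists (dilate Q (cpoly (fpoly r))).
  have -> : 1 + Negz k.+1 = Negz k.
    by rewrite !NegzE -[k.+2]add1n PoszD opprD addrA subrr add0r.
  by rewrite /= exprS mulrA b_bs.
Qed.

Lemma bpowP n : exists g, star b * bpow n = s2poly g * bpow (-1 + n).
Proof.
case: n => [[|k]|k].
- by exists 1; rewrite rmorph1 mul1r /= mulr1 expr1.
- exists (cpoly (fpoly r)).
  have -> : -1 + Posz k.+1 = Posz k by rewrite -add1n PoszD addKr.
  by rewrite /= exprS mulrA bs_b.
- exists 1; rewrite rmorph1 mul1r.
  have -> : -1 + Negz k = Negz k.+1 by rewrite !NegzE -[k.+2]add1n PoszD opprD.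
  by rewrite /= -exprS.
Qed.

Lemma bpowM m n : exists g, bpow m * bpow n = s2poly g * bpow (m + n).
Proof.
have pos (x : A) d : (forall n, exists g, x * bpow n = s2poly g * bpow (d + n)) ->
    (exists c, forall p, x * s2poly p = s2poly (dilate c p) * x) ->
    forall k n, exists g, x ^+ k * bpow n = s2poly g * bpow (d *+ k + n).
  move=> h [c hc]; elim=> [|k IH] n'; first by exists 1; rewrite rmorph1 add0r.
  have [g hg] := IH n'; have [g' hg'] := h (d *+ k + n').
  exists (dilate c g * g').
  by rewrite exprS -mulrA hg mulrA hc -mulrA hg' mulrA rmorphM mulrS addrA.
case: m => k.
  have [] := pos b 1 bpowS _ k n; first by exists Q; exact: (@b_s2poly R q r).
  by move=> g; rewrite natz; exists g.
have [] := pos (star b) (-1) bpowP _ k.+1 n; first by exists Q^-1; exact: bs_s2poly.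
by move=> g; rewrite mulNrn natz -NegzE; exists g.
Qed.

Lemma homog_bpow n : s2_homog n (bpow n).
Proof.
have pos (x : A) d : s2_homog d x -> forall k, s2_homog (d *+ k) (x ^+ k).
  move=> h; elim=> [|k IH]; first exact: homog_1.
  by rewrite exprS mulrS; exact: homogM.
case: n => k.
  by have := pos b 1 (homog_b q r) k; rewrite natz.
have := pos (star b) (-1) (homog_bs q r) k.+1.
by rewrite mulNrn natz NegzE.
Qed.

Lemma homog_s2poly p : s2_homog 0 (s2poly p).
Proof.
elim/poly_ind: p => [|p c IH]; first by rewrite rmorph0; exact: homog_0.
rewrite rmorphD rmorphM /= s2polyX s2polyC; apply: homogD.
  by rewrite -[0]addr0; apply: homogM => //; exact: homog_a.
by apply: homogZ; exact: homog_1.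
Qed.

Lemma homogP n x : s2_homog n x -> exists p, x = s2poly p * bpow n.
Proof.
elim=> {n x}.
- by exists 'X; rewrite s2polyX mulr1.
- by exists 1; rewrite rmorph1 mul1r /= expr1.
- by exists 1; rewrite rmorph1 mul1r /= expr1.
- by exists 1; rewrite rmorph1 mul1r.
- by move=> n; exists 0; rewrite rmorph0 mul0r.
- by move=> n x y _ [p ->] _ [p' ->]; exists (p + p'); rewrite rmorphD mulrDl.
- by move=> n c x _ [p ->]; exists (c *: p); rewrite s2polyZ scalerAl.
- move=> m n x y _ [p ->] _ [p' ->]; have [g hg] := bpowM m n.
  exists (p * dilate (Q ^ m) p' * g).
  rewrite -[LHS]mulrA [bpow m * (_ * _)]mulrA bpow_s2poly -[_ * bpow m * bpow n]mulrA hg.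
  by rewrite !rmorphM !mulrA.
Qed.

(* The value at [a = t] of [b^*n b^n], resp. of [b^k b^*k] for [n = - k].     *)
Definition weight (n : int) (t : R) : R := match n with
  | Posz k => \prod_(j < k) (fpoly r).[Q ^- j * t]
  | Negz k => \prod_(j < k.+1) (fpoly r).[Q ^+ j.+1 * t]
  end.

(** The innermost pair of factors is f(a) or f(Qa) by the defining relations; moving it out past the
    remaining powers dilates its argument. *)
Lemma bpow_weight n : exists2 g : {poly R}, bpow (- n) * bpow n = s2poly (cpoly g) &
  forall t, g.[t] = weight n t.
Proof.
have sb k : bpow (- Posz k) = star b ^+ k by rewrite -star_bpow starX.
case: n => k; rewrite /weight.
- rewrite sb /=; elim: k => [|k [g hg gw]].
    by exists 1 => [|t]; rewrite ?mulr1 ?rmorph1 // big_ord0 hornerC.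
  exists (g * (fpoly r \Po (Q ^- k *: 'X))) => [|t]; last first.
    by rewrite hornerM gw [RHS]big_ord_recr /= horner_comp hornerZ hornerX.
  rewrite rmorphM /= cpoly_scale rmorphM /= -hg.
  rewrite [star b ^+ k.+1]exprSr [b ^+ k.+1]exprS mulrA -[_ * star b * b]mulrA bs_b.
  by rewrite -sb bpow_s2poly -exprnN -mulrA sb hg s2poly_comm.
- elim: k => [|k [g hg gw]].
    exists (fpoly r \Po (Q *: 'X)) => [|t].
      by rewrite cpoly_scale -b_bs.
    by rewrite big_ord_recr /= big_ord0 mul1r horner_comp hornerZ hornerX expr1.
  exists (g * (fpoly r \Po (Q ^+ k.+2 *: 'X))) => [|t]; last first.
    by rewrite hornerM gw [RHS]big_ord_recr /= horner_comp hornerZ hornerX.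
  rewrite rmorphM /= cpoly_scale rmorphM /= -hg /=.
  rewrite [b ^+ k.+2]exprSr [star b ^+ k.+2]exprS mulrA -[_ * b * star b]mulrA b_bs.
  have := bpow_s2poly (Posz k.+1) (dilate Q (cpoly (fpoly r))); rewrite /= => ->.
  by rewrite dilateM -exprSr -mulrA -[b ^+ k.+1 * star b ^+ k.+1]/(bpow (- Negz k) * bpow (Negz k)) hg s2poly_comm.
Qed.

End Grading.

(** * The positive spectrum *)

Section Characters.
Variables (R : realType) (q r : {posnum R}).
Hypothesis q_lt1 : q%:num < 1.
Local Notation A := (S2qr q r).
Local Notation a := (s2a q r).
Local Notation b := (s2b q r).
Local Notation Q := (q%:num ^+ 2).
Local Notation s2poly := (horner_alg a).
Local Notation cpoly := (map_poly (real_complex R)).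
Local Notation tp := (tplus r).
Local Notation tm := (tminus r).
Local Notation f := (fpoly r).

Let Q_neq0 : Q != 0. Proof. by rewrite gt_eqF. Qed.
Let Q_lt1 : Q < 1. Proof. by rewrite expr_lt1. Qed.

Lemma fpoly_horner t : f.[t] = t - t ^+ 2 + r%:num.
Proof. by rewrite /fpoly hornerD hornerC hornerD hornerN hornerX hornerXn. Qed.

Lemma fpoly_factor t : f.[t] = (tp - t) * (t - tm).
Proof. by rewrite fpolyE hornerM !hornerD !hornerN !hornerC hornerX. Qed.

(* The weight representation with [a = diag (Q^k t)], [b] the backward shift  *)
(* and [b^*] the forward shift weighted by [f (Q^k t)]; it exists if          *)
(* [f t = 0] and it separates the polynomials in [a].                         *)
Fixpoint s2_interp (t : R) (s : s2_term R) (v : nat -> R[i]) : nat -> R[i] :=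
  match s with
  | GenA => fun k => (Q ^+ k * t)%:C * v k
  | GenB => fun k => v k.+1
  | GenBs => fun k => if k is j.+1 then f.[Q ^+ k * t]%:C * v j else 0
  | Cst c => fun k => c * v k
  | Add s s' => fun k => s2_interp t s v k + s2_interp t s' v k
  | Mul s s' => s2_interp t s (s2_interp t s' v)
  end.

Lemma s2_interp_linear t s c v w k :
  s2_interp t s (fun k => c * v k + w k) k = c * s2_interp t s v k + s2_interp t s w k.
Proof.
elim: s v w k => [||| d|s IHs s' IHs'|s IHs s' IHs'] v w k /=.
- by ring.
- by [].
- by case: k => [|k]; ring.
- by ring.
- by rewrite IHs IHs'; ring.
- by rewrite -IHs; congr s2_interp; apply/funext => j; exact: IHs'.
Qed.

Lemma s2_interpD t s v w k :
  s2_interp t s (fun k => v k + w k) k = s2_interp t s v k + s2_interp t s w k.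
Proof.
have := s2_interp_linear t s 1 v w k; rewrite mul1r => <-.
by congr s2_interp; apply/funext => j; rewrite mul1r.
Qed.

Lemma s2_interpZ t s c v k :
  s2_interp t s (fun k => c * v k) k = c * s2_interp t s v k.
Proof.
have z : s2_interp t s (fun=> 0) k = 0.
  have := s2_interp_linear t s (-1) (fun=> 0) (fun=> 0) k.
  have -> : (fun=> -1 * 0 + 0) = (fun=> 0) :> (nat -> R[i]).
    by apply/funext => j; rewrite mulr0 addr0.
  by rewrite mulN1r addNr.
have := s2_interp_linear t s c v (fun=> 0) k; rewrite z addr0 => <-.
by congr s2_interp; apply/funext => j; rewrite addr0.
Qed.

Lemma s2_interp_eq t s s' : f.[t] = 0 -> s2_eq q%:num r%:num s s' ->
  s2_interp t s = s2_interp t s'.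
Proof.
move=> ft; elim=> //= {s s'}.
- by move=> s u w _ -> _ ->.
- by move=> s s' u u' _ -> _ ->.
- by move=> s s' u u' _ -> _ ->.
- by move=> s u w; apply/funext => v; apply/funext => k; rewrite addrA.
- by move=> s u; apply/funext => v; apply/funext => k; rewrite addrC.
- by move=> s; apply/funext => v; apply/funext => k; rewrite mul0r add0r.
- by move=> s; apply/funext => v; apply/funext => k; rewrite mul1r.
- by move=> s; apply/funext => v; apply/funext => k; rewrite !mul0r.
- by move=> s u w; apply/funext => v; apply/funext => k; exact: s2_interpD.
- by move=> c d; apply/funext => v; apply/funext => k; rewrite mulrDl.
- by move=> c d; apply/funext => v; apply/funext => k; rewrite mulrA.
- by move=> c s; apply/funext => v; apply/funext => k; rewrite s2_interpZ.
- apply/funext => v; apply/funext => k.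
  rewrite mulrA -rmorphM; congr (_%:C * _).
  by rewrite [Q ^+ k.+1]exprS -mulrA mulKf.
- apply/funext => v; apply/funext => -[|k]; first by rewrite !mulr0.
  by rewrite !mulrA -!rmorphM; congr (_%:C * _); rewrite exprS; ring.
- apply/funext => v; apply/funext => -[|k]; last first.
    by rewrite fpoly_horner !rmorphD rmorphN rmorphXn /=; ring.
  (* At index 0 the left side is 0 and the right side is f(t) v_0; this is where t has to be a root
     of f. *)
  have := congr1 (real_complex R) ft; rewrite fpoly_horner expr0 mul1r.
  rewrite !rmorphD rmorphN rmorphXn rmorph0 /= => e.
  by rewrite -(mul0r (v 0%N)) -e; ring.
- apply/funext => v; apply/funext => k.
  have -> : q%:num ^+ 4 = Q * Q by rewrite -expr2 -exprM.
  rewrite fpoly_horner exprS !rmorphD !rmorphN !rmorphM rmorphXn rmorphM /=.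
  by move: (_ ^+ k) => z; ring.
Qed.

Definition s2_act t (x : A) := s2_interp t (repr x).

Section Action.
Variables (t : R) (ft : f.[t] = 0).

Lemma s2_act_class s : s2_act t (s2_class q r s) = s2_interp t s.
Proof. exact/s2_interp_eq/s2_repr. Qed.

Lemma s2_actD x y v k : s2_act t (x + y) v k = s2_act t x v k + s2_act t y v k.
Proof.
by elim/S2_ind: x => s; elim/S2_ind: y => s'; rewrite -s2_classD !s2_act_class.
Qed.

Lemma s2_actM x y v : s2_act t (x * y) v = s2_act t x (s2_act t y v).
Proof.
by elim/S2_ind: x => s; elim/S2_ind: y => s'; rewrite -s2_classM !s2_act_class.
Qed.

Lemma s2_act_poly p v k : s2_act t (s2poly p) v k = p.[(Q ^+ k * t)%:C] * v k.
Proof.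
elim/poly_ind: p v k => [|p c IH] v k.
  by rewrite rmorph0 horner0 mul0r -s2_class0 s2_act_class /= mul0r.
rewrite rmorphD rmorphM /= s2polyX s2polyC s2_actD s2_actM IH -s2_classC s2_act_class /=.
by rewrite s2_act_class /= hornerMXaddC; ring.
Qed.

End Action.

Lemma fpoly_tp : f.[tp] = 0.
Proof. by rewrite fpoly_factor subrr mul0r. Qed.

Lemma fpoly_tm : f.[tm] = 0.
Proof. by rewrite fpoly_factor subrr mulr0. Qed.

(** In the weight representation at t_+ the operator p(a) is diagonal with entries p(Q^k t_+), so
    p(a) = p'(a) gives p - p' infinitely many roots. *)
Lemma s2poly_inj : injective s2poly.
Proof.
move=> p p' e; apply/eqP; rewrite -subr_eq0; apply/negPn/negP => pp0.
have tp0 : tp != 0 by rewrite gt_eqF // tplus_gt0.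
pose x k : R[i] := (Q ^+ k * tp)%:C.
have := @max_poly_roots _ (p - p') (map x (iota 0 (size (p - p')))) pp0.
rewrite size_map size_iota ltnn => h; apply/notF/h.
  apply/allP => _ /mapP[k _ ->]; rewrite /root hornerD hornerN subr_eq0.
  have := congr1 (fun y => s2_act tp y (fun=> 1) k) e.
  by rewrite !(s2_act_poly fpoly_tp) !mulr1 => ->.
rewrite map_inj_in_uniq ?iota_uniq // => k l _ _ /complexI /(mulIf tp0).
by apply: ieexprIn => //; rewrite lt_eqF.
Qed.

Fact s2base_subproof p : s2poly p \in s2_gr 0.
Proof. exact/s2_grP/homog_s2poly. Qed.
Definition s2base p : S2base q r := Base (s2base_subproof p).

Lemma s2base_ex (x : S2base q r) : exists p, base_val x = s2poly p.
Proof.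
have /s2_grP/homogP[p hp] := base_valP x.
by exists p; rewrite hp bpow0 mulr1.
Qed.

Definition poly_of (x : S2base q r) : {poly R[i]} := projT1 (cid (s2base_ex x)).

Lemma poly_ofP x : base_val x = s2poly (poly_of x).
Proof. exact: projT2 (cid (s2base_ex x)). Qed.

Lemma poly_ofK p : poly_of (s2base p) = p.
Proof. by apply: s2poly_inj; rewrite -poly_ofP. Qed.

Lemma s2baseK x : s2base (poly_of x) = x.
Proof. by apply: val_inj; rewrite /= poly_ofP. Qed.

Lemma poly_ofD x y : poly_of (x + y) = poly_of x + poly_of y.
Proof. by apply: s2poly_inj; rewrite rmorphD /= -!poly_ofP. Qed.

Lemma poly_ofM x y : poly_of (x * y) = poly_of x * poly_of y.
Proof. by apply: s2poly_inj; rewrite rmorphM /= -!poly_ofP. Qed.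

Lemma poly_ofZ c x : poly_of (c *: x) = c *: poly_of x.
Proof. by apply: s2poly_inj; rewrite s2polyZ -!poly_ofP. Qed.

Lemma poly_of1 : poly_of 1 = 1.
Proof. by apply: s2poly_inj; rewrite rmorph1 -poly_ofP. Qed.

Lemma poly_of_star x : poly_of (star x) = conj_poly (poly_of x).
Proof. by apply: s2poly_inj; rewrite -star_s2poly -!poly_ofP. Qed.

Definition ev (t : R) (x : S2base q r) : R[i] := (poly_of x).[t%:C].

Lemma conj_poly_horner (p : {poly R[i]}) (t : R) :
  (conj_poly p).[t%:C] = (p.[t%:C])^*%R.
Proof. by rewrite /conj_poly -{1}[t%:C]conj_rc horner_map. Qed.

Lemma ev_character t : is_character (ev t).
Proof.
split=> [x y|c x|x y|x|].
- by rewrite /ev poly_ofD hornerD.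
- by rewrite /ev poly_ofZ hornerZ.
- by rewrite /ev poly_ofM hornerM.
- by rewrite /ev poly_of_star conj_poly_horner.
- by exists 1; rewrite /ev poly_of1 hornerC oner_neq0.
Qed.

(** With c = p(a) b^n, moving [bpow (- n)] to the right dilates the middle factor by Q^(-n) and
    leaves the weight. One p serves both formulas, so their quotient is evaluation at Q^(-n) t. *)
Lemma sandwich_ev n c (hc : c \in s2_gr n) : exists p : {poly R[i]},
  (forall t x, ev t (sandwich hc x) =
    (cmod p.[(Q ^ (- n) * t)%:C] ^+ 2 * weight q r n t)%:C * ev (Q ^ (- n) * t) x) /\
  (forall t, ev t (star_sq hc) = (cmod p.[(Q ^ (- n) * t)%:C] ^+ 2 * weight q r n t)%:C).
Proof.
have /s2_grP/homogP[p cE] := hc; exists p.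
have [g hg gw] := bpow_weight q r n.
have E x : star c * base_val x * c = s2poly (dilate (Q ^ (- n))
    (conj_poly p * poly_of x * p) * cpoly g).
  rewrite cE starM star_bpow star_s2poly poly_ofP.
  have -> : bpow q r (- n) * s2poly (conj_poly p) * s2poly (poly_of x) *
      (s2poly p * bpow q r n) =
      bpow q r (- n) * s2poly (conj_poly p * poly_of x * p) * bpow q r n.
    by rewrite !rmorphM /= !mulrA.
  by rewrite bpow_s2poly -[LHS]mulrA hg -rmorphM.
have H t x : ev t (sandwich hc x) =
    (cmod p.[(Q ^ (- n) * t)%:C] ^+ 2 * weight q r n t)%:C * ev (Q ^ (- n) * t) x.
  have -> : sandwich hc x = s2base (dilate (Q ^ (- n))
      (conj_poly p * poly_of x * p) * cpoly g) by apply: val_inj; rewrite /= E.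
  rewrite /ev poly_ofK hornerM horner_dilate !hornerM horner_map gw conj_poly_horner.
  by move: (Q ^ (- n) * t) => s; rewrite rmorphM /= -cmod_sqr; ring.
split=> // t; have -> : star_sq hc = sandwich hc 1.
  by apply: val_inj; rewrite /= mulr1.
by rewrite H /ev poly_of1 hornerC mulr1.
Qed.

(** A character is determined by its value at [a], which is real because [a] is self-adjoint. *)
Lemma chi_ev (chi : S2base q r -> R[i]) : is_character chi ->
  exists t : R, forall x, chi x = ev t x.
Proof.
case=> cD cZ cM cS [x0 x00].
have c1 : chi 1 = 1.
  by apply: (mulIf x00); rewrite -cM !mul1r.
have c0 : chi 0 = 0 by rewrite -(scale0r 1) cZ mul0r.
have [t ht] : exists t : R, chi (s2base 'X) = t%:C.
  exists (complex.Re (chi (s2base 'X))); rewrite RRe_real //; apply/CrealP.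
  rewrite -cS; congr chi; apply: val_inj.
  by rewrite /= star_s2poly /conj_poly map_polyX.
exists t => x; rewrite -[in LHS](s2baseK x) /ev.
elim/poly_ind: (poly_of x) => [|p c IH].
  by rewrite horner0 -c0; congr chi; apply: val_inj; rewrite /= rmorph0.
rewrite hornerMXaddC -IH -ht -cM -[c in RHS]mulr1 -[1 in RHS]c1 -cZ -cD; congr chi.
by apply: val_inj; rewrite /= rmorphD rmorphM /= s2polyC.
Qed.

(** The forward Q-orbits of the two roots of f with their limit 0; [tau_ev] and [spec_pt] identify
    this set with the positive spectrum. *)
Definition spec_set : set R :=
  [set t | t = 0 \/ exists n : nat, t = Q ^+ n * tp \/ t = Q ^+ n * tm].
Local Notation K := spec_set.

Let tp0 : 0 < tp := tplus_gt0 r.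
Let tm0 : tm < 0 := tminus_lt0 r.

Lemma fpoly_gt0 t : tm < t < tp -> 0 < f.[t].
Proof. by case/andP => h1 h2; rewrite fpoly_factor mulr_gt0 // subr_gt0. Qed.

Lemma fpoly_ge0 t : (0 <= f.[t]) = (tm <= t <= tp).
Proof.
rewrite fpoly_factor; apply/idP/idP => [h|/andP[h1 h2]]; last first.
  by rewrite mulr_ge0 // subr_ge0.
have tt : tm < tp by exact: lt_trans tm0 tp0.
apply/andP; split; rewrite leNgt; apply/negP => ht; move: h; rewrite leNgt => /negP; apply.
  by rewrite nmulr_llt0 ?subr_lt0 // subr_gt0 (lt_trans ht).
by rewrite nmulr_rlt0 ?subr_lt0 // subr_gt0 (lt_trans tt).
Qed.

Lemma spec_set_bounds t : K t -> tm <= t <= tp.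
Proof.
have Qn n : 0 <= Q ^+ n <= 1 by rewrite exprn_ge0 ?exprn_ile1 // ltW.
case=> [->|[n [->|->]]]; first by rewrite !ltW.
- have /andP[h0 h1] := Qn n; rewrite ler_piMl ?(ltW tp0) // andbT.
  by rewrite (le_trans (ltW tm0)) // mulr_ge0 // ltW.
- have /andP[h0 h1] := Qn n; rewrite ler_niMl ?(ltW tm0) //=.
  by rewrite (le_trans _ (ltW tp0)) // mulr_ge0_le0 // ltW.
Qed.

Lemma spec_set_Q t : K t -> K (Q * t).
Proof.
case=> [->|[n [->|->]]]; first by rewrite mulr0; left.
- by right; exists n.+1; left; rewrite [Q ^+ n.+1]exprS -[RHS]mulrA.
- by right; exists n.+1; right; rewrite [Q ^+ n.+1]exprS -[RHS]mulrA.
Qed.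

(** As t_- < 0 < t_+, dilation by Q < 1 pushes the closed interval between the roots into its
    interior. *)
Lemma fpoly_Q_gt0 t : tm <= t <= tp -> 0 < f.[Q * t].
Proof.
case/andP=> h1 h2; apply: fpoly_gt0; apply/andP; split.
  apply: (@lt_le_trans _ _ (Q * tm)); last by rewrite ler_pM2l.
  by rewrite ltr_nMl.
apply: (@le_lt_trans _ _ (Q * tp)); first by rewrite ler_pM2l.
by rewrite gtr_pMl.
Qed.

(** On K the polynomial f vanishes only at t_+ and t_-, the two points of K that are not Q times a
    point of K. *)
Lemma spec_set_invQ t : K t -> f.[t] != 0 <-> K (Q^-1 * t).
Proof.
move=> Kt; split=> [ft|/spec_set_bounds h]; last first.
  by rewrite gt_eqF // -[t](mulVKf Q_neq0) fpoly_Q_gt0.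
case: Kt ft => [->|[[|n] [->|->]]].
- by rewrite mulr0 => _; left.
- by rewrite mul1r fpoly_tp eqxx.
- by rewrite mul1r fpoly_tm eqxx.
- by move=> _; right; exists n; left; rewrite [Q ^+ n.+1]exprS -mulrA mulKf.
- by move=> _; right; exists n; right; rewrite [Q ^+ n.+1]exprS -mulrA mulKf.
Qed.

Lemma weight_spec n t : K t -> 0 <= weight q r n t /\ (weight q r n t != 0 <-> K (Q ^ (- n) * t)).
Proof.
move=> Kt; have KQ k : K (Q ^+ k * t).
  elim: k => [|k IH]; first by rewrite mul1r.
  by rewrite [Q ^+ k.+1]exprS -mulrA; exact: spec_set_Q.
case: n => k.
  rewrite -exprnN /weight; elim: k => [|k [IH1 IH2]].
    by rewrite big_ord0 expr0 invr1 mul1r oner_neq0; split.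
  rewrite big_ord_recr /=; set w := \prod_(_ < _) _ in IH1 IH2 *.
  have QV : Q ^- k.+1 * t = Q^-1 * (Q ^- k * t).
    by rewrite mulrA -!exprVn -exprS.
  have [w0|w0] := eqVneq w 0.
    rewrite w0 mul0r eqxx; split=> //; split=> // /spec_set_Q.
    by rewrite QV mulVKf // => /IH2; rewrite w0 eqxx.
  have Kk := IH2.1 w0; split.
    by rewrite mulr_ge0 // fpoly_ge0; exact: spec_set_bounds.
  by rewrite mulf_eq0 (negPf w0) /= QV; exact: spec_set_invQ.
have w0 : 0 < weight q r (Negz k) t.
  apply: prodr_gt0 => j _; rewrite [Q ^+ j.+1]exprS -mulrA; apply: fpoly_Q_gt0.
  by apply: spec_set_bounds.
split; first exact: ltW.
by split=> [_|_]; [exact: KQ | rewrite gt_eqF].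
Qed.

(** For t nonzero, Q^(-k) t leaves [t_-, t_+]. At the first N with f(Q^(-N) t) <= 0 the earlier
    factors of the weight are positive, so nonnegativity of the next weight forces f(Q^(-N) t) =
    0. *)
Lemma spec_setP t : K t <-> forall k : nat, 0 <= weight q r k t.
Proof.
split=> [Kt k|h]; first by have [] := weight_spec k Kt.
have [->|t0] := eqVneq t 0; first by left.
have ex : exists N, f.[Q ^- N * t] <= 0.
  have d0 : 0 < tp - tm by rewrite subr_gt0 (lt_trans tm0).
  have Q1 : `|Q| < 1 by rewrite ger0_norm // ltW.
  have t0' : 0 < `|t| by rewrite normr_gt0.
  have /cvgrPdist_lt /(_ _ (divr_gt0 t0' d0)) [N _ /(_ N (leqnn N))] := cvg_expr Q1.
  have QN : 0 < Q ^+ N by rewrite exprn_gt0.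
  rewrite /= sub0r normrN ger0_norm ?ltW // ltr_pdivlMr // => hN; exists N.
  rewrite leNgt; apply/negP => /ltW; rewrite fpoly_ge0 => /andP[h1 h2].
  have : `|Q ^- N * t| <= tp - tm.
    rewrite ler_norml; apply/andP; split.
      by apply: le_trans h1; rewrite opprB lerBlDr lerDl ltW.
    by apply: (le_trans h2); rewrite lerDl oppr_ge0 ltW.
  rewrite normrM normfV (ger0_norm (ltW QN)) leNgt => /negP; apply.
  by rewrite mulrC ltr_pdivlMr // mulrC.
have := ex_minnP ex => -[N fN Nmin].
have wN : 0 < \prod_(j < N) f.[Q ^- j * t].
  apply: prodr_gt0 => j _; rewrite ltNge; apply/negP => /Nmin.
  by rewrite leqNgt ltn_ord.
have := h N.+1; rewrite /weight big_ord_recr /= pmulr_rge0 // => fN'.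
have /eqP : f.[Q ^- N * t] = 0 by apply/eqP; rewrite eq_le fN fN'.
have QN : Q ^+ N != 0 by rewrite expf_neq0.
rewrite fpoly_factor mulf_eq0 !subr_eq0 => /orP[/eqP e|/eqP e]; right; exists N.
  by left; rewrite e mulVKf.
by right; rewrite -e mulVKf.
Qed.

Lemma ev_pos_spectrum t : K t -> pos_spectrum (ev t : {ptws S2base q r -> R[i]^o}).
Proof.
move=> Kt; split; first exact: ev_character.
move=> n c hc; have [p [_ ->]] := sandwich_ev hc.
by rewrite ler0c mulr_ge0 ?sqr_ge0 //; have [] := weight_spec n Kt.
Qed.

Lemma bpow_gr n : bpow q r n \in s2_gr n.
Proof. exact/s2_grP/homog_bpow. Qed.

Lemma bpow_ev n t : ev t (star_sq (bpow_gr n)) = (weight q r n t)%:C.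
Proof.
have [g hg gw] := bpow_weight q r n.
have -> : star_sq (bpow_gr n) = s2base (cpoly g).
  by apply: val_inj; rewrite /= star_bpow.
by rewrite /ev poly_ofK horner_map /= gw.
Qed.

Lemma pos_spectrum_ev (chi : {ptws S2base q r -> R[i]^o}) : pos_spectrum chi ->
  exists2 t, K t & forall x, chi x = ev t x.
Proof.
case=> /chi_ev[t ht] hpos; exists t => //; apply/spec_setP => k.
by have := hpos k _ (bpow_gr k); rewrite ht bpow_ev ler0c.
Qed.

Definition spec_tau (chi : S2spec q r) : R := complex.Re (spec_eval chi (s2base 'X)).

Lemma tau_ev (chi : S2spec q r) : K (spec_tau chi) /\ forall x, spec_eval chi x = ev (spec_tau chi) x.
Proof.
have [t Kt ht'] := pos_spectrum_ev (set_valP chi).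
have ht : forall x, spec_eval chi x = ev t x := ht'.
suff -> : spec_tau chi = t by split.
by rewrite /spec_tau ht /ev poly_ofK hornerX.
Qed.

(** Inverse of [spec_tau], made total by the default value [point] off K. *)
Definition spec_pt (t : R) : S2spec q r :=
  match pselect (K t) with
  | left Kt => SigSub (mem_set (ev_pos_spectrum Kt))
  | right _ => point
  end.

Lemma spec_eval_pt t x : K t -> spec_eval (spec_pt t) x = ev t x.
Proof. by rewrite /spec_pt; case: pselect. Qed.

Lemma tau_pt t : K t -> spec_tau (spec_pt t) = t.
Proof. by move=> Kt; rewrite /spec_tau spec_eval_pt // /ev poly_ofK hornerX. Qed.

Lemma tau_inj : injective spec_tau.
Proof.
move=> chi psi e; apply: val_inj; apply/funext => x.
rewrite -[LHS]/(spec_eval chi x) -[RHS]/(spec_eval psi x).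
by rewrite (tau_ev chi).2 (tau_ev psi).2 e.
Qed.

Lemma pt_tau chi : spec_pt (spec_tau chi) = chi.
Proof. by apply: tau_inj; rewrite tau_pt //; exact: (tau_ev chi).1. Qed.

Lemma alpha_domP n chi : alpha_dom n chi <-> K (Q ^ n * spec_tau chi).
Proof.
have [Kt et] := tau_ev chi; have [w0 wP] := weight_spec (- n) Kt.
rewrite opprK in wP; split=> [[c [hc]]|/wP w].
  rewrite et; have [p [_ ->]] := sandwich_ev hc.
  rewrite -(rmorph0 (real_complex R)) (inj_eq (@complexI R)) mulf_eq0 negb_or.
  by case/andP => _ /wP.
exists (bpow q r (- n)), (bpow_gr (- n)); rewrite et bpow_ev.
by rewrite -(rmorph0 (real_complex R)) (inj_eq (@complexI R)).
Qed.

Lemma tau_alpha n chi : alpha_dom (- n) chi -> spec_tau (alpha n chi) = Q ^ (- n) * spec_tau chi.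
Proof.
move=> /alpha_domP Kn; have [Kt et] := tau_ev chi.
rewrite /alpha; set P := (X in xget _ X).
(* Evaluation at Q^(-n) t meets the specification, so [xget] returns some solution; testing it on c
   = [bpow n] and x = a identifies it. *)
have : P (spec_pt (Q ^ (- n) * spec_tau chi)).
  move=> c hc; rewrite !et; have [p [h1 h2]] := sandwich_ev hc.
  rewrite h2 => c0 x; rewrite spec_eval_pt // et h1 [RHS]mulrC mulKf //.
move=> /(xgetI chi)/(_ _ (bpow_gr n)); set psi := xget _ _.
have w0 : weight q r n (spec_tau chi) != 0 by have [_ ->] := weight_spec n Kt.
rewrite et bpow_ev -(rmorph0 (real_complex R)) (inj_eq (@complexI R)) => /(_ w0) h.
rewrite {1}/spec_tau h et; have [p [h1 h2]] := sandwich_ev (bpow_gr n).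
have := h2 (spec_tau chi); rewrite bpow_ev h1 => <-.
rewrite mulrC mulKf; first by rewrite /ev poly_ofK hornerX.
by rewrite -(rmorph0 (real_complex R)) (inj_eq (@complexI R)).
Qed.

End Characters.

(** * Topology of the spectrum *)

Lemma ptws_cvg (I : choiceType) (V : topologicalType) (F : set_system (I -> V))
    (g : I -> V) : Filter F -> V ->
  (forall i, (fun h => h i) @ F --> g i) -> F --> (g : {ptws I -> V}).
Proof.
move=> FF v0 h; apply/cvg_sup => i.
apply/cvg_image.
  by rewrite eqEsubset; split => v // _; exists (fun=> v).
move=> W /(h i) /= FW; exists ((fun h => h i) @^-1` W) => //.
by rewrite eqEsubset; split => [j [? + <-//]|j Wj]; exists (fun=> j).
Qed.

Section SpectrumTopology.
Variables (R : realType) (q r : {posnum R}).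
Hypothesis q_lt1 : q%:num < 1.
Local Notation X := (S2spec q r).
Local Notation Q := (q%:num ^+ 2).
Local Notation tp := (tplus r).
Local Notation tm := (tminus r).
Local Notation K := (spec_set q r).
Local Notation tau := (@spec_tau R q r).
Local Notation pt := (spec_pt r q_lt1).

Lemma continuous_cpoly (p : {poly R[i]}) : continuous (fun s : R => p.[s%:C] : R[i]^o).
Proof.
have cC : continuous (fun s : R => s%:C : R[i]^o).
  apply/contE => x e e0; have /cvgrPdist_lt/(_ e e0) : (fun y : R => y) @ x --> (x : R) by exact: cvg_id.
  by apply: filterS => y; rewrite -rmorphB cmod_real.
elim/poly_ind: p => [|p c IH].
  by move=> x; under eq_fun do rewrite horner0; exact: cvg_cst.
have -> : (fun s : R => (p * 'X + c%:P).[s%:C] : R[i]^o) = (fun s => p.[s%:C] * s%:C + c).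
  by apply/funext => s; rewrite hornerMXaddC.
move=> x.
apply: (@continuousD R[i] R[i]^o R (fun s : R => p.[s%:C] * s%:C) (fun=> c) x).
  exact: (@continuousM R[i] R (fun s : R => p.[s%:C]) (fun s => s%:C) x (IH x) (cC x)).
exact: cst_continuous.
Qed.

Lemma tau_continuous : continuous tau.
Proof.
move=> chi; apply: (proj2 (@cvgrPdist_lt R R X (nbhs (chi : X)) _ tau (tau chi))) => e e0.
have ce : continuous (fun psi : X => spec_eval psi (s2base q r 'X) : R[i]^o).
  move=> psi; apply: (@continuous_comp _ _ _ (set_val : X -> {ptws S2base q r -> R[i]^o})
    (fun h => h (s2base q r 'X))).
    exact: initial_continuous.
  exact: (@proj_continuous _ (fun=> R[i]^o) (s2base q r 'X)).
have /contE/(_ chi e e0) := ce; apply: filterS => psi.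
by apply: le_lt_trans; rewrite /tau -raddfB; exact: Re_le_cmod.
Qed.

(** The weak topology is generated by the evaluations, which are polynomials in [tau]; with
    [tau_continuous] it is therefore the topology of K inside R. *)
Lemma cvg_tau (F : set_system X) chi : Filter F -> tau @ F --> tau chi -> F --> chi.
Proof.
move=> FF h U [_ [[B Bop <-] Bchi sBU]].
apply: (filterS sBU).
have : (set_val : X -> {ptws S2base q r -> R[i]^o}) @ F --> set_val chi.
  apply: ptws_cvg => [|x]; first exact: (0 : R[i]).
  rewrite -[set_val chi x]/(spec_eval chi x) (tau_ev q_lt1 chi).2 /ev.
  have -> : (fun g : S2base q r -> R[i]^o => g x) @ (set_val @ F) =
      (fun psi => (poly_of x).[(tau psi)%:C] : R[i]^o) @ F.
    congr (_ @ F); apply/funext => psi /=.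
    by rewrite -[LHS]/(spec_eval psi x) (tau_ev q_lt1 psi).2.
  exact: (cvg_comp tau (fun s : R => (poly_of x).[s%:C] : R[i]^o) h
    (@continuous_cpoly (poly_of x) (tau chi))).
by move=> /(_ B); apply; apply: open_nbhs_nbhs.
Qed.


Lemma fpoly_gt0E t : (0 < (fpoly r).[t]) = (tm < t < tp).
Proof.
apply/idP/idP => [h|]; last exact: fpoly_gt0.
have := ltW h; rewrite fpoly_ge0 !le_eqVlt => /andP[/orP[/eqP e|->]].
  by rewrite -e fpoly_tm ltxx in h.
by case/orP => [/eqP e|->//]; rewrite e fpoly_tp ltxx in h.
Qed.

(** Turns membership in D_n into a closed condition on t; [spec_setQn_lt] turns it into an open one.
    So D_n is clopen and extension by zero preserves continuity. *)
Lemma spec_setQn n t : K t -> K (Q ^ n * t) <-> tm <= Q ^ n * t <= tp.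
Proof.
move=> Kt; split=> [|]; first exact: spec_set_bounds.
case: n => k.
  move=> _; elim: k => [|k IH]; first by rewrite mul1r.
  by rewrite -exprnP [Q ^+ k.+1]exprS -mulrA; exact: spec_set_Q.
rewrite NegzE -exprnN; elim: k.+1 => [|m IH]; first by rewrite expr0 invr1 mul1r.
set s := Q ^- m.+1 * t => hs.
have Qs : Q ^- m * t = Q * s.
  by rewrite /s [Q ^+ m.+1]exprS invfM -[_ / _ * t]mulrA mulVKf.
have Ks : K (Q * s).
  rewrite -Qs; apply: IH; rewrite Qs.
  by have := fpoly_Q_gt0 q_lt1 hs; rewrite fpoly_gt0E => /andP[/ltW -> /ltW ->].
have f0 : (fpoly r).[Q * s] != 0 by rewrite gt_eqF // fpoly_Q_gt0.
by have := (spec_set_invQ q_lt1 Ks).1 f0; rewrite mulKf.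
Qed.

(** One more factor Q replaces the closed interval by the open one, on which f is positive; a point
    of K where f does not vanish can be divided by Q within K. *)
Lemma spec_setQn_lt n t : K t -> K (Q ^ n * t) <-> tm < Q ^ (n + 1) * t < tp.
Proof.
move=> Kt; rewrite addrC expfzDr // expr1z -mulrA.
split=> [/(spec_set_bounds q_lt1) h|h].
  by rewrite -fpoly_gt0E; exact: fpoly_Q_gt0.
have KQ : K (Q * (Q ^ n * t)).
  move: h; rewrite mulrA -[X in X * _ ^ _]expr1z -expfzDr // => /andP[h1 h2].
  by apply/spec_setQn => //; rewrite !ltW.
have f0 : (fpoly r).[Q * (Q ^ n * t)] != 0 by rewrite gt_eqF // fpoly_gt0E.
by have := (spec_set_invQ q_lt1 KQ).1 f0; rewrite mulKf.
Qed.

Lemma cvgQ_tau n (chi : X) : (fun psi : X => Q ^ n * tau psi) @ chi --> Q ^ n * tau chi.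
Proof. exact: (cvgM (cvg_cst _) (@tau_continuous chi)). Qed.

Lemma near_spec_set n (chi : X) : K (Q ^ n * tau chi) ->
  \forall psi \near chi, K (Q ^ n * tau psi).
Proof.
move=> /(spec_setQn_lt n (tau_ev q_lt1 chi).1)/andP[h1 h2].
have /(_ (nbhs_filter chi)) a1 := cvgr_gt _ (@cvgQ_tau (n + 1) chi) _ h1.
have /(_ (nbhs_filter chi)) a2 := cvgr_lt _ (@cvgQ_tau (n + 1) chi) _ h2.
apply: filterS2 a2 a1 => psi h3 h4; apply/spec_setQn_lt; first exact: (tau_ev q_lt1 psi).1.
by rewrite h3 h4.
Qed.

Lemma near_spec_setN n (chi : X) : ~ K (Q ^ n * tau chi) ->
  \forall psi \near chi, ~ K (Q ^ n * tau psi).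
Proof.
have E psi := spec_setQn n (tau_ev q_lt1 psi).1.
move=> /E/negP; rewrite negb_and -!ltNge => /orP[h|h].
  have /(_ (nbhs_filter chi)) := cvgr_lt _ (@cvgQ_tau n chi) _ h.
  by apply: filterS => psi h' /E/andP[]; rewrite leNgt h'.
have /(_ (nbhs_filter chi)) := cvgr_gt _ (@cvgQ_tau n chi) _ h.
by apply: filterS => psi h' /E/andP[_]; rewrite leNgt h'.
Qed.

Definition spec_shift (n : int) (chi : X) : X := pt (Q ^ n * tau chi).

Lemma shift_cvg n (chi : X) : K (Q ^ n * tau chi) -> spec_shift n @ chi --> spec_shift n chi.
Proof.
move=> h; apply: cvg_tau; first exact: fmap_filter (nbhs_filter chi).
rewrite [tau (spec_shift n chi)]tau_pt //.
apply: cvg_trans (@cvgQ_tau n chi).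
apply: (@near_eq_cvg X R (nbhs chi) (nbhs_filter chi) (fun psi => Q ^ n * tau psi)
  (fun psi => tau (spec_shift n psi))).
by apply: filterS (near_spec_set h) => psi Kp; rewrite tau_pt.
Qed.

(** beta_n extended by zero to all of C(K), so that additivity and multiplicativity hold for every
    argument. *)
Definition dual_ext_fun (n : int) (g : Cfun R X) (chi : X) : R[i] :=
  if pselect (K (Q ^ n * tau chi)) then g (spec_shift n chi) else 0.

Lemma ext_cont n g : dual_ext_fun n g \in @cont_pred R X.
Proof.
apply/contP; split; last first.
  have [M hM] := cont_bound g; exists (Num.max M 0) => chi.
  by rewrite /dual_ext_fun le_max; case: pselect => h /=; rewrite ?hM // cmod0 lexx orbT.
apply/contE => chi e e0; rewrite /dual_ext_fun; case: (pselect (K _)) => [h|h] /=.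
  have := shift_cvg h; have /contE/(_ (spec_shift n chi) e e0) := @cont_continuous R X g.
  move=> h1 h2; have := h2 _ h1; apply: filterS2 (near_spec_set h) => psi Kp h3.
  by case: pselect => //=.
apply: filterS (near_spec_setN h) => psi Kp; case: pselect => // h' /=.
by rewrite subrr cmod0.
Qed.
Definition dual_ext n g : Cfun R X := Cont (ext_cont n g).

Lemma extE n g chi : K (Q ^ n * tau chi) -> dual_ext n g chi = g (spec_shift n chi).
Proof. by move=> h; rewrite /= /dual_ext_fun; case: pselect => //=. Qed.

Lemma ext0 n g chi : ~ K (Q ^ n * tau chi) -> dual_ext n g chi = 0.
Proof. by move=> h; rewrite /= /dual_ext_fun; case: pselect => //=. Qed.

Lemma shift_alpha n (chi : X) : alpha_dom n chi -> alpha (- n) chi = spec_shift n chi.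
Proof.
move=> h; apply: (tau_inj q_lt1); rewrite tau_pt; last exact/(alpha_domP q_lt1).
by rewrite (tau_alpha q_lt1) opprK.
Qed.

(** As D_n is clopen, the function sought by [xget] exists for every g; it is unique because its
    values are prescribed both on and off D_n. *)
Lemma dual_actE n g : dual_act n g = dual_ext n g.
Proof.
rewrite /dual_act; set P := (X in xget _ X).
have : P (dual_ext n g).
  split=> chi h; first by rewrite ext0 // => /(alpha_domP q_lt1).
  by rewrite extE ?shift_alpha //; exact/(alpha_domP q_lt1).
move=> /(xgetI 0) [d e]; apply: cont_eq => chi.
have [h|h] := pselect (alpha_dom n chi).
  by rewrite e // extE ?shift_alpha //; exact/(alpha_domP q_lt1).
by rewrite d // ext0 // => /(alpha_domP q_lt1).
Qed.

(** K is bounded and, by [spec_setP], cut out by closed polynomial inequalities; the spectrum is its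
    continuous image under [pt]. *)
Lemma S2spec_compact : compact [set: X].
Proof.
have Kc : compact K.
  apply: (subclosed_compact _ (@segment_compact R tm tp)); last first.
    by move=> t /(spec_set_bounds q_lt1); rewrite /= in_itv.
  have -> : K = \bigcap_(k in [set: nat]) [set t | 0 <= weight q r k t].
    apply/seteqP; split=> t.
      by move=> /(spec_setP _ q_lt1) h k _; exact: h.
    by move=> h; apply/(spec_setP _ q_lt1) => k; exact: h.
  apply: closed_bigI => k _.
  have [g _ gw] := bpow_weight q r k.
  have -> : [set t | 0 <= weight q r k t] = horner g @^-1` [set x | 0 <= x].
    by apply/seteqP; split=> t /=; rewrite gw.
  apply: closed_comp; last exact: closed_ge.
  by move=> t _; exact: continuous_horner.
have -> : [set: X] = pt @` K.
  apply/seteqP; split=> // chi _; exists (tau chi); last exact: pt_tau.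
  exact: (tau_ev q_lt1 chi).1.
apply: continuous_compact Kc; rewrite continuous_subspace_in => t /set_mem Kt.
have h : pt @ within K (nbhs t) --> pt t.
  apply: cvg_tau.
  rewrite [tau (pt t)]tau_pt //.
  apply: (@cvg_trans _ ((fun s : R => s) @ within K (nbhs t))); last exact: cvg_within.
  apply: (@near_eq_cvg R R (within K (nbhs t)) (within_filter _ (nbhs_filter t))).
  by rewrite near_withinE; apply: nearW => s Ks; rewrite tau_pt.
move=> U /h; rewrite /= !nbhs_simpl /= => hU.
by move: hU; rewrite (nbhs_subspace_in Kt).
Qed.

End SpectrumTopology.

(** * The dual partial action *)

Lemma same_paction_is_paction (R : realType) (B : cstarAlgType R) (P P' : pa_data B) :
  same_paction P P' -> (forall x, pa_act P 0 x = x) -> is_paction P' -> is_paction P.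
Proof.
move=> [ed ea] a0 [d0' a0' i' h' c']; split=> //.
- by rewrite ed.
- by move=> n; rewrite ed.
- move=> n; have [b D Z M S] := h' n; rewrite !ed.
  have e x : pa_dom P' (- n) x -> pa_act P n x = pa_act P' n x.
    by rewrite -ed; exact: ea.
  have i := i' (- n); split.
  + have [b1 b2 b3] := b; split.
    * by move=> x hx; rewrite e //; exact: b1.
    * move=> x y hx hy; rewrite !e; [exact: b2|exact/set_mem|exact/set_mem].
    * by move=> y /b3[x hx <-]; exists x => //; exact: e.
  + by move=> x y hx hy; rewrite !e ?D //; exact: (idealD i).
  + move=> c x hx; rewrite !e ?Z // -mulr_algl; exact: (idealMl i).
  + by move=> x y hx hy; rewrite !e ?M //; exact: (idealMl i).
  + by move=> x hx; rewrite !e ?S //; exact: (ideal_star i).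
- move=> m n x; rewrite !ed => hx; rewrite ea ?ed // => hy.
  have [h1 h2] := c' m n x hx hy; split=> //.
  by rewrite !ea ?ed.
Qed.

Section DualAction.
Variables (R : realType) (q r : {posnum R}).
Hypothesis q_lt1 : q%:num < 1.
Local Notation X := (S2spec q r).
Local Notation Q := (q%:num ^+ 2).
Local Notation K := (spec_set q r).
Local Notation tau := (@spec_tau R q r).
Local Notation shift := (spec_shift q_lt1).
Local Notation ext := (dual_ext q_lt1).
Implicit Types (g h : Cfun R X) (chi : X).


Let Ktau chi : K (tau chi) := (tau_ev q_lt1 chi).1.

Lemma QnD m n (t : R) : Q ^ (m + n) * t = Q ^ n * (Q ^ m * t).
Proof. by rewrite expfzDr // mulrA [Q ^ n * _]mulrC. Qed.

Lemma tau_shift n chi : K (Q ^ n * tau chi) -> tau (shift n chi) = Q ^ n * tau chi.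
Proof. by move=> h; rewrite /shift tau_pt. Qed.

Lemma spec_shift0 chi : shift 0 chi = chi.
Proof. by rewrite /shift expr0z mul1r pt_tau. Qed.

Lemma spec_shiftD m n chi : K (Q ^ m * tau chi) -> shift n (shift m chi) = shift (m + n) chi.
Proof. by move=> h; rewrite {1}/shift tau_shift // -QnD. Qed.

Lemma spec_set_pos (k : nat) t : K t -> K (Q ^ k * t).
Proof.
move=> Kt; elim: k => [|k IH]; first by rewrite mul1r.
by rewrite -exprnP [Q ^+ k.+1]exprS -mulrA; exact: spec_set_Q.
Qed.

(** The hypothesis says that D_{m+n} lies in D_m; without it the composite may vanish where the
    right side does not. *)
Lemma ext_ext m n g : (forall t, K t -> K (Q ^ (m + n) * t) -> K (Q ^ m * t)) ->
  ext m (ext n g) = ext (m + n) g.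
Proof.
move=> hK; apply: cont_eq => chi.
have [h|h] := pselect (K (Q ^ m * tau chi)); last first.
  by rewrite !ext0 // => k; apply: h; exact: hK (Ktau _) k.
rewrite extE //; have [h'|h'] := pselect (K (Q ^ (m + n) * tau chi)).
  by rewrite extE ?tau_shift // -?QnD // spec_shiftD // extE.
by rewrite !ext0 // tau_shift // -QnD.
Qed.

Lemma ext_pos (m : nat) n g : ext m (ext n g) = ext (m%:Z + n) g.
Proof. by apply: ext_ext => t Kt _; exact: spec_set_pos. Qed.

Lemma ext_neg m (n : nat) g : ext m (ext (- n%:Z) g) = ext (m - n%:Z) g.
Proof.
apply: ext_ext => t Kt /(spec_set_pos n).
by rewrite -QnD subrK.
Qed.

Lemma ext_0 g : ext 0 g = g.
Proof.
apply: cont_eq => chi; rewrite extE ?spec_shift0 //.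
by rewrite expr0z mul1r.
Qed.

Lemma extD n g h : ext n (g + h) = ext n g + ext n h.
Proof.
apply: cont_eq => chi; rewrite -[RHS]/(ext n g chi + ext n h chi).
have [k|k] := pselect (K (Q ^ n * tau chi)); first by rewrite !extE.
by rewrite !ext0 // addr0.
Qed.

Lemma extZ n (c : R[i]) g : ext n (c *: g) = c *: ext n g.
Proof.
apply: cont_eq => chi; rewrite -[RHS]/(c * ext n g chi).
have [k|k] := pselect (K (Q ^ n * tau chi)); first by rewrite !extE.
by rewrite !ext0 // mulr0.
Qed.

Lemma extM n g h : ext n (g * h) = ext n g * ext n h.
Proof.
apply: cont_eq => chi; rewrite -[RHS]/(ext n g chi * ext n h chi).
have [k|k] := pselect (K (Q ^ n * tau chi)); first by rewrite !extE.
by rewrite !ext0 // mulr0.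
Qed.

Lemma ext_star n g : ext n (star g) = star (ext n g).
Proof.
apply: cont_eq => chi; rewrite -[RHS]/((ext n g chi)^*%R).
have [k|k] := pselect (K (Q ^ n * tau chi)); first by rewrite !extE.
by rewrite !ext0 // conjC0.
Qed.

Lemma ext_norm n g : cnorm (ext n g) <= cnorm g.
Proof.
apply: cont_norm_le => chi.
have [k|k] := pselect (K (Q ^ n * tau chi)).
  by rewrite extE // cont_norm_ub.
by rewrite ext0 // cmod0 cont_norm_ge0.
Qed.

Lemma dual_domP n g : dual_dom n g <-> forall chi, ~ K (Q ^ n * tau chi) -> g chi = 0.
Proof. by split=> h chi hc; apply: h => /(alpha_domP q_lt1). Qed.

Lemma ext_dom n g : dual_dom n (ext n g).
Proof. by apply/dual_domP => chi; exact: ext0. Qed.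

Lemma dual_dom_pos (k : nat) g : dual_dom k g.
Proof. by apply/dual_domP => chi; case; exact: spec_set_pos. Qed.

Lemma extK n g : dual_dom (- n) g -> ext (- n) (ext n g) = g.
Proof.
move=> /dual_domP d; apply: cont_eq => chi.
have [h|h] := pselect (K (Q ^ (- n) * tau chi)); last by rewrite ext0 // d.
rewrite extE // extE; last by rewrite tau_shift // -QnD addNr expr0z mul1r.
by rewrite spec_shiftD // addNr spec_shift0.
Qed.

Lemma dual_is_paction : is_paction (dual_paction q r).
Proof.
split=> /=.
- by rewrite -subTset => g _; exact: (@dual_dom_pos 0%N g).
- by move=> g; rewrite (dual_actE q_lt1) ext_0.
- move=> n; split.
  + by move=> chi.
  + by move=> g h hg hh chi hc; rewrite -[LHS]/(g chi + h chi) hg // hh // addr0.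
  + by move=> g h hh chi hc; rewrite -[LHS]/(g chi * h chi) hh // mulr0.
  + by move=> g h hg chi hc; rewrite -[LHS]/(g chi * h chi) hg // mul0r.
  + by move=> g hg chi hc; rewrite -[LHS]/((g chi)^*%R) hg // conjC0.
  + move=> u l hu /(tendsP (cnorm_group _)) ul chi hc.
    apply: cmod_eq0; apply/eqP; rewrite eq_le cmod_ge0 andbT.
    apply/ler_addgt0Pr => e e0; rewrite add0r; have [k hk] := ul e e0.
    apply: le_trans (ltW (hk k (leqnn k))); rewrite -cmodN.
    have := cont_norm_ub (u k - l) chi; rewrite -[cont_fun _ _]/(u k chi - l chi).
    by rewrite (hu k chi hc) sub0r.
- move=> n; have -> : @dual_act R q r n = ext n by apply: funext => g; exact: dual_actE.
  split; last first.
  + by move=> g _; exact: ext_star.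
  + by move=> g h _ _; exact: extM.
  + by move=> c g _; exact: extZ.
  + by move=> g h _ _; exact: extD.
  split.
  + by move=> g _; exact: ext_dom.
  + move=> g h; rewrite !inE => hg hh e.
    by rewrite -(extK hg) e extK.
  + move=> g hg; exists (ext (- n) g); first exact: ext_dom.
    by rewrite -{1}[n]opprK extK // opprK.
(* A point off D_{-(m+n)} is either off D_{-n}, where g vanishes, or is shifted by -n to a point off
   D_{-m}, where [ext n g] vanishes. *)
- move=> m n g; rewrite !(dual_actE q_lt1) => /dual_domP h1 /dual_domP h2.
  have h3 chi : ~ K (Q ^ (- (m + n)) * tau chi) -> g chi = 0.
    move=> hc; have [h|h] := pselect (K (Q ^ (- n) * tau chi)); last exact: h1.
    have := h2 (shift (- n) chi); rewrite tau_shift // -QnD.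
    have -> : - n - m = - (m + n) by rewrite opprD addrC.
    move=> /(_ hc); rewrite extE; last by rewrite tau_shift // -QnD addNr expr0z mul1r.
    by rewrite spec_shiftD // addNr spec_shift0.
  split; first exact/dual_domP.
  apply: cont_eq => chi; have [h|h] := pselect (K (Q ^ m * tau chi)).
    rewrite [RHS]extE //; have [h'|h'] := pselect (K (Q ^ (m + n) * tau chi)).
      by rewrite extE // extE ?tau_shift -?QnD // spec_shiftD.
    by rewrite !ext0 // tau_shift // -QnD.
  rewrite [RHS]ext0 //; have [h'|h'] := pselect (K (Q ^ (m + n) * tau chi)); last first.
    by rewrite ext0.
  rewrite extE //; apply: h1; rewrite tau_shift // -QnD.
  by rewrite addrK.
Qed.

Lemma theta_is_pauto : is_pauto (S2theta q r).
Proof. by have [_ _ i h _] := dual_is_paction; split; [exact: i|exact: i|exact: h]. Qed.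

Lemma theta_setT : pauto_J (S2theta q r) = setT.
Proof. by rewrite -subTset => g _; exact: (@dual_dom_pos 1%N g). Qed.

Local Notation theta_pinv :=
  ('pinv_(fun=> 0) (pauto_I (S2theta q r)) (pauto_theta (S2theta q r))).

(** [ext (-1)] takes values in I and is a right inverse of theta on J, which is the whole algebra;
    injectivity of theta on I identifies it with the partial inverse. *)
Lemma theta_pinvE g : theta_pinv g = ext (-1) g.
Proof.
have {1}-> : g = pauto_theta (S2theta q r) (ext (-1) g).
  have d : dual_dom (- -1) g by rewrite opprK; exact: (@dual_dom_pos 1%N g).
  by rewrite /= (dual_actE q_lt1); exact/esym/(extK d).
have [[_ inj _] _ _ _ _] := pauto_iso theta_is_pauto.
have := @pinvKV _ _ (fun=> 0) _ _ inj (ext (-1) g); apply; rewrite inE; exact: ext_dom.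
Qed.

Lemma iter_theta (m : nat) g : iter m (pauto_theta (S2theta q r)) g = ext m g.
Proof.
elim: m => [|m IH]; first by rewrite ext_0.
by rewrite iterS IH /= (dual_actE q_lt1) (ext_pos 1).
Qed.

Lemma iter_theta_pinv (m : nat) g : iter m theta_pinv g = ext (- m%:Z) g.
Proof.
elim: m => [|m IH]; first by rewrite ext_0.
by rewrite iterS IH theta_pinvE ext_neg -opprD.
Qed.

Lemma theta_posdom (m : nat) : pauto_posdom (S2theta q r) m = setT.
Proof.
elim: m => // m IH; rewrite -subTset => g _ /=; rewrite IH; split=> //.
exact: (@dual_dom_pos 1%N g).
Qed.

Lemma theta_negdom (m : nat) : pauto_negdom (S2theta q r) m = dual_dom (- m%:Z).
Proof.
elim: m => [|m IH].
  apply/seteqP; split=> // g _; exact: (@dual_dom_pos 0%N g).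
have QS (t : R) : Q ^ (- m.+1%:Z) * t = Q ^ (- m%:Z) * (Q ^ (-1) * t).
  by rewrite -QnD -opprD.
apply/seteqP; split=> g /=; rewrite IH (dual_actE q_lt1).
  move=> [/dual_domP h1 /dual_domP h2]; apply/dual_domP => chi; rewrite QS => hc.
  have [h|h] := pselect (K (Q ^ (-1) * tau chi)); last exact: h1.
  have e : spec_shift q_lt1 1 (shift (-1) chi) = chi.
    by rewrite spec_shiftD // addNr spec_shift0.
  have := h2 (shift (-1) chi); rewrite tau_shift // => /(_ hc).
  by rewrite extE ?e // tau_shift // -QnD addNr expr0z mul1r.
move=> /dual_domP h; split; apply/dual_domP => chi hc.
  apply: h => k; apply: hc; move: k; rewrite QS => /(spec_set_pos m).
  by rewrite -QnD addNr expr0z mul1r.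
have K1 : K (Q ^ 1 * tau chi) by apply: (@spec_set_pos 1).
rewrite extE //; apply: h; rewrite QS tau_shift // -[Q ^ (-1) * _]QnD.
by rewrite subrr expr0z mul1r.
Qed.

Lemma same_theta : same_paction (pa_of_pauto (S2theta q r)) (dual_paction q r).
Proof.
split=> [[m|m]|[m|m] g _] /=.
- by rewrite theta_posdom; apply/esym; rewrite -subTset => g _; exact: dual_dom_pos.
- by rewrite -[LHS]/(pauto_negdom (S2theta q r) m.+1) theta_negdom NegzE.
- by rewrite iter_theta (dual_actE q_lt1).
- by rewrite -iterS iter_theta_pinv (dual_actE q_lt1) NegzE.
Qed.

Lemma theta_is_paction : is_paction (pa_of_pauto (S2theta q r)).
Proof. exact: same_paction_is_paction same_theta _ dual_is_paction. Qed.

End DualAction.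

(** * Density of the polynomials *)

Section Density.
Variables (R : realType) (q r : {posnum R}).
Hypothesis q_lt1 : q%:num < 1.
Local Notation X := (S2spec q r).
Local Notation Q := (q%:num ^+ 2).
Local Notation tp := (tplus r).
Local Notation tm := (tminus r).
Local Notation K := (spec_set q r).
Local Notation tau := (@spec_tau R q r).
Local Notation pt := (spec_pt r q_lt1).
Local Notation ext := (dual_ext q_lt1).
Local Notation cpoly := (map_poly (real_complex R)).
Implicit Types (g h : Cfun R X) (chi : X) (p : {poly R[i]}).

Let Q_gt0 : 0 < Q. Proof. by rewrite exprn_gt0. Qed.
Let Q_lt1 : Q < 1. Proof. by rewrite expr_lt1. Qed.
Let Ktau chi : K (tau chi) := (tau_ev q_lt1 chi).1.

Lemma ctau_cont : (fun chi : X => (tau chi)%:C) \in @cont_pred R X.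
Proof.
apply: compact_cont; first exact: S2spec_compact.
move=> chi.
(* Evaluation of the polynomial 'X serves as the continuous embedding of R into the complex
   numbers. *)
have := cvg_comp tau (fun s : R => ('X : {poly R[i]}).[s%:C] : R[i]^o)
  (@tau_continuous _ _ _ chi) (@continuous_cpoly _ 'X (tau chi)).
rewrite hornerX.
by under eq_fun do rewrite hornerX.
Qed.
Definition ctau : Cfun R X := Cont ctau_cont.
Definition polyc p : Cfun R X := horner_alg ctau p.

Lemma polycE p chi : polyc p chi = p.[(tau chi)%:C].
Proof.
rewrite /polyc; elim/poly_ind: p => [|p c IH]; first by rewrite rmorph0 horner0.
rewrite rmorphD rmorphM /= horner_algX horner_algC hornerMXaddC -IH.
by rewrite -[LHS]/(_ * (tau chi)%:C + c * 1) mulr1.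
Qed.

Definition gelfand (x : S2base q r) : Cfun R X := polyc (poly_of x).

Lemma gelfandE x chi : gelfand x chi = spec_eval chi x.
Proof. by rewrite /gelfand polycE (tau_ev q_lt1 chi).2. Qed.

Lemma gelfand_s2base p : gelfand (s2base q r p) = polyc p.
Proof. by rewrite /gelfand poly_ofK. Qed.

Lemma gelfand_star_hom : star_hom gelfand.
Proof.
have E x chi : gelfand x chi = ev (tau chi) x by rewrite gelfandE (tau_ev q_lt1 chi).2.
have ch chi := ev_character r q_lt1 (tau chi).
split=> [x y|c x|x y||x]; apply: cont_eq => chi.
- by rewrite E; have [-> _ _ _ _] := ch chi; rewrite -!E.
- by rewrite E; have [_ -> _ _ _] := ch chi; rewrite -!E.
- by rewrite E; have [_ _ -> _ _] := ch chi; rewrite -!E.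
- by rewrite E /ev poly_of1 // hornerC.
- by rewrite E; have [_ _ _ -> _] := ch chi; rewrite -!E.
Qed.

Local Notation poly_limit := (in_closure gelfand).

Lemma poly_limit_polyc p : poly_limit (polyc p).
Proof. by rewrite -gelfand_s2base; exact: in_closure_range. Qed.

Lemma ext1E n chi : K (Q ^ n * tau chi) -> ext n 1 chi = 1.
Proof. by move=> h; rewrite extE. Qed.

(* The indicator function of D_{-1}, the set where [fpoly r] does not vanish. *)
Local Notation e := (ext (-1) 1).

Lemma QN1 (t : R) : Q ^ (-1) * t = Q^-1 * t. Proof. by rewrite exprN1. Qed.

(** On D_{-1} one has c <= f <= C, so (1 - f/C)^n tends to 0 uniformly there; off D_{-1} f is 0 and
    the power stays 1. *)
Lemma poly_limit_dom : poly_limit e.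
Proof.
pose f := fpoly r; pose C : R := 4^-1 + r%:num; pose c := (1 - Q) ^+ 2 * r%:num.
have rp : 0 < r%:num by [].
have C0 : 0 < C by rewrite addr_gt0 ?invr_gt0.
have Q1 : 0 < 1 - Q by rewrite subr_gt0.
have c0 : 0 < c by rewrite mulr_gt0 ?exprn_gt0.
have fC t : f.[t] <= C.
  by rewrite fpoly_horner /C; have := sqr_ge0 (t - 2^-1); rewrite !expr2; lra.
have cC : c <= C.
  have : (1 - Q) ^+ 2 <= 1 by rewrite expr_le1 // ?lerBlDr ?lerDl ltW.
  by rewrite /c /C -(ler_pM2r rp) mul1r; have : 0 < 4^-1 :> R by []; lra.
(* With t = Qs one has t_+ - t >= (1 - Q) t_+ and t - t_- >= (1 - Q) (- t_-); the product of the two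
   bounds is c because t_+ t_- = - r. *)
have fc t : K (Q^-1 * t) -> c <= f.[t].
  move=> /(spec_set_bounds q_lt1); set s := Q^-1 * t => /andP[h1 h2].
  have -> : t = Q * s by rewrite /s mulVKf.
  rewrite fpoly_factor /c; have := tplusMtminus r; have := tplus_gt0 r; have := tminus_lt0 r.
  have a1 : Q * s <= Q * tp by rewrite ler_pM2l.
  have a2 : Q * tm <= Q * s by rewrite ler_pM2l.
  move: (Q * s) a1 a2 => y a1 a2 m0 p0 e; have -> : r%:num = - (tp * tm) by rewrite e opprK.
  have b1 : (1 - Q) * tp <= tp - y by lra.
  have b2 : (1 - Q) * (- tm) <= y - tm by lra.
  have -> : (1 - Q) ^+ 2 * (- (tp * tm)) = ((1 - Q) * tp) * ((1 - Q) * (- tm)).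
    by move: (1 - Q) (tp) (tm) => a u v; ring.
  by apply: ler_pM => //; rewrite mulr_ge0 ?oppr_ge0 // ltW.
pose rho := 1 - c / C.
have rho0 : 0 <= rho by rewrite subr_ge0 ler_pdivrMr // mul1r.
have rho1 : rho < 1 by rewrite ltrBlDr ltrDl divr_gt0.
move=> eps eps0.
have [n hn] : exists n : nat, rho ^+ n < eps.
  have h : GRing.exp rho @ \oo --> (0 : R).
    by apply: cvg_expr; rewrite ger0_norm.
  have [n /(_ n (leqnn n)) ?] := (cvg0P (fun n => exprn_ge0 n rho0)).1 h eps eps0.
  by exists n.
exists (s2base q r (1 - (cpoly (1 - C^-1 *: f)) ^+ n)); rewrite gelfand_s2base.
apply: le_lt_trans hn; apply: cont_norm_le => chi.
have -> : (e - polyc (1 - cpoly (1 - C^-1 *: f) ^+ n)) chi =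
    e chi - (1 - ((1 - C^-1 * f.[tau chi])%:C) ^+ n).
  rewrite -[LHS]/(e chi - polyc _ chi) polycE hornerD hornerN horner_exp horner_map /= !hornerE.
  by [].
have [h|h] := pselect (K (Q ^ (-1) * tau chi)).
  rewrite ext1E // opprB addrC subrK -rmorphXn /= cmod_real.
  have := fc (tau chi); rewrite -QN1 => /(_ h) h'.
  have u0 : 0 <= 1 - C^-1 * f.[tau chi].
    rewrite subr_ge0 mulrC ler_pdivrMr // mul1r; exact: fC.
  rewrite ger0_norm ?exprn_ge0 ?lerXn2r ?nnegrE //.
  by rewrite /rho lerD2l lerN2 mulrC ler_pM2l ?invr_gt0.
have f0 : f.[tau chi] = 0.
  by apply/eqP/negPn/negP => /(spec_set_invQ q_lt1 (Ktau chi)); rewrite -QN1.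
by rewrite ext0 // f0 mulr0 subr0 expr1n subrr subr0 cmod0 exprn_ge0.
Qed.

Lemma ext_polyc n p : ext n (polyc p) = ext n 1 * polyc (dilate (Q ^ n) p).
Proof.
apply: cont_eq => chi; rewrite -[RHS]/(ext n 1 chi * _).
have [h|h] := pselect (K (Q ^ n * tau chi)); last by rewrite !ext0 // mul0r.
by rewrite ext1E // extE // mul1r !polycE tau_shift // horner_dilate.
Qed.

Lemma extB n g h : ext n (g - h) = ext n g - ext n h.
Proof. by rewrite extD -scaleN1r extZ scaleN1r. Qed.

Lemma poly_limit_ext g : poly_limit g -> poly_limit (ext (-1) g).
Proof.
move=> hg; apply: in_closure_closed => eps /hg[x hx].
exists (ext (-1) (gelfand x)); last by rewrite -extB (le_lt_trans (ext_norm _ _ _)).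
rewrite ext_polyc; apply: (in_closureM gelfand_star_hom) poly_limit_dom _; exact: poly_limit_polyc.
Qed.

Lemma ext_decomp g : g = (1 - e) * g + ext (-1) (ext 1 g).
Proof.
apply: cont_eq => chi; rewrite -[RHS]/((1 - e chi) * g chi + ext (-1) (ext 1 g) chi).
have [h|h] := pselect (K (Q ^ (-1) * tau chi)); last first.
  by rewrite !ext0 // subr0 mul1r addr0.
rewrite ext1E // subrr mul0r add0r extE // extE.
  by rewrite spec_shiftD // addNr spec_shift0.
by rewrite tau_shift // -QnD addNr expr0z mul1r.
Qed.

(* Off D_{-1} there are only two points, so linear interpolation suffices. *)
Lemma poly_limit_compl g : poly_limit ((1 - e) * g).
Proof.
have tpm : tp - tm != 0 by rewrite gt_eqF // subr_gt0 (lt_trans (tminus_lt0 r)) ?tplus_gt0.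
pose l : {poly R[i]} := ((tp - tm)^-1)%:C *:
  (g (pt tp) *: ('X - (tm%:C)%:P) + g (pt tm) *: ((tp%:C)%:P - 'X)).
have -> : (1 - e) * g = (1 - e) * polyc l.
  apply: cont_eq => chi; rewrite -[RHS]/((1 - e chi) * polyc l chi).
  rewrite -[LHS]/((1 - e chi) * g chi).
  have [h|h] := pselect (K (Q ^ (-1) * tau chi)).
    by rewrite ext1E // subrr !mul0r.
  rewrite ext0 // subr0 !mul1r polycE /l !hornerE -{1}(pt_tau q_lt1 chi).
  have f0 : (fpoly r).[tau chi] = 0.
    by apply/eqP/negPn/negP => /(spec_set_invQ q_lt1 (Ktau chi)); rewrite -QN1.
  have cV : ((tp - tm)^-1)%:C * (tp%:C - tm%:C) = 1 :> R[i].
    by rewrite -rmorphB -rmorphM /= mulVf.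
  move/eqP: f0; rewrite fpoly_factor mulf_eq0 !subr_eq0 => /orP[/eqP <-|/eqP ->].
    by rewrite subrr mulr0 addr0 mulrCA cV mulr1.
  by rewrite subrr mulr0 add0r mulrCA cV mulr1.
apply: (in_closureM gelfand_star_hom) (poly_limit_polyc _); apply: (in_closureB gelfand_star_hom) poly_limit_dom.
have -> : 1 = polyc 1 by rewrite /polyc rmorph1.
exact: poly_limit_polyc.
Qed.

(** By [ext_decomp], g is a part off D_{-1}, itself a limit of polynomials, plus [ext (-1)] of
    [ext 1 g]. As [ext (-1)] is a contraction preserving such limits, an approximation of [ext 1 g]
    yields one of g with no larger error. *)
Lemma poly_limit_step (m : nat) g h eps : poly_limit h -> cnorm (ext m g - h) < eps ->
  exists2 h', poly_limit h' & cnorm (g - h') < eps.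
Proof.
elim: m h g => [|m IH] h g hh; first by rewrite ext_0; exists h.
have -> : ext m.+1 g = ext m (ext 1 g) by rewrite ext_pos addrC.
case/(IH _ _ hh) => h' hh' gh'; exists ((1 - e) * g + ext (-1) h').
  apply: (in_closureD gelfand_star_hom); [exact: poly_limit_compl|exact: poly_limit_ext].
rewrite {1}(ext_decomp g) opprD addrACA subrr add0r -extB.
exact: le_lt_trans (ext_norm _ _ _) gh'.
Qed.

Lemma near_zero g (eps : R) : 0 < eps ->
  exists2 d : R, 0 < d & forall chi, `|tau chi| < d -> cmod (g chi - g (pt 0)) < eps.
Proof.
move=> eps0; pose F := filter_from [set d : R | 0 < d] (fun d => [set chi : X | `|tau chi| < d]).
have FF : Filter F.
  apply: filter_from_filter; first by exists 1 => /=.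
  move=> d d' /= d0 d0'; exists (Num.min d d'); first by rewrite /= lt_min d0.
  by move=> chi /=; rewrite lt_min => /andP[].
have K0 : K 0 by left.
have /(_ _)/[!nbhs_simpl] h : F --> pt 0.
  apply: (cvg_tau q_lt1 FF); rewrite (tau_pt q_lt1 K0).
  apply: (proj2 (@cvgrPdist_lt R R X F FF tau 0)) => d d0.
  by exists d => // chi /=; rewrite sub0r normrN.
have /contE/(_ (pt 0) eps eps0)/h[d d0 hd] := @cont_continuous R X g.
by exists d => // chi /hd /=; rewrite cmodBC.
Qed.

(** For large m the function [ext m g] only sees values of g near 0 and is close to the constant
    g(0); [poly_limit_step] carries this approximation back to g. *)
Lemma gelfand_dense : dense_range gelfand.
Proof.
move=> g; apply: in_closure_closed => eps eps0; have e2 : 0 < eps / 2 by rewrite divr_gt0.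
have [d d0 hd] := near_zero g e2.
pose C := Num.max tp (- tm).
have C0 : 0 < C by rewrite lt_max tplus_gt0.
have tC chi : `|tau chi| <= C.
  have /(spec_set_bounds q_lt1)/andP[h1 h2] := Ktau chi.
  by rewrite ler_norml /C oppr_max opprK ge_min h1 orbT le_max h2.
have [m hm] : exists m : nat, Q ^+ m < d / C.
  have h : GRing.exp Q @ \oo --> (0 : R) by apply: cvg_expr; rewrite ger0_norm // ltW.
  have dC : 0 < d / C by rewrite divr_gt0.
  have [m /(_ m (leqnn m)) ?] := (cvg0P (fun n => exprn_ge0 n (ltW Q_gt0))).1 h _ dC.
  by exists m.
apply: (@poly_limit_step m g (polyc (g (pt 0))%:P)); first exact: poly_limit_polyc.
apply: (@le_lt_trans _ _ (eps / 2)); last by rewrite gtr_pMr // invf_lt1 // ltr1n.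
apply: cont_norm_le => chi; rewrite -[cont_fun _ _]/(ext m g chi - polyc _ chi).
have Km : K (Q ^ m * tau chi) by exact: spec_set_pos.
rewrite polycE hornerC extE //; apply/ltW/hd; rewrite tau_shift // normrM.
rewrite ger0_norm; last by rewrite -exprnP exprn_ge0 // ltW.
apply: le_lt_trans (ler_wpM2l _ (tC chi)) _; first by rewrite -exprnP exprn_ge0 // ltW.
by rewrite -ltr_pdivlMr // -exprnP.
Qed.

End Density.

(** * Characters as representations *)

Section ComplexLine.
Variable R : realType.

(* A separate carrier: the slot for completeness on R[i]^o is taken by the    *)
(* generic instance for real fields.                                          *)
Definition cline : Type := R[i]^o.
HB.instance Definition _ := NormedModule.copy cline R[i]^o.
HB.instance Definition _ := PointedUniform.copy cline R[i]^o.

Lemma cline_complete (F : set_system cline) : ProperFilter F -> cauchy F -> cvg F.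
Proof.
move=> FF /(@cauchyP R[i] R[i]^o) hF.
have /choice[u hu] (n : nat) : exists x : R[i]^o, F (ball x (n.+1%:R^-1 : R[i])).
  by apply: hF; rewrite invr_gt0.
have near (e : R) : 0 < e -> exists N : nat, forall n, (N <= n)%N -> F [set x | cmod (u n - x) < e].
  move=> e0; have [N _ hN] := near_infty_natSinv_lt (PosNum e0).
  exists N => n Nn; apply: filterS (hu n) => x /= hx.
  apply: lt_trans (hN n Nn); rewrite /= -ltcR -cmodE.
  by move: hx; rewrite -ball_normE /= rmorphV ?unitfE // rmorph_nat.
have [e e0|l hl] := complex_cauchy (u := u).
  have e2 : 0 < e / 2 by rewrite divr_gt0.
  have [N hN] := near _ e2; exists N => m n hm hn.
  have [x [h1 h2]] := filter_ex (filterI (hN _ hm) (hN _ hn)).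
  have -> : u m - u n = (u m - x) + (x - u n) by rewrite addrA subrK.
  by apply: le_lt_trans (cmodD _ _) _; rewrite [e]splitr ltrD // cmodBC.
apply/cvg_ex; exists l; apply/fcvgrPdist_lt => e e0.
have er : e = real_complex R (complex.Re e) by rewrite RRe_real // realE ltW.
move: e0; rewrite er ltcR; move: (complex.Re e) => {er}e e0.
have e2 : 0 < e / 2 by rewrite divr_gt0.
have [N hN] := near _ e2; have [M hM] := hl _ e2; pose n := maxn N M.
apply: filterS (hN n (leq_maxl _ _)) => x /= hx; rewrite cmodE ltcR.
have -> : l - x = - (u n - l) + (u n - x) by rewrite opprB addrA subrK.
apply: le_lt_trans (cmodD _ _) _; rewrite cmodN [e]splitr ltrD //.
exact/hM/leq_maxr.
Qed.

HB.instance Definition _ := Uniform_isComplete.Build cline cline_complete.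

Definition cdot (x y : cline) : R[i] := x * (y^*)%R.

Fact cdotDl y : zmod_morphism (cdot ^~ y).
Proof. by move=> u v; rewrite /cdot mulrBl. Qed.
Fact cdotDr x : zmod_morphism (cdot x).
Proof. by move=> u v; rewrite /cdot rmorphB mulrBr. Qed.
Fact cdotZl y : scalable_for *%R (cdot ^~ y).
Proof. by move=> c u; rewrite /cdot mulrA. Qed.
Fact cdotZr x : scalable_for (@Num.conj R[i] \; *%R) (cdot x).
Proof. by move=> c u; rewrite /cdot rmorphM mulrCA. Qed.
HB.instance Definition _ := isBilinear.Build R[i] cline cline R[i]
  *%R (@Num.conj R[i] \; *%R) cdot cdotDl cdotDr cdotZl cdotZr.
Fact cdot_herm (x y : cline) : cdot x y = (-1) ^+ false * ((cdot y x)^*)%R.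
Proof. by rewrite expr0 mul1r /cdot rmorphM /= conjCK mulrC. Qed.
HB.instance Definition _ := isHermitianSesquilinear.Build R[i] cline false
  (@Num.conj R[i]) cdot cdot_herm.
Fact cdot_gt0 (x : cline) : x != 0 -> 0 < cdot x x.
Proof. by move=> x0; rewrite /cdot mul_conjC_gt0. Qed.
HB.instance Definition _ := isDotProduct.Build R[i] cline cdot cdot_gt0.

Fact cdot_norm (x : cline) : `|x| ^+ 2 = cdot x x.
Proof. exact: normCK. Qed.

Definition complex_line : hilbert R[i] := @Hilbert R[i] cline cdot cdot_norm.

HB.instance Definition _ := @isStarAlgebra.Build R[i] R[i]^o (@Num.conj R[i])
  (@conjCK _) (rmorphD _) (fun c x => rmorphM _ c x)
  (fun x y => etrans (rmorphM _ x y) (mulrC _ _)).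

(** The representation is multiplication by f x on the complex line; it supplies the nonzero
    representation that [bounded_reps] asks for. *)
Lemma character_rep (A : starAlgType R[i]) (f : A -> R[i]^o) : star_hom f ->
  exists pi : A -> {linear complex_line -> complex_line}, star_rep pi.
Proof.
move=> [fD fZ fM f1 fS].
pose T x (v : complex_line) : complex_line := f x * (v : R[i]).
have TL x : linear (T x).
  by move=> c u v; rewrite /T mulrDr -scalerAr.
pose pi x : {linear complex_line -> complex_line} :=
  HB.pack (T x) (GRing.isLinear.Build _ _ _ _ (T x) (TL x)).
exists pi; split=> [x|x y v|c x v|x y v|v|x u v].
- move=> v; exact: (@mulrl_continuous R[i] (f x)).
- by rewrite -[LHS]/(f _ * v) fD mulrDl.
- by rewrite -[LHS]/(f _ * v) fZ -scalerAl.
- by rewrite -[LHS]/(f _ * v) fM -mulrA.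
- by rewrite -[LHS]/(f _ * v) f1 mul1r.
- rewrite -[LHS]/(f x * u * (v^*)%R) -[RHS]/(u * (((f (star x)) * v)^*)%R) fS.
  by rewrite rmorphM /= conjCK [f x * u]mulrC mulrA.
Qed.

End ComplexLine.

(** * Functional calculus in the envelope *)

Section SphereEnvelope.
Variables (R : realType) (q r : {posnum R}).
Hypothesis q_lt1 : q%:num < 1.
Local Notation A := (S2qr q r).
Local Notation a := (s2a q r).
Local Notation b := (s2b q r).
Local Notation X := (S2spec q r).
Local Notation K := (spec_set q r).
Local Notation s2poly := (horner_alg a).
Local Notation cpoly := (map_poly (real_complex R)).
Local Notation polyc := (@polyc R q r q_lt1).

Lemma s2poly_rep_le p : rep_le (s2poly p) (cnorm (polyc p)).
Proof.
have h t : K t -> cmod p.[t%:C] <= cnorm (polyc p).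
  move=> Kt; rewrite -(tau_pt q_lt1 Kt) -(polycE q_lt1); exact: cont_norm_ub.
move=> H pi rpi; apply: (s2poly_norm_le q_lt1 rpi); first exact: cnorm_ge0.
- by move=> n; apply: h; right; exists n; left.
- by move=> n; apply: h; right; exists n; right.
- by apply: (h 0); left.
Qed.

(** The bound for b is the square root of the one for [star b * b] = f(a); the rest is induction on
    terms. The character a = 0, b = sqrt r provides a nonzero representation. *)
Lemma S2_bounded_reps : bounded_reps A.
Proof.
split=> [x|].
  have hB : exists2 M, 0 <= M & rep_le b M.
    exists (Num.sqrt (cnorm (polyc (cpoly (fpoly r))))); first exact: sqrtr_ge0.
    apply: rep_le_star_sqr; first exact: sqrtr_ge0.
    by rewrite sqr_sqrtr ?cnorm_ge0 // bs_b; exact: s2poly_rep_le.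
  elim/S2_ind: x; elim=> [|||c|s [M M0 hM] t [N N0 hN]|s [M M0 hM] t [N N0 hN]].
  - exists (cnorm (polyc 'X)); first exact: cnorm_ge0.
    by rewrite -/(s2a q r) -s2polyX; exact: s2poly_rep_le.
  - exact: hB.
  - have [M M0 hM] := hB; exists M => //; rewrite -star_s2b; exact: rep_le_star.
  - exists (cmod c * 1); first by rewrite mulr1 cmod_ge0.
    rewrite s2_classC; apply: rep_leZ; exact: rep_le1.
  - exists (M + N); first exact: addr_ge0.
    rewrite s2_classD; exact: rep_leD.
  - exists (M * N); first exact: mulr_ge0.
    rewrite s2_classM; exact: rep_leM.
have rel : s2_relations q%:num r%:num (0 : R[i]^o) ((Num.sqrt r%:num)%:C : R[i]^o)
    (star ((Num.sqrt r%:num)%:C : R[i]^o)).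
  have -> : star ((Num.sqrt r%:num)%:C : R[i]^o) = (Num.sqrt r%:num)%:C.
    exact: conj_rc.
  have e : r%:num%:C%:A = r%:num%:C :> R[i]^o by exact: mulr1.
  have rr : ((Num.sqrt r%:num)%:C : R[i]^o) * (Num.sqrt r%:num)%:C = r%:num%:C.
    by rewrite -rmorphM /= -expr2 sqr_sqrtr.
  split; rewrite ?expr2.
  - by rewrite mul0r mulr0 scaler0.
  - by rewrite mul0r mulr0 scaler0.
  - by rewrite rr mul0r subr0 add0r e.
  - by rewrite rr mul0r !scaler0 subr0 add0r e.
have s0 : star (0 : R[i]^o) = 0 by exact: star0.
have [f [[hf _ _] _]] := S2_universal s0 rel.
have [pi rpi] := character_rep hf.
by exists (complex_line R), pi, (1 : R[i]); split=> //; exact: oner_neq0.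
Qed.

Lemma S2_has_envelope : has_envelope A.
Proof. exact: bounded_reps_envelope S2_bounded_reps. Qed.

Variables (E : cstarAlgType R) (iota : A -> E).
Hypothesis hiota : enveloping iota.

Let ih : star_hom iota. Proof. by case: hiota. Qed.

Lemma iota_rnorm x : cnorm (iota x) = rnorm x.
Proof.
have [_ n _] := hiota; apply: EFin_inj.
by rewrite n (rnormE S2_bounded_reps).
Qed.

(** The polynomials are dense in C(K), and p |-> p(a) is contractive for the supremum norm by
    [s2poly_rep_le]. *)
Lemma calculus_ex : exists psi : Cfun R X -> E, [/\ star_hom psi,
  forall p, psi (polyc p) = iota (s2poly p) & forall g, cnorm (psi g) <= cnorm g].
Proof.
have jh : star_hom (fun x : S2base q r => iota (base_val x)).
  have [D Z M O S] := ih.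
  by split=> [x y|c x|x y||x]; [exact: D|exact: Z|exact: M|exact: O|exact: S].
have [|psi [h1 h2 h3]] :=
    star_hom_extend (gelfand_star_hom r q_lt1) jh (gelfand_dense q_lt1).
  move=> x; rewrite iota_rnorm; apply/(rnorm_leP S2_bounded_reps); first exact: cnorm_ge0.
  by rewrite poly_ofP; exact: s2poly_rep_le.
exists psi; split=> // p.
by rewrite -gelfand_s2base h2.
Qed.

End SphereEnvelope.

(** * The coisometry *)

Section Weights.
Variables (R : realType) (q r : {posnum R}).
Hypothesis q_lt1 : q%:num < 1.
Local Notation X := (S2spec q r).
Local Notation Q := (q%:num ^+ 2).
Local Notation K := (spec_set q r).
Local Notation tau := (@spec_tau R q r).
Local Notation cpoly := (map_poly (real_complex R)).
Local Notation polyc := (@polyc R q r q_lt1).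
Local Notation ext := (@dual_ext R q r q_lt1).

Let Ktau chi : K (tau chi) := (tau_ev q_lt1 chi).1.

Lemma real_cont (h : R -> R) : (forall t, K t -> {for t, continuous h}) ->
  (fun chi : X => (h (tau chi))%:C) \in @cont_pred R X.
Proof.
move=> hc; apply: compact_cont; first exact: S2spec_compact.
move=> chi.
have := cvg_comp tau (fun s : R => ('X : {poly R[i]}).[(h s)%:C] : R[i]^o)
  (@tau_continuous _ _ _ chi)
  (cvg_comp h (fun s : R => ('X : {poly R[i]}).[s%:C] : R[i]^o)
    (hc _ (Ktau chi)) (@continuous_cpoly _ 'X (h (tau chi)))).
rewrite hornerX.
by under eq_fun do rewrite hornerX.
Qed.

(** The modulus in the polar decomposition of b, as [b * star b] = f(Qa); it has no zero on K
    because QK avoids the roots of f. *)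
Definition wt (t : R) : R := Num.sqrt (fpoly r).[Q * t].

Lemma wt_gt0 t : K t -> 0 < wt t.
Proof. by move=> Kt; rewrite sqrtr_gt0 fpoly_Q_gt0 // (spec_set_bounds q_lt1). Qed.

Lemma wt_sqr t : K t -> wt t ^+ 2 = (fpoly r).[Q * t].
Proof. by move=> Kt; rewrite sqr_sqrtr // ltW // fpoly_Q_gt0 // (spec_set_bounds q_lt1). Qed.

Lemma wt_continuous t : {for t, continuous wt}.
Proof.
apply: (@continuous_comp _ _ _ (fun t => (fpoly r).[Q * t]) Num.sqrt).
  apply: (@continuous_comp _ _ _ (fun t => Q * t) (horner (fpoly r))).
    exact: mulrl_continuous.
  exact: continuous_horner.
exact: sqrt_continuous.
Qed.

Definition weightc : Cfun R X := Cont (real_cont (fun t _ => @wt_continuous t)).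

Fact inv_wt_continuous t : K t -> {for t, continuous (fun t => (wt t)^-1)}.
Proof. by move=> Kt; apply: continuousV (@wt_continuous t); rewrite gt_eqF // wt_gt0. Qed.
Definition inv_weightc : Cfun R X := Cont (real_cont inv_wt_continuous).

Lemma weightc_inv : inv_weightc * weightc = 1.
Proof.
apply: cont_eq => chi; rewrite -[LHS]/(((wt (tau chi))^-1)%:C * (wt (tau chi))%:C).
by rewrite -rmorphM mulVf // gt_eqF // wt_gt0.
Qed.

Lemma Cfun_mulC (g h : Cfun R X) : g * h = h * g.
Proof. by apply: cont_eq => chi; exact: mulrC. Qed.

Lemma weightc_star : star weightc = weightc.
Proof. by apply: cont_eq => chi; exact: conj_rc. Qed.

Lemma inv_weightc_star : star inv_weightc = inv_weightc.
Proof. by apply: cont_eq => chi; exact: conj_rc. Qed.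

Lemma weightc_sqr : weightc * weightc = polyc (dilate Q (cpoly (fpoly r))).
Proof.
apply: cont_eq => chi; rewrite -[LHS]/((wt (tau chi))%:C * (wt (tau chi))%:C).
by rewrite -rmorphM -expr2 wt_sqr // polycE horner_dilate horner_map.
Qed.

Lemma ext1_pos (k : nat) : ext k 1 = 1.
Proof. by apply: cont_eq => chi; rewrite ext1E //; exact: spec_set_pos. Qed.

Lemma ext1_polyc p : ext 1 (polyc p) = polyc (dilate Q p).
Proof. by rewrite ext_polyc (ext1_pos 1) mul1r expr1z. Qed.

(* [fpoly r] vanishes exactly off D_{-1}. *)
Lemma ext_neg_weightc_sqr :
  ext (-1) (weightc * weightc) = polyc (cpoly (fpoly r)).
Proof.
apply: cont_eq => chi; rewrite polycE horner_map.
have [h|h] := pselect (K (Q ^ (-1) * tau chi)).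
  rewrite extE // weightc_sqr polycE horner_dilate horner_map /= tau_shift //.
  by rewrite exprN1 mulVKf // gt_eqF // exprn_gt0.
rewrite ext0 //; apply/esym; have -> : (fpoly r).[tau chi] = 0.
  by apply/eqP/negPn/negP => /(spec_set_invQ q_lt1 (Ktau chi)); rewrite -exprN1.
by [].
Qed.

End Weights.

(** * Relations of the coisometry in the envelope *)

Section Isometry.
Variables (R : realType) (q r : {posnum R}).
Hypothesis q_lt1 : q%:num < 1.
Local Notation A := (S2qr q r).
Local Notation a := (s2a q r).
Local Notation b := (s2b q r).
Local Notation X := (S2spec q r).
Local Notation s2poly := (horner_alg a).
Local Notation polyc := (@polyc R q r q_lt1).
Local Notation ext := (@dual_ext R q r q_lt1).
Local Notation w := (weightc r q_lt1).
Local Notation wi := (inv_weightc r q_lt1).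
Variables (E : cstarAlgType R) (iota : A -> E) (psi : Cfun R X -> E).
Hypothesis ih : star_hom iota.
Hypothesis ph : star_hom psi.
Hypothesis psi_poly : forall p, psi (polyc p) = iota (s2poly p).
Hypothesis psi_norm : forall g, cnorm (psi g) <= cnorm g.

Let psiM : {morph psi : g h / g * h}. Proof. by case: ph. Qed.
Let psi1 : psi 1 = 1. Proof. by case: ph. Qed.
Let psiS : {morph psi : g / star g}. Proof. by case: ph. Qed.
Let iotaM : {morph iota : g h / g * h}. Proof. by case: ih. Qed.
Let iotaS : {morph iota : g / star g}. Proof. by case: ih. Qed.

(** For polynomials this is [b_s2poly], and both sides are continuous in g. *)
Lemma iota_b_psi g : iota b * psi g = psi (ext 1 g) * iota b.
Proof.
have [u hu] := dense_tends (cnorm_group _) (gelfand_dense q_lt1 g).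
have t1 : tends (@cnorm R E) (fun n => psi (gelfand q_lt1 (u n))) (psi g).
  apply: (tends_le (K := 1) (cnorm_group _) (cnorm_group _) _ hu) => n.
  by rewrite mul1r -(star_homB ph) psi_norm.
have t2 : tends (@cnorm R E) (fun n => psi (ext 1 (gelfand q_lt1 (u n)))) (psi (ext 1 g)).
  apply: (tends_le (K := 1) (cnorm_group _) (cnorm_group _) _ hu) => n.
  by rewrite mul1r -(star_homB ph) -extB (le_trans (psi_norm _)) // ext_norm.
have c := tends_cst (cnorm_group E) (iota b).
have t3 := @ctendsM _ _ _ _ _ _ c t1.
have t4 := @ctendsM _ _ _ _ _ _ t2 c.
apply: (tends_unique (cnorm_group E) t3).
rewrite (_ : (fun n => _) = fun n => psi (ext 1 (gelfand q_lt1 (u n))) * iota b) //.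
apply/funext => n; rewrite /gelfand ext1_polyc !psi_poly -!iotaM.
by rewrite b_s2poly.
Qed.

(** The partial isometry s of the polar decomposition b = w s. *)
Definition coiso : E := psi wi * iota b.
Local Notation s := coiso.

Lemma w_coiso : psi w * s = iota b.
Proof. by rewrite /s mulrA -psiM Cfun_mulC weightc_inv psi1 mul1r. Qed.

Lemma coiso_starE : star s = iota (star b) * psi wi.
Proof. by rewrite starM -psiS inv_weightc_star iotaS. Qed.

Lemma coiso_coiso_star : s * star s = 1.
Proof.
rewrite coiso_starE /s -mulrA [iota b * _]mulrA -iotaM b_bs -psi_poly -weightc_sqr.
rewrite -psiM -psiM -mulrA [w * wi]Cfun_mulC weightc_inv mulr1 weightc_inv.
exact: psi1.
Qed.

Lemma coiso_psi g : s * psi g = psi (ext 1 g) * s.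
Proof. by rewrite /s -mulrA iota_b_psi !mulrA -!psiM Cfun_mulC. Qed.

(** The left side is f(a) times the shift of w^(-2) by [ext (-1)]; the two cancel on D_{-1}, and off
    D_{-1} both vanish. *)
Lemma coiso_star_coiso : star s * s = psi (ext (-1) 1).
Proof.
(* As [ext 1] undoes [ext (-1)] on this side, the square of [wi] can be carried to the right of
   b. *)
have k : wi * wi = ext 1 (ext (-1) (wi * wi)) by rewrite ext_pos subrr ext_0.
rewrite coiso_starE /s -mulrA [psi wi * (_ * _)]mulrA -psiM k -iota_b_psi mulrA -iotaM bs_b.
rewrite -psi_poly -psiM -ext_neg_weightc_sqr -extM; congr (psi (ext _ _)).
rewrite -mulrA [w * (wi * _)]mulrA [w * wi]Cfun_mulC weightc_inv mul1r.
by rewrite Cfun_mulC weightc_inv.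
Qed.

Lemma psi_coiso g : psi g * s = s * psi (ext (-1) g).
Proof. by rewrite coiso_psi ext_pos subrr ext_0. Qed.

Lemma coiso_star_psi g : star s * psi g = psi (ext (-1) g) * star s.
Proof.
rewrite -[LHS]starK starM starK -psiS psi_coiso starM -psiS.
by rewrite -ext_star starK.
Qed.

Definition coison (n : int) : E := if n is Posz k then s ^+ k else star s ^+ `|n|%N.
Local Notation sn := coison.

Lemma coison_psi n g : sn n * psi g = psi (ext n g) * sn n.
Proof.
have pos (x : E) (d : nat -> int) : d 0%N = 0 ->
    (forall g, x * psi g = psi (ext (d 1%N) g) * x) ->
    (forall k g, ext (d 1%N) (ext (d k) g) = ext (d k.+1) g) ->
    forall k g, x ^+ k * psi g = psi (ext (d k) g) * x ^+ k.
  move=> d0 hx hd; elim=> [|k IH] h; first by rewrite mul1r mulr1 d0 ext_0.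
  by rewrite exprS -mulrA IH mulrA hx hd mulrA.
case: n => k.
  by apply: (pos s Posz) => // [|m h]; [exact: coiso_psi|exact: (ext_pos q_lt1 1)].
rewrite NegzE; apply: (pos (star s) (fun m => - m%:Z)) => // [|m h].
  exact: coiso_star_psi.
by rewrite ext_neg -opprD.
Qed.

Lemma star_coison n : star (sn n) = sn (- n).
Proof.
case: n => [[|k]|k]; [exact: star1|exact: starX|].
by rewrite [LHS]starX starK.
Qed.

Lemma coiso_coison m : s * sn m = sn (1 + m).
Proof.
case: m => [k|[|k]] /=; first by rewrite -exprS.
  by rewrite expr1 coiso_coiso_star.
by rewrite exprS mulrA coiso_coiso_star mul1r subn1.
Qed.

Lemma coiso_star_coison m : star s * sn m = psi (ext (-1) 1) * sn (-1 + m).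
Proof.
have e0 : star s = psi (ext (-1) 1) * star s.
  by rewrite -coiso_star_coiso -mulrA coiso_coiso_star mulr1.
case: m => [[|k]|k].
- by rewrite /= mulr1 expr1.
- have -> : -1 + k.+1%:Z = k by rewrite intS addKr.
  by rewrite -[LHS]/(star s * s ^+ k.+1) exprS [LHS]mulrA coiso_star_coiso.
- rewrite (_ : -1 + Negz k = Negz k.+1); last by rewrite !NegzE -opprD.
  by rewrite [sn _]/= {1}e0 -mulrA -exprS.
Qed.

(** A factor s joins the powers freely because s is a coisometry. A factor s^* costs the indicator
    of D_{-1}, and these indicators accumulate to that of D_n. *)
Lemma coisonM n m : sn n * sn m = psi (ext n 1) * sn (n + m).
Proof.
case: n => k.
  rewrite ext1_pos psi1 mul1r [sn k]/=.
  elim: k m => [|k IH] m; first by rewrite mul1r add0r.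
  by rewrite exprSr -mulrA coiso_coison IH intS addrA [k%:Z + 1]addrC.
rewrite NegzE [sn _]/=; move: k.+1 => {k}k.
elim: k m => [|k IH] m; first by rewrite mul1r oppr0 ext_0 psi1 mul1r add0r.
have sk : sn (- k%:Z) = star s ^+ k by case: k {IH}.
rewrite exprSr -mulrA coiso_star_coison mulrA -sk coison_psi -mulrA sk IH mulrA -psiM.
have ek : - k%:Z - 1%:Z = - k.+1%:Z by rewrite -opprD -PoszD addn1.
by rewrite -extM mulr1 (ext_neg q_lt1 (- k%:Z) 1) addrA ek.
Qed.

End Isometry.

(** * Homomorphisms out of a crossed product *)

Section CrossedProduct.
Variables (R : realType) (B : cstarAlgType R) (P : paction B).
Local Notation dom := (pa_dom P).
Local Notation act := (pa_act P).

Lemma tensor_congr n m x y (dx : dom n x) (dy : dom m y) :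
  n = m -> x = y -> tensor dx = tensor dy.
Proof. by move=> e e'; subst m y; apply: crossed_eq. Qed.

Lemma crossed_sum (f : crossed P) : f = \sum_(n <- csupp f) tensor (crossed_dom f n).
Proof.
apply: crossed_eq => k.
rewrite (big_morph (fun h : crossed P => h k) (id1 := 0) (op1 := +%R)) //=.
have [kf|kf] := boolP (k \in csupp f).
  rewrite (big_fsetD1 k) //= eqxx big_seq big1 ?addr0 // => n.
  by rewrite !inE eq_sym => /andP[/negPf ->].
rewrite csuppP // big_seq big1 // => n nf; case: eqP => // kn.
by rewrite kn nf in kf.
Qed.

Lemma crossed_ind (S : crossed P -> Prop) : S 0 -> (forall f g, S f -> S g -> S (f + g)) ->
  (forall n x (dx : dom n x), S (tensor dx)) -> forall f, S f.
Proof. by move=> S0 SD ST f; rewrite (crossed_sum f); elim/big_ind: _. Qed.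

Let dom0 x : dom 0 x. Proof. by rewrite (pa_dom0 (pactionP P)). Qed.

Definition cst0 x : crossed P := tensor (dom0 x).

Lemma cst0_star_hom : star_hom cst0.
Proof.
split=> [x y|c x|x y||x].
- by apply: crossed_eq => k; rewrite -[RHS]/(cst0 x k + cst0 y k) /=; case: eqP => // _; rewrite addr0.
- by apply: crossed_eq => k; rewrite -[RHS]/(c *: cst0 x k) /=; case: eqP => // _; rewrite scaler0.
- rewrite /cst0 tensorM; apply: tensor_congr; rewrite ?addr0 // /cterm oppr0.
  by rewrite !(pa_act0 (pactionP P)).
- exact: crossed_eq.
- rewrite /cst0 star_tensor; apply: tensor_congr; rewrite ?oppr0 //.
  by rewrite (pa_act0 (pactionP P)).
Qed.

Section Lift.
Variables (E : starAlgType R[i]) (psi : B -> E) (s : int -> E).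
Hypothesis ph : star_hom psi.
Hypothesis s0 : s 0 = 1.
Hypothesis sM : forall n m x y, dom n x -> dom m y ->
  psi x * s n * (psi y * s m) = psi (cterm P n x y) * s (n + m).
Hypothesis sS : forall n x, dom n x ->
  star (psi x * s n) = psi (act (- n) (star x)) * s (- n).

(** The map x (x) n |-> psi(x) s_n. The hypotheses [sM] and [sS] are its compatibility with product
    and involution on elementary tensors, which suffices by [crossed_ind]. *)
Definition crossed_lift (f : crossed P) : E := \sum_(n \in setT) psi (f n) * s n.
Local Notation F := crossed_lift.

Let psi0 : psi 0 = 0. Proof. by have := star_homB ph 0 0; rewrite !subrr. Qed.
Let psiD : {morph psi : x y / x + y}. Proof. by case: ph. Qed.

Lemma crossed_liftE (f : crossed P) (t : {fset int}) : (forall n, n \notin t -> f n = 0) ->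
  F f = \sum_(n <- t) psi (f n) * s n.
Proof. by move=> h; apply: fsbigTE => n /h ->; rewrite psi0 mul0r. Qed.

Lemma crossed_liftD f g : F (f + g) = F f + F g.
Proof.
rewrite (crossed_liftE (@csupp2l _ _ P f g)) (crossed_liftE (@csupp2r _ _ P f g)).
rewrite (@crossed_liftE _ (csupp f `|` csupp g)%fset) -?big_split /=.
  by apply: eq_bigr => n _; rewrite psiD mulrDl.
by move=> n hn; rewrite -[LHS]/(f n + g n) (csupp2l hn) (csupp2r hn) addr0.
Qed.

Lemma crossed_liftZ (c : R[i]) f : F (c *: f) = c *: F f.
Proof.
have [_ psiZ _ _ _] := ph.
rewrite (crossed_liftE (@csuppP _ _ P f)) (@crossed_liftE _ (csupp f)) ?scaler_sumr.
  by apply: eq_bigr => n _; rewrite -[(c *: f) n]/(c *: f n) psiZ scalerAl.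
by move=> n /csuppP h; rewrite -[LHS]/(c *: f _) h scaler0.
Qed.

Lemma crossed_lift_tensor n x (dx : dom n x) : F (tensor dx) = psi x * s n.
Proof.
rewrite (@crossed_liftE _ [fset n]%fset) ?big_seq_fset1 /= ?eqxx //.
by move=> k; rewrite inE => /negPf ->.
Qed.

Lemma crossed_lift_star_hom : star_hom F.
Proof.
have F0 : F 0 = 0 by rewrite -(scale0r (0 : crossed P)) crossed_liftZ scale0r.
split; [exact: crossed_liftD|exact: crossed_liftZ| | |].
- move=> f g; elim/crossed_ind: f => [|f f' IH IH'|n x dx].
  + by rewrite mul0r F0 mul0r.
  + by rewrite mulrDl !crossed_liftD IH IH' mulrDl.
  elim/crossed_ind: g => [|g g' IH IH'|m y dy].
  + by rewrite mulr0 F0 mulr0.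
  + by rewrite mulrDr !crossed_liftD IH IH' mulrDr.
  by rewrite tensorM !crossed_lift_tensor sM.
- have [_ _ _ <- _] := cst0_star_hom.
  by rewrite crossed_lift_tensor s0 mulr1; case: ph.
- elim/crossed_ind => [|f f' IH IH'|n x dx].
  + by rewrite star0 F0 star0.
  + by rewrite starD !crossed_liftD IH IH' starD.
  by rewrite star_tensor !crossed_lift_tensor sS.
Qed.

End Lift.
End CrossedProduct.

(* M^2 - |f|^2 = g g^* with g continuous, so |pi f| <= M for M = |f|. *)
Lemma Cfun_rep_le (R : realType) (X : ptopologicalType) (f : Cfun R X) :
  compact [set: X] -> rep_le f (cnorm f).
Proof.
move=> cX; pose M := cnorm f.
have M0 : 0 <= M by exact: cnorm_ge0.
have le chi : cmod (f chi) <= M by exact: cont_norm_ub.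
pose h chi : R := M ^+ 2 - cmod (f chi) ^+ 2.
have h0 chi : 0 <= h chi by rewrite subr_ge0 ler_sqr ?nnegrE ?cmod_ge0.
have gc : (fun chi => (Num.sqrt (h chi))%:C) \in @cont_pred R X.
  apply: compact_cont => //; apply/contE => chi e e0.
  have cf : cmod (f x) @[x --> chi] --> cmod (f chi).
    apply/cvgrPdist_lt => d d0; have /contE/(_ chi d d0) := @cont_continuous R X f.
    apply: filterS => y; apply: le_lt_trans; rewrite ler_norml.
    have := cmodD (f chi - f y) (f y); have := cmodD (f y - f chi) (f chi).
    by rewrite !subrK [cmod (f y - f chi)]cmodBC; lra.
  have ch : Num.sqrt (h x) @[x --> chi] --> Num.sqrt (h chi).
    apply: (cvg_comp h (@Num.sqrt R) _ (@sqrt_continuous R (h chi))).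
    apply: cvgB; first exact: cvg_cst.
    exact: (cvgM cf cf).
  have /cvgrPdist_lt/(_ e e0) := ch.
  by apply: filterS => y; rewrite -rmorphB cmod_real.
pose g : Cfun R X := Cont gc.
have e : star f * f = (M ^+ 2)%:C *: 1 - star g * g.
  apply: cont_eq => chi.
  rewrite -[LHS]/(((f chi)^*)%R * f chi) -[RHS]/((M ^+ 2)%:C * 1 - ((g chi)^*)%R * g chi).
  rewrite !cmod_sqr mulr1 -rmorphB /= cmod_real ger0_norm ?sqrtr_ge0 // sqr_sqrtr //.
  by rewrite /h opprB addrC subrK.
move=> H pi rpi v; rewrite -ler_sqr ?nnegrE ?mulr_ge0 ?hnorm_ge0 //.
rewrite -lecR (rep_sqr _ _ rpi) e (repB _ _ _ rpi) (repZ rpi) (rep1 rpi).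
rewrite dotBl dotZl -(rep_sqr _ _ rpi) dot_sqr exprMn [X in _ <= X]rmorphM /=.
by rewrite lerBlDr lerDl ler0c sqr_ge0.
Qed.

(** * The sphere in the crossed product *)

Lemma rep_comp (R : realType) (A B : starAlgType R[i]) (j : A -> B) (H : hilbert R[i])
    (pi : B -> {linear H -> H}) : star_hom j -> star_rep pi -> star_rep (fun x => pi (j x)).
Proof.
move=> [jD jZ jM j1 jS] [pb pD pZ pM p1 pS]; split=> [x|x y v|c x v|x y v|v|x u v].
- exact: pb.
- by rewrite jD pD.
- by rewrite jZ pZ.
- by rewrite jM pM.
- by rewrite j1 p1.
- by rewrite pS jS.
Qed.

Lemma star_hom_comp (C : numClosedFieldType) (A B D : starAlgType C) (f : A -> B) (g : B -> D) :
  star_hom f -> star_hom g -> star_hom (g \o f).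
Proof.
move=> [fD fZ fM f1 fS] [gD gZ gM g1 gS].
by split=> [x y|c x|x y||x] /=; rewrite ?fD ?fZ ?fM ?f1 ?fS ?gD ?gZ ?gM ?g1 ?gS.
Qed.

Lemma star_hom_horner (C : numClosedFieldType) (A B : starAlgType C) (j : A -> B) (x : A) p :
  star_hom j -> j (horner_alg x p) = horner_alg (j x) p.
Proof.
move=> hj; have [jD jZ jM j1 _] := hj.
elim/poly_ind: p => [|p c IH]; first by rewrite !rmorph0 -(subrr 0) (star_homB hj) subrr.
by rewrite !rmorphD !rmorphM /= !horner_algX !horner_algC jD jM IH jZ j1.
Qed.

Lemma S2_hom_eq (R : realType) (q r : {posnum R}) (B : starAlgType R[i]) (f g : S2qr q r -> B) :
  star_hom f -> star_hom g -> f (s2a q r) = g (s2a q r) -> f (s2b q r) = g (s2b q r) -> f =1 g.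
Proof.
move=> [fD fZ fM f1 fS] [gD gZ gM g1 gS] ea eb.
elim/S2_ind; elim=> [|||c|s IHs t IHt|s IHs t IHt].
- exact: ea.
- exact: eb.
- by rewrite -star_s2b fS gS eb.
- by rewrite s2_classC fZ gZ f1 g1.
- by rewrite s2_classD fD gD IHs IHt.
- by rewrite s2_classM fM gM IHs IHt.
Qed.

(** * Crossed products by partial actions that agree with the dual one *)

Section SphereCrossed.
Variables (R : realType) (q r : {posnum R}).
Hypothesis q_lt1 : q%:num < 1.
Local Notation A := (S2qr q r).
Local Notation a := (s2a q r).
Local Notation b := (s2b q r).
Local Notation X := (S2spec q r).
Local Notation Q := (q%:num ^+ 2).
Local Notation tau := (@spec_tau R q r).
Local Notation s2poly := (horner_alg a).
Local Notation cpoly := (map_poly (real_complex R)).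
Local Notation polyc := (@polyc R q r q_lt1).
Local Notation ctau := (@ctau R q r q_lt1).
Local Notation ext := (@dual_ext R q r q_lt1).
Local Notation w := (weightc r q_lt1).
Local Notation wi := (inv_weightc r q_lt1).
Variable P : paction (Cfun R X).
Hypothesis hP : same_paction P (dual_paction q r).
Local Notation dom := (pa_dom P).
Local Notation act := (pa_act P).
Local Notation cst := (cst0 P).

Lemma same_domP n g : dom n g <-> dual_dom n g.
Proof. by rewrite hP.1. Qed.

Lemma same_actE n g : dom n g -> act (- n) g = ext (- n) g.
Proof. by move=> d; rewrite hP.2 ?opprK //= dual_actE. Qed.

(** beta_n is multiplicative and undoes beta_{-n} on g, so the twisted product becomes an ordinary
    one with a shifted second factor. *)
Lemma same_ctermE n g h : dom n g -> cterm P n g h = g * ext n h.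
Proof.
move=> d; rewrite /cterm same_actE // -{1}[n]opprK same_actE; last first.
  by rewrite -same_actE //; exact: cterm_in.
rewrite opprK extM; congr (_ * _); rewrite -{1}[n]opprK extK // opprK.
exact/same_domP.
Qed.

Let dom1 g : dom 1 g. Proof. exact/same_domP/(@dual_dom_pos _ _ _ q_lt1 1%N g). Qed.

Lemma tensor1_cst g h : tensor (dom1 g) * cst h = tensor (dom1 (g * ext 1 h)).
Proof. by rewrite /cst0 tensorM; apply: tensor_congr; rewrite ?addr0 ?same_ctermE. Qed.

Lemma cst_tensor n g h (dh : dom n h) (dgh : dom n (g * h)) :
  cst g * tensor dh = tensor dgh.
Proof.
rewrite /cst0 tensorM; apply: tensor_congr; rewrite ?add0r ?same_ctermE ?ext_0 //.
by rewrite (pa_dom0 (pactionP P)).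
Qed.

(** The image of b, with 1 (x) 1 in the role of the coisometry. *)
Definition gen_b : crossed P := tensor (dom1 w).
Local Notation gb := gen_b.

Lemma gen_b_cst h : gb * cst h = cst (ext 1 h) * gb.
Proof.
by rewrite tensor1_cst (cst_tensor _ (dom1 _)); apply: tensor_congr => //; exact: Cfun_mulC.
Qed.

Lemma star_gen_b_gen_b : star gb * gb = cst (polyc (cpoly (fpoly r))).
Proof.
rewrite star_tensor tensorM; apply: tensor_congr; rewrite ?addNr // same_ctermE.
  by rewrite same_actE weightc_star // -ext_neg_weightc_sqr extM.
rewrite same_actE weightc_star //; exact/same_domP/ext_dom.
Qed.

Lemma gen_b_star_gen_b : gb * star gb = cst (polyc (dilate Q (cpoly (fpoly r)))).
Proof.
rewrite star_tensor tensorM; apply: tensor_congr; rewrite ?subrr // same_ctermE //.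
by rewrite same_actE weightc_star // ext_pos subrr ext_0 weightc_sqr.
Qed.

Lemma ext1_ctau : ext 1 ctau = Q%:C *: ctau.
Proof.
apply: cont_eq => chi; have k := @spec_set_pos _ _ _ 1 _ (tau_ev q_lt1 chi).1.
rewrite extE // -[LHS]/((tau _)%:C) tau_shift // -[RHS]/(Q%:C * (tau chi)%:C).
by rewrite -rmorphM.
Qed.

Lemma crossed_relations : s2_relations q%:num r%:num (cst ctau) gb (star gb).
Proof.
have [cD cZ cM c1 cS] := cst0_star_hom P; have cB := star_homB (cst0_star_hom P).
have Q0 : Q != 0 by rewrite gt_eqF // exprn_gt0.
have ba : gb * cst ctau = Q%:C *: (cst ctau * gb).
  by rewrite gen_b_cst ext1_ctau cZ scalerAl.
split.
- by rewrite ba scalerA -rmorphM /= mulVf // scale1r.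
- have := congr1 star ba; rewrite starM starZ starM -cS.
  have -> : star ctau = ctau by apply: cont_eq => chi; exact: conj_rc.
  by rewrite [(_^*)%R](conj_rc Q).
- rewrite star_gen_b_gen_b expr2 -cM -cB -c1 -cZ -cD; congr cst; apply: cont_eq => chi.
  rewrite polycE horner_map /= fpoly_horner.
  rewrite -[RHS]/((tau chi)%:C - (tau chi)%:C * (tau chi)%:C + r%:num%:C * 1).
  by rewrite mulr1 rmorphD rmorphB rmorphXn.
- rewrite gen_b_star_gen_b [cst ctau ^+ 2]expr2 -cM -!cZ -cB -c1 -cZ -cD; congr cst; apply: cont_eq => chi.
  rewrite polycE horner_dilate horner_map /= fpoly_horner.
  rewrite -[RHS]/(Q%:C * (tau chi)%:C - (q%:num ^+ 4)%:C * ((tau chi)%:C * (tau chi)%:C)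
    + r%:num%:C * 1).
  by rewrite mulr1 -!rmorphM -rmorphB -rmorphD /= exprMn -exprM expr2.
Qed.

Lemma S2_crossed_ex : exists f : A -> crossed P,
  [/\ star_hom f, f a = cst ctau & f b = gb].
Proof.
have sa : star (cst ctau) = cst ctau.
  have [_ _ _ _ <-] := cst0_star_hom P; congr cst.
  by apply: cont_eq => chi; exact: conj_rc.
by have [f [h _]] := S2_universal sa crossed_relations; exists f.
Qed.

Definition S2_crossed : A -> crossed P := projT1 (cid S2_crossed_ex).

Lemma S2_crossedP : [/\ star_hom S2_crossed, S2_crossed a = cst ctau & S2_crossed b = gb].
Proof. exact: projT2 (cid S2_crossed_ex). Qed.

Let S2_crossedh : star_hom S2_crossed. Proof. by case: S2_crossedP. Qed.

Lemma S2_crossed_poly p : S2_crossed (s2poly p) = cst (polyc p).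
Proof.
rewrite (star_hom_horner _ _ S2_crossedh) (star_hom_horner _ _ (cst0_star_hom P)).
by case: S2_crossedP => _ -> _.
Qed.

Lemma cst_rep_le g : rep_le (cst g) (cnorm g).
Proof.
move=> H pi rpi v.
exact: (@Cfun_rep_le R X g (S2spec_compact q_lt1) H _ (rep_comp (cst0_star_hom P) rpi) v).
Qed.

(** The product [star x * x] of an elementary tensor x lies in degree 0, where [cst_rep_le]
    applies. *)
Lemma tensor_rep_le n g (dg : dom n g) : exists2 M, 0 <= M & rep_le (tensor dg) M.
Proof.
have [y ey] : exists y, star (tensor dg) * tensor dg = cst y.
  by eexists; rewrite star_tensor tensorM; apply: tensor_congr; rewrite ?addNr.
exists (Num.sqrt (cnorm y)); first exact: sqrtr_ge0.
apply: rep_le_star_sqr; first exact: sqrtr_ge0.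
by rewrite sqr_sqrtr ?cnorm_ge0 // ey; exact: cst_rep_le.
Qed.

(** * From the crossed product back to the envelope of the sphere *)

Section Inverse.
Variables (E : cstarAlgType R) (iota : A -> E).
Hypothesis hiota : enveloping iota.

(** [crossed_lift] is applied to the calculus psi and the powers of s. On the generators the
    composite with [S2_crossed] gives psi of the coordinate, which is a, and w s = b. *)
Lemma crossed_to_envelope : exists f : crossed P -> E, star_hom f /\ forall x, f (S2_crossed x) = iota x.
Proof.
have ih : star_hom iota by case: hiota.
have [psi [ph psi_poly psi_norm]] := calculus_ex q_lt1 hiota.
have [psiD _ psiM psi1 psiS] := ph.
have hc := coison_psi ih ph psi_poly psi_norm.
pose s := coison q_lt1 iota psi.
have fh : star_hom (@crossed_lift _ _ P E psi s).
  apply: crossed_lift_star_hom => // [n m x y dx dy|n x dx].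
  - have -> : psi x * s n * (psi y * s m) = psi x * (s n * psi y) * s m by rewrite !mulrA.
    rewrite hc.
    have -> : psi x * (psi (ext n y) * s n) * s m = psi x * psi (ext n y) * (s n * s m).
      by rewrite !mulrA.
    rewrite (coisonM ih ph psi_poly psi_norm) mulrA -!psiM -mulrA -extM mulr1.
    by rewrite same_ctermE.
  - rewrite starM star_coison -psiS hc same_actE //.
    exact: (ideal_star (pa_ideal (pactionP P) n)).
exists (@crossed_lift _ _ P E psi s); split=> //.
have [_ phi_a phi_b] := S2_crossedP.
apply: (S2_hom_eq (star_hom_comp S2_crossedh fh) ih) => /=.
  rewrite phi_a crossed_lift_tensor // mulr1.
  by rewrite -[ctau](horner_algX (ctau : Cfun R X)) -/(polyc 'X) psi_poly s2polyX.
by rewrite phi_b crossed_lift_tensor // [s 1]/= expr1 w_coiso.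
Qed.

(** A representation of the crossed product pulls back to A. Conversely one of A extends to E and
    pulls back along [crossed_to_envelope] to a representation that restricts to the given one on
    A. *)
Lemma rep_norm_S2_crossed_envelope (x : A) : rep_norm (S2_crossed x) = rep_norm x.
Proof.
have [f [fh fphi]] := crossed_to_envelope.
apply/eqP; rewrite eq_le; apply/andP; split; apply: ub_ereal_sup => _ [H [pi [rpi ->]]].
  apply: ereal_sup_ubound; exists H, (fun x => pi (S2_crossed x)); split=> //.
  exact: rep_comp S2_crossedh rpi.
have [pi' [rpi' e]] := rep_extend hiota rpi.
apply: ereal_sup_ubound; exists H, (fun y => pi' (f y)); split.
  exact: rep_comp fh rpi'.
rewrite /op_norm; congr ereal_sup; apply/seteqP.
by split=> _ [v hv <-]; exists v => //; rewrite fphi e.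
Qed.

End Inverse.

(** Finite sums of elementary tensors are bounded by [tensor_rep_le]; a nonzero representation is
    taken from A through its envelope. *)
Lemma crossed_bounded_reps : bounded_reps (crossed P).
Proof.
have [E [iota hiota]] := S2_has_envelope r q_lt1.
split=> [x|].
  elim/crossed_ind: x => [|f g [M M0 hM] [N N0 hN]|n g dg].
  - by exists 0 => // H pi rpi v; rewrite rep0 // /hnorm normr0 mul0r.
  - by exists (M + N); [exact: addr_ge0|exact: rep_leD].
  - exact: tensor_rep_le.
have [_ [H [pi [v [rpi v0]]]]] := S2_bounded_reps r q_lt1.
have [f [fh _]] := crossed_to_envelope hiota.
have [pi' [rpi' _]] := rep_extend hiota rpi.
by exists H, (fun y => pi' (f y)), v; split=> //; exact: rep_comp fh rpi'.
Qed.

Lemma crossed_has_envelope : has_envelope (crossed P).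
Proof. exact: bounded_reps_envelope crossed_bounded_reps. Qed.

Lemma rep_norm_S2_crossed x : rep_norm (S2_crossed x) = rep_norm x.
Proof.
by have [E [iota hiota]] := S2_has_envelope r q_lt1; exact: rep_norm_S2_crossed_envelope hiota x.
Qed.

(** * Density of the image of the sphere algebra *)

Section Dense.
Variables (F : cstarAlgType R) (kappa : crossed P -> F).
Hypothesis hkappa : enveloping kappa.

Let kh : star_hom kappa. Proof. by case: hkappa. Qed.
Let kphi : star_hom (kappa \o S2_crossed) := star_hom_comp S2_crossedh kh.
Let kM : {morph kappa : x y / x * y}. Proof. by case: kh. Qed.

(** The polynomials are dense in C(K), and kappa is contractive on degree 0 by [cst_rep_le]. *)
Lemma in_closure_cst g : in_closure (kappa \o S2_crossed) (kappa (cst g)).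
Proof.
apply: in_closure_closed => e /(gelfand_dense q_lt1 g)[x hx].
exists (kappa (cst (gelfand q_lt1 x))).
  by rewrite /gelfand -S2_crossed_poly; exact: in_closure_range.
rewrite -(star_homB kh) -(star_homB (cst0_star_hom P)); apply: le_lt_trans hx.
have [_ nk _] := hkappa; rewrite -lee_fin nk; apply/rep_normP; first exact: cnorm_ge0.
exact: cst_rep_le.
Qed.

(** g (x) n is g (x) 0 times the n-th power of 1 (x) 1, and 1 (x) 1 is w^(-1) (x) 0 times the image
    w (x) 1 of b. *)
Lemma in_closure_tensor_pos (n : nat) g (dg : dom n g) :
  in_closure (kappa \o S2_crossed) (kappa (tensor dg)).
Proof.
have d1 (k : nat) : dom k 1 by apply/same_domP/(@dual_dom_pos _ _ _ q_lt1 k).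
have u1 : in_closure (kappa \o S2_crossed) (kappa (tensor (d1 1%N))).
  have -> : tensor (d1 1%N) = cst wi * gb.
    by rewrite (cst_tensor _ (dom1 _)); apply: tensor_congr; rewrite ?weightc_inv.
  rewrite kM; apply: (in_closureM kphi); first exact: in_closure_cst.
  by case: S2_crossedP => _ _ <-; exact: in_closure_range.
have -> : tensor dg = cst g * tensor (d1 1%N) ^+ n.
  have -> : tensor (d1 1%N) ^+ n = tensor (d1 n).
    elim: n {g dg} => [|n IH]; first by rewrite expr0; exact: crossed_eq.
    rewrite exprS IH tensorM; apply: tensor_congr; rewrite -?intS //.
    by rewrite same_ctermE // mul1r; exact: (ext1_pos _ q_lt1 1).
  have dg1 : dom n (g * 1) by rewrite mulr1.
  by rewrite (cst_tensor _ dg1); apply: tensor_congr; rewrite ?mulr1.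
rewrite kM; apply: (in_closureM kphi); first exact: in_closure_cst.
have kX m x : kappa (x ^+ m) = kappa x ^+ m.
  elim: m => [|m IH]; first by rewrite !expr0; case: kh.
  by rewrite !exprS kM IH.
by rewrite kX; exact: in_closureX.
Qed.

Lemma S2_crossed_dense : dense_range (kappa \o S2_crossed).
Proof.
move=> y; apply: in_closure_closed => e e0.
have [_ _ /(_ y e e0)[x hx]] := hkappa; exists (kappa x) => // {hx}.
elim/crossed_ind: x => [|f g hf hg|[n|n] g dg].
- by rewrite -(subrr 0) (star_homB kh) subrr -(subrr (kappa (S2_crossed 0)));
    apply: (in_closureB kphi); exact: in_closure_range.
- by have [-> _ _ _ _] := kh; exact: in_closureD.
- exact: in_closure_tensor_pos.
have [_ _ _ _ kS] := kh.
(* A negative degree is reduced to a positive one by taking adjoints. *)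
rewrite -[tensor dg]starK kS star_tensor; apply: (in_closure_star kphi).
exact: (@in_closure_tensor_pos n.+1).
Qed.

Lemma cnorm_S2_crossed x : (cnorm (kappa (S2_crossed x)))%:E = rep_norm x.
Proof. by have [_ -> _] := hkappa; exact: rep_norm_S2_crossed. Qed.

Lemma S2_crossed_comp_star_hom : star_hom (kappa \o S2_crossed).
Proof. exact: kphi. Qed.

End Dense.

End SphereCrossed.

(** * Isomorphism of the envelopes *)

Theorem theorem3p3 (R : realType) (q r : {posnum R}) (q_lt1 : q%:num < 1) :
  compact [set: S2spec q r] /\
  exists (beta_paction : is_paction (dual_paction q r))
         (theta_pauto : is_pauto (S2theta q r))
         (Theta_paction : is_paction (pa_of_pauto (S2theta q r))),
  let dual_crossed := crossed (Paction beta_paction) in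
  let covariance := crossed (Paction Theta_paction) in
  pauto_J (S2theta q r) = setT /\
  same_paction (pa_of_pauto (S2theta q r)) (dual_paction q r) /\
  has_envelope (S2qr q r) /\
  has_envelope covariance /\
  has_envelope dual_crossed /\
  envelopes_isomorphic (S2qr q r) covariance /\
  envelopes_isomorphic covariance dual_crossed.
Proof.
split; first exact: S2spec_compact.
exists (dual_is_paction r q_lt1), (theta_is_pauto r q_lt1), (theta_is_paction r q_lt1).
set P := Paction (dual_is_paction r q_lt1); set P' := Paction (theta_is_paction r q_lt1).
have hP : same_paction P (dual_paction q r) by split.
have hP' : same_paction P' (dual_paction q r) := same_theta r q_lt1.
move=> /=; split; first exact: theta_setT.
split; first exact: hP'.
split; first exact: S2_has_envelope.
split; first exact: crossed_has_envelope hP'.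
split; first exact: crossed_has_envelope hP.
split=> E F iota kappa hi hk.
  have [ih ni di] := hi.
  (* A has dense images in E and in F, and both norms restrict to its representation norm. *)
  apply: (star_iso_dense ih (S2_crossed_comp_star_hom q_lt1 hP' hk) di (S2_crossed_dense q_lt1 hP' hk)) => x.
  by apply: EFin_inj; rewrite ni -(cnorm_S2_crossed q_lt1 hP' hk).
(* The two crossed products are compared through A: both envelopes are completions of A in its
   representation norm. *)
apply: (star_iso_dense (S2_crossed_comp_star_hom q_lt1 hP' hi) (S2_crossed_comp_star_hom q_lt1 hP hk)
  (S2_crossed_dense q_lt1 hP' hi) (S2_crossed_dense q_lt1 hP hk)) => x.
by apply: EFin_inj; rewrite (cnorm_S2_crossed q_lt1 hP hk) (cnorm_S2_crossed q_lt1 hP' hi).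
Qed.
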